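(* The tilting graph $\mathcal{G}(\mathcal{T}^{\nu}_{\mathbb{X}})$ of tilting bundles in $\mathrm{coh}\text{-}\mathbb{X}(p,q)$ coincides with the graph $\Lambda_{(p,q)}$; that is, the map $\varphi: T\mapsto(c_1,\dots,c_p)$ is an isomorphism of graphs $\mathcal{G}(\mathcal{T}^{\nu}_{\mathbb{X}})\to\Lambda_{(p,q)}$.
   Context: Sheaves. Let $\mathbf{k}$ be an algebraically closed field and $1\le p\le q$ integers. $\mathbb{L}(p,q)$ is the abelian group on generators $\vec{x}_1,\vec{x}_2$ with relation $p\vec{x}_1=q\vec{x}_2=:\vec{c}$. $S=\mathbf{k}[x_1,x_2]$ is $\mathbb{L}(p,q)$-graded with $\deg x_i=\vec{x}_i$. $\mathrm{coh}\text{-}\mathbb{X}(p,q)$ is the quotient of the category of finitely generated $\mathbb{L}(p,q)$-graded $S$-modules by the Serre subcategory of finite dimensional modules; $\mathcal{O}$ is the image of $S$ and $\mathcal{O}(\vec{x})$ its grading shifts. The indecomposable vector bundles are exactly the line bundles $\mathcal{O}(\vec{x})$, $\vec{x}\in\mathbb{L}(p,q)$. A sheaf $T$ is tilting if $\mathrm{Ext}^1(T,T)=0$ and $\mathrm{Hom}(T,X)=0=\mathrm{Ext}^1(T,X)$ implies $X=0$; tilting sheaves are taken multiplicity-free and up to isomorphism, and have exactly $p+q$ indecomposable summands. A tilting bundle is a tilting sheaf which is a vector bundle. The graph $\mathcal{G}(\mathcal{T}^{\nu}_{\mathbb{X}})$ has as vertices the isomorphism classes of tilting bundles; two vertices are joined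 by an edge iff the tilting bundles differ by precisely one indecomposable direct summand. $\Lambda_{(p,q)}$ is the graph with vertex set $\Lambda^0_{(p,q)}=\{(c_1,\dots,c_p)\in\mathbb{Z}^p\mid c_1\le\cdots\le c_p\le c_1+q\}$ and an edge between $(c_1,\dots,c_p)$ and $(d_1,\dots,d_p)$ iff $\sum_{i=1}^p|c_i-d_i|=1$. The identification $\varphi$ of vertices. In the strip $\mathbb{U}=\mathbb{R}\times[0,1]$ let $D^{i/p}_{j/q}$ ($i,j\in\mathbb{Z}$) be the arc joining $(\tfrac{j}{q},0)$ to $(\tfrac{i}{p},1)$, associated with the line bundle $\mathcal{O}(i\vec{x}_1-j\vec{x}_2)$ (the arcs giving a fixed line bundle form one orbit under the translation $(x,y)\mapsto(x+1,y)$). For a tilting bundle $T$ the collection of all arcs $D^{i/p}_{j/q}$ such that $\mathcal{O}(i\vec{x}_1-j\vec{x}_2)$ is a direct summand of $T$ is a triangulation of $\mathbb{U}$ with vertices the points $(\tfrac{i}{p},1)$ and $(\tfrac{j}{q},0)$. For $1\le i\le p$ the boundary segment from $(\tfrac{i-1}{p},1)$ to $(\tfrac{i}{p},1)$ lies in a unique triangle, whose third vertex is $(\tfrac{c_i}{q},0)$ with $c_i\in\mathbb{Z}$; put $\varphi(T)=(c_1,\dots,c_p)$. *)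

(* Defs.v *)
From Stdlib Require Import Classical.
From HB Require Import structures.
From mathcomp Require Import all_boot all_order all_algebra.
From mathcomp Require Import zify.
From mathcomp.multinomials Require Import mpoly.

Set Implicit Arguments.
Unset Strict Implicit.
Unset Printing Implicit Defensive.

Import Order.TTheory GRing.Theory Num.Theory.
Local Open Scope ring_scope.

(* The group L(p,q) is the quotient of Z^2 by the subgroup generated by
   (p, -q).  If 0 < p, the only multiple of (p, -q) that z can be is the one by
   z.1 / p, which makes membership decidable. *)
Definition Lrel (p q : nat) : {pred int * int} :=
  fun z => z == ((p%:Z, - q%:Z) : int * int) *~ (z.1 %/ p%:Z)%Z.

Lemma pairMz (a b n : int) : (a, b) *~ n = (a * n, b * n) :> (int * int).
Proof.
have pairMn (m : nat) : (a, b) *+ m = (a * m%:Z, b * m%:Z) :> (int * int).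
  elim: m => [|m IH]; first by rewrite !mulr0.
  by rewrite mulrS IH; congr pair; rewrite intS mulrDr mulr1.
case: n => m; first exact: pairMn.
rewrite NegzE mulrNz -pmulrn pairMn; congr pair; by rewrite mulrN.
Qed.

Lemma LrelP (p q : nat) (z : int * int) : (0 < p)%N ->
  z \in Lrel p q <-> exists n : int, z = ((p%:Z, - q%:Z) : int * int) *~ n.
Proof.
move=> p0; split=> [/eqP -> | [n ->]]; first by eexists.
rewrite unfold_in; have -> : (((p%:Z, - q%:Z) *~ n).1 %/ p%:Z)%Z = n => //.
by rewrite pairMz /= mulKz //; case: p p0.
Qed.

Lemma Lrel_zmod_closed (p q : nat) : zmod_closed (Lrel p q).
Proof.
case: p => [|p].
  have E z : z \in Lrel 0 q = (z == 0) by rewrite unfold_in divz0 mulr0z.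
  by split=> [|u v]; rewrite !E // => /eqP-> /eqP->; rewrite subr0.
split=> [|u v]; first by apply/LrelP => //; exists 0; rewrite mulr0z.
move=> /(LrelP _ _ (ltn0Sn p)) [m ->] /(LrelP _ _ (ltn0Sn p)) [n ->].
by apply/LrelP => //; exists (m - n); rewrite mulrzBr.
Qed.

HB.instance Definition _ (p q : nat) :=
  GRing.isZmodClosed.Build (int * int)%type (Lrel p q) (Lrel_zmod_closed p q).

Definition LL (p q : nat) : zmodType := {ideal_quot (Lrel p q)}.

Definition vx1 (p q : nat) : LL p q := \pi_({ideal_quot (Lrel p q)})%qT (1, 0).
Definition vx2 (p q : nat) : LL p q := \pi_({ideal_quot (Lrel p q)})%qT (0, 1).

Section Sheaves.
Variables (k : fieldType) (p q : nat).
Local Notation L := (LL p q).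
Local Notation S := {mpoly k[2]}.

Definition mdegL (m : 'X_{1..2}) : L :=
  vx1 p q *+ m ord0 + vx2 p q *+ m ord_max.

Definition homdeg (d : L) (f : S) : Prop :=
  forall m, m \in msupp f -> mdegL m = d.

(* c is the family of homogeneous components of u *)
Definition decomp (V : zmodType) (gr : L -> V -> Prop) (u : V) (c : L -> V) :=
  (forall x, gr x (c x)) /\
  exists s : seq L,
    [/\ uniq s, forall x, x \notin s -> c x = 0 & u = \sum_(x <- s) c x].

(* gr x u : u lies in the component of degree x *)
Record grmod := GrMod {
  gr_mod :> lmodType S;
  gr : L -> gr_mod -> Prop;
  gr0 : forall x, gr x 0;
  grB : forall x u v, gr x u -> gr x v -> gr x (u - v);
  gr_scale : forall d x f u, homdeg d f -> gr x u -> gr (d + x) (f *: u);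
  gr_decomp : forall u, exists c, decomp gr u c;
  gr_uniq : forall u c c', decomp gr u c -> decomp gr u c' -> c =1 c'
}.

Definition fingen (M : grmod) : Prop :=
  exists n (e : 'I_n -> M), forall u, exists a : 'I_n -> S,
    u = \sum_i a i *: e i.

Definition kcomb (M : lmodType S) n (a : 'I_n -> k) (e : 'I_n -> M) : M :=
  \sum_i (a i)%:MP *: e i.

Definition grsub (M : grmod) (U : M -> Prop) : Prop :=
  [/\ U 0, forall f u v, U u -> U v -> U (f *: u + v)
    & forall u c, U u -> decomp (@gr M) u c -> forall x, U (c x)].

Definition findim (M : lmodType S) (U : M -> Prop) : Prop :=
  exists n (e : 'I_n -> M), (forall i, U (e i)) /\
    forall u, U u -> exists a, u = kcomb a e.

Definition cofindim (M : lmodType S) (U : M -> Prop) : Prop :=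
  exists n (e : 'I_n -> M), forall u, exists a, U (u - kcomb a e).

Lemma decomp_ext (V : zmodType) (gr : L -> V -> Prop) u c (s' : seq L) :
  decomp gr u c -> uniq s' -> (forall x, x \notin s' -> c x = 0) ->
  u = \sum_(x <- s') c x.
Proof.
move=> [_ [s [us s0 ->]]] us' s0'.
rewrite (bigID (mem s')) /= [X in _ + X]big1 ?addr0; last by move=> x /s0'.
rewrite [RHS](bigID (mem s)) /=[X in _ = _ + X]big1 ?addr0; last first.
  by move=> x /s0.
rewrite -[LHS]big_filter -[RHS]big_filter; apply: perm_big; apply: uniq_perm.
- exact: filter_uniq.
- exact: filter_uniq.
- by move=> x; rewrite !mem_filter andbC.
Qed.

Section DirectSum.
Variables M N : grmod.

Definition gr_pair (x : L) (u : M * N) := gr x u.1 /\ gr x u.2.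

Lemma decomp_pair (u : M * N) (c : L -> M * N) :
  decomp gr_pair u c <->
  decomp (@gr M) u.1 (fun x => (c x).1) /\ decomp (@gr N) u.2 (fun x => (c x).2).
Proof.
have pairS (s : seq L) : \sum_(x <- s) c x =
    (\sum_(x <- s) (c x).1, \sum_(x <- s) (c x).2).
  elim: s => [|x s IH]; first by rewrite !big_nil.
  by rewrite !big_cons IH; case: (c x).
split=> [[h [s [us s0 e]]] | [d1 d2]].
  split; split; try by move=> x; case: (h x).
  - exists s; split=> // [x xs|]; first by rewrite s0.
    by rewrite e pairS.
  - exists s; split=> // [x xs|]; first by rewrite s0.
    by rewrite e pairS.
have [h1 [s1 [_ z1 _]]] := d1; have [h2 [s2 [_ z2 _]]] := d2.
split; first by move=> x; split.
pose s := undup (s1 ++ s2).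
have zs x : x \notin s -> (c x).1 = 0 /\ (c x).2 = 0.
  by rewrite mem_undup mem_cat negb_or => /andP [/z1 -> /z2 ->].
exists s; split; first exact: undup_uniq.
  by move=> x /zs []; case: (c x) => /= ? ? -> ->.
rewrite pairS -(decomp_ext d1) ?undup_uniq // => [|x /zs []//].
rewrite -(decomp_ext d2) ?undup_uniq // => [|x /zs []//].
by case: u d1 d2.
Qed.

Lemma gr_pair0 x : gr_pair x 0.
Proof. by split; apply: gr0. Qed.

Lemma gr_pairB x u v : gr_pair x u -> gr_pair x v -> gr_pair x (u - v).
Proof. by move=> [? ?] [? ?]; split; apply: grB. Qed.

Lemma gr_pair_scale d x f u : homdeg d f -> gr_pair x u ->
  gr_pair (d + x) (f *: u).
Proof. by move=> ? [? ?]; split; apply: gr_scale. Qed.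

Lemma gr_pair_decomp u : exists c, decomp gr_pair u c.
Proof.
have [c1 h1] := gr_decomp u.1; have [c2 h2] := gr_decomp u.2.
by exists (fun x => (c1 x, c2 x)); apply/decomp_pair.
Qed.

Lemma gr_pair_uniq u c c' :
  decomp gr_pair u c -> decomp gr_pair u c' -> c =1 c'.
Proof.
move=> /decomp_pair [h1 h2] /decomp_pair [h1' h2'] x.
move: (gr_uniq h1 h1' x) (gr_uniq h2 h2' x) => /=.
by case: (c x) (c' x) => [? ?] [? ?] /= -> ->.
Qed.

Definition dsum_mod : grmod :=
  @GrMod (M * N)%type gr_pair gr_pair0 gr_pairB gr_pair_scale
    gr_pair_decomp gr_pair_uniq.

Lemma dsum_fg : fingen M -> fingen N -> fingen dsum_mod.
Proof.
move=> [m [e he]] [n [e' he']].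
exists (m + n)%N, (fun i => match split i with
  | inl j => (e j, 0) | inr j => (0, e' j) end) => u.
have [a ha] := he u.1; have [a' ha'] := he' u.2.
exists (fun i => match split i with inl j => a j | inr j => a' j end).
rewrite big_split_ord /=.
under eq_bigr => i _ do rewrite (unsplitK (inl i)).
under [X in _ + X]eq_bigr => i _ do rewrite (unsplitK (inr i)).
have E1 : \sum_i a i *: ((e i, 0) : M * N) = (u.1, 0).
  rewrite ha; elim/big_rec2: _ => // i y z _ ->.
  by congr pair; rewrite /= scaler0 addr0.
have E2 : \sum_i a' i *: ((0, e' i) : M * N) = (0, u.2).
  rewrite ha'; elim/big_rec2: _ => // i y z _ ->.
  by congr pair; rewrite /= scaler0 addr0.
rewrite [X in _ = X + _]E1 [X in _ = _ + X]E2; case: u {ha ha' E1 E2} => u v.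
by congr pair; rewrite /= ?addr0 ?add0r.
Qed.

End DirectSum.

Lemma mdegLD m1 m2 : mdegL (m1 + m2)%MM = mdegL m1 + mdegL m2.
Proof. by rewrite /mdegL !mnmDE !mulrnDr addrACA. Qed.

Lemma homdegP d f : homdeg d f <-> forall m, mdegL m <> d -> f@_m = 0.
Proof.
split=> h m hm.
  by apply: memN_msupp_eq0; apply/negP => /h.
apply/eqP; apply: contraTT hm => /eqP /h; rewrite mcoeff_msupp => ->.
by rewrite eqxx.
Qed.

Lemma homdeg0 d : homdeg d 0.
Proof. by move=> m; rewrite msupp0. Qed.

Lemma homdegB d f g : homdeg d f -> homdeg d g -> homdeg d (f - g).
Proof.
move=> /homdegP hf /homdegP hg; apply/homdegP => m hm.
by rewrite mcoeffB hf // hg // subr0.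
Qed.

Lemma homdegM d e f g : homdeg d f -> homdeg e g -> homdeg (d + e) (f * g).
Proof.
move=> hf hg m /msuppM_le /allpairsP [[m1 m2] /= [/hf <- /hg <- ->]].
exact: mdegLD.
Qed.

Section LineBundle.
Variable x : L.

(* S(x)_y = S_(x + y) *)
Definition gr_line (y : L) (f : S^o) := homdeg (x + y) f.

Lemma gr_line_scale d y f (g : S^o) : homdeg d f -> gr_line y g ->
  gr_line (d + y) (f *: g).
Proof. by rewrite /gr_line addrCA; apply: homdegM. Qed.

Definition hpart (f : S) (d : L) : S :=
  \sum_(m <- msupp f | mdegL m == d) f@_m *: 'X_[m].

Lemma mcoeff_hpart f d m :
  (hpart f d)@_m = if mdegL m == d then f@_m else 0.
Proof.
rewrite /hpart raddf_sum /=.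
under eq_bigr => i _ do rewrite mcoeffZ mcoeffX.
have [hm|/memN_msupp_eq0 hm] := boolP (m \in msupp f); last first.
  rewrite hm if_same big1 // => i _.
  by case: eqP => [->|_]; rewrite ?mulr0 // hm mul0r.
rewrite big_mkcond (bigD1_seq m) ?msupp_uniq //= eqxx mulr1 big1 ?addr0 //.
by move=> i /negPf ->; rewrite mulr0 if_same.
Qed.

Lemma gr_line_decomp f : exists c, decomp gr_line f c.
Proof.
exists (fun y => hpart f (x + y)); split.
  by move=> y; apply/homdegP => m /eqP /negPf hm; rewrite mcoeff_hpart hm.
exists (undup [seq mdegL m - x | m <- msupp f]); split; first exact: undup_uniq.
  move=> y; rewrite mem_undup => hy; apply/mpolyP => m.
  rewrite mcoeff_hpart mcoeff0; case: eqP => // e.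
  apply: memN_msupp_eq0; apply: contra hy => hm.
  by apply/mapP; exists m; rewrite // e addrAC subrr add0r.
apply/mpolyP => m; rewrite raddf_sum /=.
under eq_bigr => y _ do rewrite mcoeff_hpart.
have [hm|/memN_msupp_eq0 hm] := boolP (m \in msupp f); last first.
  by rewrite hm big1 // => y _; rewrite if_same.
rewrite (bigD1_seq (mdegL m - x)) ?undup_uniq //=; last first.
  by rewrite mem_undup; apply/mapP; exists m.
rewrite [x + _]addrC subrK eqxx big1 ?addr0 // => y hy.
case: eqP => // e; move: hy; rewrite e addrAC subrr add0r.
by rewrite eqxx.
Qed.

Lemma gr_line_uniq f c c' :
  decomp gr_line f c -> decomp gr_line f c' -> c =1 c'.
Proof.
suff H d y m : decomp gr_line f d ->
    (d y)@_m = if mdegL m == x + y then f@_m else 0.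
  by move=> h h' y; apply/mpolyP => m; rewrite !H.
move=> [hd [s [us s0 ->]]].
rewrite raddf_sum /=.
case: eqP => [e|ne]; last exact: (proj1 (homdegP _ _) (hd y)).
have z0 z : z != y -> (d z)@_m = 0.
  move=> /eqP zy; apply: (proj1 (homdegP _ _) (hd z)) => e'.
  by apply: zy; apply: (addrI x); rewrite -e -e'.
have [ys|ys] := boolP (y \in s).
  by rewrite (bigD1_seq y) //= big1 ?addr0.
rewrite s0 // mcoeff0 big1_seq // => z /andP [_ zs].
by apply: z0; apply: contraNneq ys => <-.
Qed.

Definition line_mod : grmod :=
  @GrMod S^o gr_line (fun y => @homdeg0 (x + y))
    (fun y => @homdegB (x + y)) gr_line_scale gr_line_decomp gr_line_uniq.

Lemma line_fg : fingen line_mod.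
Proof.
exists 1%N, (fun=> 1) => u; exists (fun=> u).
by rewrite big_ord1 /GRing.scale /= mulr1.
Qed.

End LineBundle.

Section Zero.
Local Notation Z := 'M[S]_(1, 0).

Lemma zero_decomp (u : Z) : exists c, decomp (fun (_ : L) _ => True) u c.
Proof.
exists (fun=> 0); split=> //; exists [::]; split=> //.
by rewrite big_nil thinmx0.
Qed.

Lemma zero_uniq (u : Z) c c' : decomp (fun (_ : L) _ => True) u c ->
  decomp (fun (_ : L) _ => True) u c' -> c =1 c'.
Proof. by move=> _ _ x; rewrite [c x]thinmx0 [c' x]thinmx0. Qed.

Definition zero_mod : grmod :=
  @GrMod Z (fun _ _ => True) (fun=> I) (fun _ _ _ _ _ => I)
    (fun _ _ _ _ _ _ => I) zero_decomp zero_uniq.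

Lemma zero_fg : fingen zero_mod.
Proof.
exists 0%N, (fun=> 0) => u; exists (fun=> 0).
by rewrite big_ord0 [u]thinmx0.
Qed.

End Zero.

Lemma subspace_basis m (W : 'rV[k]_m -> Prop) :
  W 0 -> (forall a u v, W u -> W v -> W (a *: u + v)) ->
  exists r (b : 'I_r -> 'rV[k]_m), (forall i, W (b i)) /\
    forall v, W v -> exists c : 'I_r -> k, v = \sum_i c i *: b i.
Proof.
move=> W0 WZ.
suff claim d r (A : 'M[k]_(r, m)) : (forall i, W (row i A)) ->
    (m - \rank A < d)%N -> exists r (b : 'I_r -> 'rV[k]_m),
    (forall i, W (b i)) /\
    forall v, W v -> exists c : 'I_r -> k, v = \sum_i c i *: b i.
  apply: (claim m.+1 0%N 0); first by case.
  exact: leq_ltn_trans (leq_subr _ _) _.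
elim: d r A => // d IH r A hA hd.
case: (classic (forall v, W v -> (v <= A)%MS)) => [all | nall].
  exists r, (fun i => row i A); split=> // v /all /submxP [D ->].
  by exists (fun i => D 0 i); rewrite mulmx_sum_row.
have [v nv] := not_all_ex_not _ _ nall.
have [Wv /negP vA] := imply_to_and _ _ nv.
apply: (IH _ (col_mx A v)).
  move=> i; case: (split_ordP i) => j ->.
    by rewrite rowKu.
  by rewrite rowKd [j]ord1 row_id.
have lt : (\rank A < \rank (col_mx A v))%N.
  rewrite -addsmxE; apply: rank_ltmx.
  by rewrite /ltmx addsmxSl /= addsmx_sub submx_refl /= (negPf vA).
have := rank_leq_col (col_mx A v).
by move: lt hd; clear; move: (\rank _) (\rank _) => a b; lia.
Qed.

Section Relations.
Variables M N : grmod.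

(* A graded submodule R of M (+) N is the same thing as a degree preserving
   homomorphism M' -> N/N', where M' is the domain of R and
   N' = {v | R 0 v}. *)
Definition grrel (R : M -> N -> Prop) : Prop :=
  grsub (M := dsum_mod M N) (fun u => R u.1 u.2).

Definition dom (R : M -> N -> Prop) (u : M) : Prop := exists v, R u v.
Definition indet (R : M -> N -> Prop) (v : N) : Prop := R 0 v.

Lemma grrel0 R : grrel R -> R 0 0.
Proof. by case. Qed.

Lemma grrelZ R f u u' v v' :
  grrel R -> R u v -> R u' v' -> R (f *: u + u') (f *: v + v').
Proof. by case=> _ h _; apply: (h f (u, v) (u', v')). Qed.

Lemma grrelB R u u' v v' : grrel R -> R u v -> R u' v' -> R (u - u') (v - v').
Proof.
move=> hR h h'; rewrite [u - _]addrC [v - _]addrC -!scaleN1r.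
exact: grrelZ.
Qed.

Lemma grrel_decomp R u v c d : grrel R -> R u v ->
  decomp (@gr M) u c -> decomp (@gr N) v d -> forall x, R (c x) (d x).
Proof.
case=> _ _ h Ruv hc hd; apply: (h (u, v) (fun x => (c x, d x)) Ruv).
exact/decomp_pair.
Qed.

Lemma grrel_kcomb R n (a : 'I_n -> k) u v : grrel R ->
  (forall i, R (u i) (v i)) -> R (kcomb a u) (kcomb a v).
Proof.
move=> hR h; rewrite /kcomb; elim/big_rec2: _ => [|i y z _ Rzy].
  exact: grrel0.
exact: grrelZ.
Qed.

End Relations.

Definition relcomp (X Y Z : Type) (R : X -> Y -> Prop) (Q : Y -> Z -> Prop) :=
  fun u w => exists v, R u v /\ Q v w.

Lemma grrel_comp (X Y Z : grmod) (R : X -> Y -> Prop) (Q : Y -> Z -> Prop) :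
  grrel R -> grrel Q -> grrel (relcomp R Q).
Proof.
move=> hR hQ; split.
- by exists 0; split; apply: grrel0.
- move=> f [u u'] [v v'] [w [h1 h2]] [w' [h1' h2']].
  by exists (f *: w + w'); split; apply: grrelZ.
- move=> [u u'] c [w [h1 h2]] /decomp_pair [d1 d2] x.
  have [e he] := gr_decomp w; exists (e x); split.
    exact: (grrel_decomp hR h1 d1 he).
  exact: (grrel_decomp hQ h2 he d2).
Qed.

Lemma kcomb_cat (M : lmodType S) m n (a : 'I_m -> k) (b : 'I_n -> k)
    (e : 'I_m -> M) (f : 'I_n -> M) :
  kcomb (fun i => match split i with inl j => a j | inr j => b j end)
        (fun i => match split i with inl j => e j | inr j => f j end)
  = kcomb a e + kcomb b f.
Proof.
rewrite /kcomb big_split_ord /=.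
under eq_bigr => i _ do rewrite (unsplitK (inl i)).
by under [X in _ + X]eq_bigr => i _ do rewrite (unsplitK (inr i)).
Qed.

Section RowCombination.
Variables (M : lmodType S) (m : nat) (e : 'I_m -> M).

Definition rcomb (b : 'rV[k]_m) : M := kcomb (fun j => b 0 j) e.

Lemma rcombZ a b b' : rcomb (a *: b + b') = a%:MP *: rcomb b + rcomb b'.
Proof.
rewrite /rcomb /kcomb scaler_sumr -big_split /=; apply: eq_bigr => i _.
by rewrite !mxE mpolyCD mpolyCM scalerDl scalerA.
Qed.

Lemma rcomb0 : rcomb 0 = 0.
Proof.
by rewrite /rcomb /kcomb big1 // => i _; rewrite mxE mpolyC0 scale0r.
Qed.

Lemma rcomb_sum r (c : 'I_r -> k) (b : 'I_r -> 'rV[k]_m) :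
  rcomb (\sum_i c i *: b i) = kcomb c (fun i => rcomb (b i)).
Proof.
rewrite /(kcomb c); elim/big_rec2: _ => [|i y z _ <-]; first exact: rcomb0.
exact: rcombZ.
Qed.

Lemma rcomb_row (a : 'I_m -> k) : rcomb (\row_j a j) = kcomb a e.
Proof. by apply: eq_bigr => i _; rewrite mxE. Qed.

End RowCombination.

Section Composition.
Variables (X Y Z : grmod) (R : X -> Y -> Prop) (Q : Y -> Z -> Prop).
Hypotheses (hR : grrel R) (hQ : grrel Q).

Lemma cofindim_comp :
  cofindim (dom R) -> cofindim (dom Q) -> cofindim (dom (relcomp R Q)).
Proof.
move=> [n [e he]] [m [f hf]].
pose W b := exists uw : X * Y, R uw.1 uw.2 /\ dom Q (uw.2 - rcomb f b).
have W0 : W 0.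
  exists 0; split; first exact: grrel0.
  by exists 0; rewrite rcomb0 subr0; apply: grrel0.
have WZ a b b' : W b -> W b' -> W (a *: b + b').
  move=> [[u w] /= [h1 [v h2]]] [[u' w'] /= [h1' [v' h2']]].
  exists (a%:MP *: u + u', a%:MP *: w + w'); split; first exact: grrelZ.
  exists (a%:MP *: v + v'); rewrite rcombZ opprD addrACA -scalerBr.
  exact: grrelZ.
have [r [b [Wb bgen]]] := subspace_basis W0 WZ.
have [uw huw] := fin_all_exists Wb.
have [v hv] := fin_all_exists (fun i => (huw i).2).
exists (n + r)%N,
  (fun i => match split i with inl j => e j | inr j => (uw j).1 end) => u.
have [a [w Rw]] := he u; have [a' [z Qz]] := hf w.
have [|c hc] := bgen (\row_j a' j).
  by exists (u - kcomb a e, w); split=> //; exists z; rewrite rcomb_row.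
exists (fun i => match split i with inl j => a j | inr j => c j end).
rewrite kcomb_cat opprD addrA.
exists (z - kcomb c v), (w - kcomb c (fun i => (uw i).2)); split.
  by apply: grrelB => //; apply: grrel_kcomb => // i; case: (huw i).
have -> : w - kcomb c (fun i => (uw i).2) =
    (w - kcomb a' f) - kcomb c (fun i => (uw i).2 - rcomb f (b i)).
  have -> : kcomb c (fun i => (uw i).2 - rcomb f (b i)) =
      kcomb c (fun i => (uw i).2) - rcomb f (\sum_i c i *: b i).
    rewrite rcomb_sum /kcomb -sumrB; apply: eq_bigr => i _.
    by rewrite scalerBr.
  rewrite -hc rcomb_row; set A := w; set B := kcomb a' f.
  by rewrite opprB addrA subrK.
by apply: grrelB => //; apply: grrel_kcomb.
Qed.

Lemma findim_comp :
  findim (indet R) -> findim (indet Q) -> findim (indet (relcomp R Q)).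
Proof.
move=> [m [f [hf fgen]]] [n [g [hg ggen]]].
pose W b := dom Q (rcomb f b).
have W0 : W 0 by exists 0; rewrite rcomb0; apply: grrel0.
have WZ a b b' : W b -> W b' -> W (a *: b + b').
  move=> [v h] [v' h']; exists (a%:MP *: v + v'); rewrite rcombZ.
  exact: grrelZ.
have [r [b [Wb bgen]]] := subspace_basis W0 WZ.
have [z hz] := fin_all_exists Wb.
have Rf a : R 0 (kcomb a f).
  have -> : (0 : X) = kcomb a (fun=> 0).
    by rewrite /kcomb big1 // => i _; rewrite scaler0.
  exact: grrel_kcomb.
exists (r + n)%N,
  (fun i => match split i with inl j => z j | inr j => g j end); split.
  move=> i; case: (split i) => j.
    by exists (rcomb f (b j)); split; [exact: Rf | exact: hz].
  by exists 0; split; [exact: grrel0 | exact: hg].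
move=> v [w [/fgen [a ->] h2]].
have [|c hc] := bgen (\row_j a j); first by exists v; rewrite rcomb_row.
have h3 : Q (kcomb a f) (kcomb c z).
  by rewrite -rcomb_row hc rcomb_sum; apply: grrel_kcomb.
have [a' ha'] : exists a', v - kcomb c z = kcomb a' g.
  by apply: ggen; rewrite /indet -(subrr (kcomb a f)); apply: grrelB.
exists (fun i => match split i with inl j => c j | inr j => a' j end).
by rewrite kcomb_cat -ha' addrC subrK.
Qed.

End Composition.

(* The category coh-X(p,q).  Morphisms are, following Gabriel, the elements of
   the colimit of Hom(X', Y/Y') over the X' in X and Y' in Y with X/X' and Y'
   finite dimensional; qhom is the type of representatives and qeq the equality
   of the classes.  Submodules and quotients of finitely generated modules are
   finitely generated, S being noetherian. *)

Record coh := Coh { coh_mod :> grmod; coh_fg : fingen coh_mod }.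

Record qhom (X Y : coh) := QHom {
  qrel :> X -> Y -> Prop;
  qrel_gr : grrel qrel;
  qrel_dom : cofindim (dom qrel);
  qrel_indet : findim (indet qrel)
}.

(* h is the common image of f and g in Hom(X', Y/Y'), for X' and Y' the domain
   and the indeterminacy of h *)
Definition qeq (X Y : coh) (f g : qhom X Y) : Prop :=
  exists h : qhom X Y, forall u, dom h u ->
    [/\ dom f u, dom g u, forall v, f u v -> h u v & forall v, g u v -> h u v].

Definition qcomp (X Y Z : coh) (g : qhom Y Z) (f : qhom X Y) : qhom X Z :=
  @QHom X Z (relcomp f g) (grrel_comp (qrel_gr f) (qrel_gr g))
    (cofindim_comp (qrel_gr f) (qrel_gr g) (qrel_dom f) (qrel_dom g))
    (findim_comp (qrel_gr f) (qrel_gr g) (qrel_indet f) (qrel_indet g)).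

Lemma cofindim_all (M : grmod) (U : M -> Prop) : (forall u, U u) -> cofindim U.
Proof. by move=> h; exists 0%N, (fun=> 0) => u; exists (fun=> 0). Qed.

Lemma findim_zero (M : grmod) (U : M -> Prop) :
  (forall u, U u -> u = 0) -> findim U.
Proof.
move=> h; exists 0%N, (fun=> 0); split; first by case.
by move=> u /h ->; exists (fun=> 0); rewrite /kcomb big_ord0.
Qed.

Section IdZero.
Variables X Y : coh.

Lemma id_gr : grrel (fun u v : X => u = v).
Proof.
split=> //; first by move=> f [u u'] [v v'] /= -> ->.
move=> [u u'] c /= e /decomp_pair /= [d1 d2] x; move: d1; rewrite e => d1.
exact: (gr_uniq d1 d2).
Qed.

Lemma id_dom : cofindim (dom (fun u v : X => u = v)).
Proof. by apply: cofindim_all => u; exists u. Qed.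

Lemma id_indet : findim (indet (fun u v : X => u = v)).
Proof. by apply: findim_zero. Qed.

Definition qid : qhom X X := QHom id_gr id_dom id_indet.

Lemma zero_gr : grrel (fun (u : X) (v : Y) => v = 0).
Proof.
split=> //.
  by move=> f [u u'] [v v'] /= -> ->; rewrite scaler0 addr0.
move=> [u u'] c /= e /decomp_pair /= [_ d2] x; move: d2; rewrite e => d2.
apply: (gr_uniq d2 (c' := fun=> 0)); split=> [y|]; first exact: gr0.
by exists [::]; split; rewrite ?big_nil.
Qed.

Lemma zero_dom : cofindim (dom (fun (u : X) (v : Y) => v = 0)).
Proof. by apply: cofindim_all => u; exists 0. Qed.

Lemma zero_indet : findim (indet (fun (u : X) (v : Y) => v = 0)).
Proof. exact: findim_zero. Qed.

Definition qzero : qhom X Y := QHom zero_gr zero_dom zero_indet.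

End IdZero.

Definition qiso (X Y : coh) : Prop := exists (f : qhom X Y) (g : qhom Y X),
  qeq (qcomp g f) (qid X) /\ qeq (qcomp f g) (qid Y).

Definition is_zero (X : coh) : Prop := qeq (qid X) (qzero X X).

Definition hom_vanishes (X Y : coh) : Prop :=
  forall f : qhom X Y, qeq f (qzero X Y).

Definition is_kernel (X Y Z : coh) (i : qhom X Y) (pi : qhom Y Z) : Prop :=
  qeq (qcomp pi i) (qzero X Z) /\
  forall (W : coh) (f : qhom W Y), qeq (qcomp pi f) (qzero W Z) ->
    exists g : qhom W X, qeq (qcomp i g) f /\
      forall g' : qhom W X, qeq (qcomp i g') f -> qeq g' g.

Definition is_cokernel (X Y Z : coh) (i : qhom X Y) (pi : qhom Y Z) : Prop :=
  qeq (qcomp pi i) (qzero X Z) /\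
  forall (W : coh) (f : qhom Y W), qeq (qcomp f i) (qzero X W) ->
    exists g : qhom Z W, qeq (qcomp g pi) f /\
      forall g' : qhom Z W, qeq (qcomp g' pi) f -> qeq g' g.

(* Ext^1(X, Y) = 0: every short exact sequence 0 -> Y -> E -> X -> 0 splits *)
Definition ext1_vanishes (X Y : coh) : Prop :=
  forall (E : coh) (i : qhom Y E) (pi : qhom E X),
    is_kernel i pi -> is_cokernel i pi ->
    exists s : qhom X E, qeq (qcomp pi s) (qid X).

Definition line (x : L) : coh := Coh (line_fg x).
Definition dsum (X Y : coh) : coh := Coh (dsum_fg (coh_fg X) (coh_fg Y)).
Definition dsum_lines (s : seq L) : coh :=
  foldr (fun x => dsum (line x)) (Coh zero_fg) s.

Definition is_summand (X T : coh) : Prop := exists Y, qiso T (dsum X Y).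

(* The indecomposable vector bundles are the line bundles, so that a
   multiplicity-free vector bundle is a sum of pairwise non-isomorphic ones. *)
Definition multfree_bundle (T : coh) : Prop := exists s : seq L,
  qiso T (dsum_lines s) /\
  forall i j : 'I_(size s),
    qiso (line (tnth (in_tuple s) i)) (line (tnth (in_tuple s) j)) -> i = j.

Definition tilting (T : coh) : Prop :=
  ext1_vanishes T T /\
  forall X : coh, hom_vanishes T X -> ext1_vanishes T X -> is_zero X.

Record tilting_bundle := TiltingBundle {
  tb_sheaf :> coh;
  tb_tilting : tilting tb_sheaf;
  tb_multfree_bundle : multfree_bundle tb_sheaf
}.

Definition differ_by_one (T T' : coh) : Prop :=
  exists (s : seq L) (x x' : L), [/\ ~ qiso (line x) (line x'),
    qiso T (dsum_lines (x :: s)) & qiso T' (dsum_lines (x' :: s))].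

(* The arc joining (j/q, 0) to (i/p, 1) belongs to the collection of T *)
Definition has_arc (T : coh) (i j : int) : Prop :=
  is_summand (line (vx1 p q *~ i - vx2 p q *~ j)) T.

End Sheaves.

(* Graphs on the classes of an equivalence relation on vertices *)
Record graph := Graph {
  vertex :> Type;
  same : vertex -> vertex -> Prop;
  edge : vertex -> vertex -> Prop
}.

Definition graph_iso (G H : graph) (f : G -> H) : Prop :=
  [/\ forall u v, same u v <-> same (f u) (f v),
      forall w, exists u, same (f u) w
    & forall u v, edge u v <-> edge (f u) (f v)].

Definition tilting_graph (k : fieldType) (p q : nat) : graph :=
  @Graph (tilting_bundle k p q) (fun T T' => qiso T T')
    (fun T T' => differ_by_one T T').

Definition Lambda_vertex (p q : nat) (c : p.-tuple int) : bool :=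
  sorted <=%R c && (last 0 c <= head 0 c + q%:Z).

Definition Lambda (p q : nat) : graph :=
  @Graph {c : p.-tuple int | Lambda_vertex q c} eq
    (fun c d => \sum_(i < p) `|tnth (val c) i - tnth (val d) i| = 1).

(* Marked points of the strip; all of them have rational coordinates. *)
Definition top (p : nat) (i : int) : rat * rat := (i%:~R / p%:R, 1).
Definition bot (q : nat) (j : int) : rat * rat := (j%:~R / q%:R, 0).

(* P and Q are joined by a boundary segment or by an arc of the collection of
   T *)
Definition side (k : fieldType) (p q : nat) (T : coh k p q) (P Q : rat * rat) :=
  [\/ exists i, P = top p (i - 1) /\ Q = top p i,
      exists j, P = bot q (j - 1) /\ Q = bot q j
    | exists i j, [/\ has_arc T i j, P = bot q j & Q = top p i]].

Definition joined (k : fieldType) (p q : nat) (T : coh k p q) P Q :=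
  side T P Q \/ side T Q P.

Definition triangle (k : fieldType) (p q : nat) (T : coh k p q) P Q R :=
  [/\ joined T P Q, joined T Q R & joined T P R].

(* The i-th entry of phi T, for 1 <= i <= p, has index i - 1 in the tuple. *)
Definition is_phi (k : fieldType) (p q : nat)
    (phi : tilting_graph k p q -> Lambda p q) : Prop :=
  forall (T : tilting_graph k p q) (i : 'I_p) (R : rat * rat),
    triangle T (top p i%:Z) (top p (i%:Z + 1)) R <->
    R = bot q (tnth (val (phi T)) i).

(* Main.v *)
Require Import Defs.
From Stdlib Require Import Classical ClassicalEpsilon Setoid Morphisms.
From HB Require Import structures.
From mathcomp Require Import all_boot all_order all_algebra.
From mathcomp Require Import zify ring.
From mathcomp.multinomials Require Import mpoly.

(* Hom and Ext^1 from a line bundle O(x) to a module M are computed by the Cech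
   complex of the charts x_1 <> 0 and x_2 <> 0, in degree - x.  Hence Ext^1
   between O(i x_1 - j x_2) and O(i' x_1 - j' x_2) is nonzero exactly if the
   arcs cross, that is i' < i and j < j', so that the set A of all (i, j) with
   O(i x_1 - j x_2) a summand of a tilting bundle T is a chain of Z x Z which is
   invariant under (p, q).  Testing T against S/(x_b) shows that A meets every
   column and every row, and testing it against line bundles excludes diagonal
   steps; so A is a staircase, determined by the heights c_i of its horizontal
   steps, and (c_1, ..., c_p) is phi T.  Conversely, if Hom and Ext^1 into M
   vanish on a staircase, the Koszul sequences of x_1, x_2 propagate this to all
   points above it, which forces M to be finite dimensional; so every staircase
   gives a tilting bundle.  Replacing one summand of T flips one corner of the
   staircase, that is, changes one c_i by 1. *)

Set Implicit Arguments.
Unset Strict Implicit.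
Unset Printing Implicit Defensive.

Import Order.TTheory GRing.Theory Num.Theory.
Local Open Scope ring_scope.

(** * The grading group *)

(** Morphisms are relations and Ext^1 is defined through splittings, so no long exact sequence and
    no derived functor is at hand. One principle replaces them: a graded submodule of a finitely
    generated module has finite codimension exactly if powers of x_1 and of x_2 push each element
    into it, and the elements of a finite dimensional one are killed by such powers. Equality of
    morphisms, exactness and vanishing thus become identities that hold, for each b, after
    multiplication by some x_b ^ N. No localization is formed: sections on the charts are numerators
    with a common exponent. For Ext^1 two constructions are needed: H^1 = 0 yields splittings by
    correcting local lifts, and the splitting of one explicit extension, a pushout of a Koszul
    sequence, yields H^1 = 0. Since arbitrary isomorphisms of the quotient category occur, the list
    of line bundles in T has to be recovered from T itself; this rests on the fact that between two
    different line bundles Hom vanishes in at least one direction. *)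

Section Degrees.
Variables p q : nat.
Local Notation L := (LL p q).

(* Here and below a boolean b selects a variable: x_1 for false, x_2 for
   true. *)
Definition dv (b : bool) : L := if b then vx2 p q else vx1 p q.

Definition el (a b : int) : L := vx1 p q *~ a + vx2 p q *~ b.

Lemma LL_piE (a b : int) :
  \pi_({ideal_quot (Lrel p q)})%qT (a, b) = el a b :> L.
Proof.
rewrite /el /vx1 /vx2 -!raddfMz -raddfD /= !pairMz /= !mul0r !mul1r.
by congr (\pi _)%qT; congr pair; rewrite /= ?addr0 ?add0r.
Qed.

Lemma el_surj (z : L) : exists a b, z = el a b.
Proof. by elim/quotW: z => -[a b]; exists a, b; apply: LL_piE. Qed.

Lemma elD a b a' b' : el a b + el a' b' = el (a + a') (b + b').
Proof. by rewrite /el !mulrzDr addrACA. Qed.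

Lemma elN a b : - el a b = el (- a) (- b).
Proof. by rewrite /el !mulrNz opprD. Qed.

Lemma elMn a b n : el a b *+ n = el (a * n%:Z) (b * n%:Z).
Proof. by rewrite /el mulrnDl !mulrzA !pmulrn. Qed.

Lemma elMz a b n : el a b *~ n = el (a * n) (b * n).
Proof. by rewrite /el mulrzDl !mulrzA. Qed.

Lemma el00 : 0 = el 0 0.
Proof. by rewrite /el !mulr0z addr0. Qed.

Lemma dv_el b : dv b = if b then el 0 1 else el 1 0.
Proof. by case: b; rewrite /el mulr0z ?add0r ?addr0 mulr1z. Qed.

Lemma mdegL_el m : mdegL p q m = el (m ord0) (m ord_max).
Proof. by rewrite /mdegL !pmulrn. Qed.

Hypothesis p_gt0 : (0 < p)%N.

Lemma el_eq0 (a b : int) : el a b = 0 <->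
  exists t : int, a = t * p%:Z /\ b = - (t * q%:Z).
Proof.
rewrite -LL_piE -(raddf0 (\pi_({ideal_quot (Lrel p q)})%qT)).
have H : (\pi_({ideal_quot (Lrel p q)})%qT (a, b) =
   \pi_({ideal_quot (Lrel p q)})%qT (0 : int * int) :> L) <->
   (a,b) \in Lrel p q.
  by split=> [/eqP|h]; [|apply/eqP]; rewrite -Quotient.idealrBE subr0.
apply: (iff_trans H); apply: (iff_trans (LrelP _ _ p_gt0)).
split=> -[t].
  by rewrite pairMz => -[-> ->]; exists t; split; lia.
by move=> [-> ->]; exists t; rewrite pairMz; congr pair; lia.
Qed.

Lemma el_eq a b a' b' : el a b = el a' b' <->
  exists t : int, a = a' + t * p%:Z /\ b = b' - t * q%:Z.
Proof.
have E : el a b - el a' b' = el (a - a') (b - b') by rewrite elN elD.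
split.
  move=> /eqP; rewrite -subr_eq0 E => /eqP /el_eq0 [t [h1 h2]].
  by exists t; split; lia.
move=> [t [h1 h2]]; apply/eqP; rewrite -subr_eq0 E; apply/eqP/el_eq0.
by exists t; split; lia.
Qed.

Hypothesis q_gt0 : (0 < q)%N.

(** The group L may have torsion, but each generator has infinite order: a multiple of (p, -q) with
    one coordinate zero is zero. *)
Lemma dvMn_inj b (y : L) : injective (fun n => dv b *+ n + y).
Proof.
move=> m n /= /addIr; rewrite dv_el.
by case: b; rewrite !elMn => /el_eq [t [h1 h2]]; move: h1 h2; nia.
Qed.

End Degrees.

(** Settles equalities of degrees that already hold between the chosen representatives in Z^2;
    whatever uses the relation p x_1 = q x_2 goes through [el_eq0] or [el_eq]. *)
Ltac el_solve :=
  rewrite ?dv_el /= ?el00 ?(elMn, elMz, elN, elD); congr (el _ _ _ _); lia.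

Arguments dv : simpl never.

(** * Polynomials in two variables *)

Section Variables.
Variables (k : fieldType).
Local Notation S := {mpoly k[2]}.

Definition iv (b : bool) : 'I_2 := if b then ord_max else ord0.

Definition xv (b : bool) : S := 'X_(iv b).

Lemma xv_pow b n : xv b ^+ n = 'X_[(U_(iv b) *+ n)%MM].
Proof. by rewrite /xv mpolyXn. Qed.

Lemma xvM (b : bool) n (m : nat) : xv b ^+ n * xv b ^+ m = xv b ^+ (n + m).
Proof. by rewrite exprD. Qed.

Lemma xv_neq0 b n : xv b ^+ n != 0.
Proof.
rewrite xv_pow; apply/eqP => /(congr1 (fun f => f@_(U_(iv b) *+ n)%MM)).
by rewrite mcoeffX eqxx mcoeff0 => /eqP; rewrite oner_eq0.
Qed.

Lemma mnm2P (m m' : 'X_{1..2}) b : m (iv b) = m' (iv b) ->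
  m (iv (~~ b)) = m' (iv (~~ b)) -> m = m'.
Proof.
move=> h1 h2; apply/mnmP => -[[|[|//]] hi].
  have -> : Ordinal hi = iv false by apply: val_inj.
  by case: b h1 h2.
have -> : Ordinal hi = iv true by apply: val_inj.
by case: b h1 h2.
Qed.

Lemma mulmUn b n b' : (U_(iv b) *+ n)%MM (iv b') = (n * (b == b'))%N.
Proof.
rewrite mulmnE mnm1E mulnC; congr (_ * nat_of_bool _)%N.
by case: b; case: b'.
Qed.

Lemma mcoeffMxv (f : S) b n (m : 'X_{1..2}) :
  (xv b ^+ n * f)@_m =
    if (n <= m (iv b))%N then f@_(m - U_(iv b) *+ n)%MM else 0.
Proof.
rewrite xv_pow mulrC; case: leqP => h.
  have {1}-> : m = (U_(iv b) *+ n + (m - U_(iv b) *+ n))%MM.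
    by apply: (@mnm2P _ _ b); rewrite mnmDE mnmBE !mulmUn; case: b h => /=; lia.
  by rewrite mcoeffMX.
apply: memN_msupp_eq0; rewrite (perm_mem (msuppMX _ _)).
apply/negP => /mapP [m' _ e]; move: h.
by rewrite e mnmDE mulmUn eqxx; lia.
Qed.

Lemma xv_dvd (f : S) b n : (forall m : 'X_{1..2},
  (m (iv b) < n)%N -> f@_m = 0) ->
  exists g, f = xv b ^+ n * g.
Proof.
move=> h; exists (\sum_(m <- msupp f) f@_m *: 'X_[m - U_(iv b) *+ n]).
rewrite {1}[f]mpolyE mulr_sumr; apply: eq_big_seq => m.
rewrite mcoeff_msupp => hm; rewrite -scalerAr xv_pow -mpolyXD.
congr (_ *: 'X_[_]); apply: (@mnm2P _ _ b); rewrite mnmDE mnmBE !mulmUn.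
  have : (n <= m (iv b))%N by rewrite leqNgt; apply: contra hm => /h ->.
  by case: b h => /=; lia.
by case: b {h} => /=; lia.
Qed.

(** Powers of the two variables form a regular sequence. The coefficient of f at m reappears in the
    sum at m + n e_b, where the second summand contributes nothing if m has exponent below n' in the
    other variable; so that power divides f, and g follows by cancellation. *)
Lemma koszul (f g : S) b n n' : xv b ^+ n * f + xv (~~ b) ^+ n' * g = 0 ->
  exists h, f = xv (~~ b) ^+ n' * h /\ g = - (xv b ^+ n * h).
Proof.
move=> e; have [|h eh] := @xv_dvd f (~~ b) n'.
  move=> m hm; have := congr1 (fun f => f@_(m + U_(iv b) *+ n)%MM) e.
  rewrite mcoeffD !mcoeffMxv !mnmDE !mulmUn eqxx mcoeff0.
  rewrite ifT; last by lia.
  rewrite addmK ifF ?addr0 //.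
  by apply/negbTE; rewrite -ltnNge; case: b hm {e} => /=; lia.
exists h; split=> //; apply/eqP; rewrite -subr_eq0 opprK.
have : xv (~~ b) ^+ n' * (g + xv b ^+ n * h) == 0.
  by rewrite mulrDr -e eh; apply/eqP; ring.
by rewrite mulf_eq0 (negPf (xv_neq0 _ _)).
Qed.

(** A source of nonvanishing: it makes the Cech class of 1 / (x_1 ^ a x_2 ^ b) nonzero in [H1_lineP]
    and S / (x_b) nonzero as a sheaf in [torsion_nonzero]. *)
Lemma xv_pow_nmem b n n' (f g : S) (m : 'X_{1..2}) :
  (m (iv b) < n)%N -> (m (iv (~~ b)) < n')%N ->
  'X_[m] <> xv b ^+ n * f + xv (~~ b) ^+ n' * g.
Proof.
move=> h1 h2 /(congr1 (fun f => f@_m)); rewrite mcoeffX eqxx.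
rewrite mcoeffD !mcoeffMxv leqNgt h1 leqNgt h2 /= addr0 => /eqP.
by rewrite oner_eq0.
Qed.

End Variables.

Arguments iv : simpl never.

(** * Graded modules *)

Section LinearSubsets.
Variables (k : fieldType) (M : lmodType {mpoly k[2]}).
Local Notation S := {mpoly k[2]}.

Definition linsub (U : M -> Prop) : Prop :=
  U 0 /\ forall f u v, U u -> U v -> U (f *: u + v).

Variable U : M -> Prop.
Hypothesis hU : linsub U.

Lemma linsub0 : U 0. Proof. by case: hU. Qed.

Lemma linsubZ f u : U u -> U (f *: u).
Proof. by move=> h; rewrite -[_ *: _]addr0; apply: (proj2 hU) => //;
  apply: linsub0. Qed.

Lemma linsubD u v : U u -> U v -> U (u + v).
Proof. by move=> h h'; rewrite -[u]scale1r; apply: (proj2 hU). Qed.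

Lemma linsubN u : U u -> U (- u).
Proof. by move=> h; rewrite -scaleN1r; apply: linsubZ. Qed.

Lemma linsubB u v : U u -> U v -> U (u - v).
Proof. by move=> h h'; apply: linsubD => //; apply: linsubN. Qed.

Lemma linsub_sum I (r : seq I) (P : pred I) (F : I -> M) :
  (forall i, P i -> U (F i)) -> U (\sum_(i <- r | P i) F i).
Proof. by move=> h; elim/big_ind: _ => //; [exact: linsub0 | exact: linsubD].
  Qed.

End LinearSubsets.

Section GradedModules.
Variables (k : fieldType) (p q : nat).
Local Notation L := (LL p q).
Local Notation S := {mpoly k[2]}.

Lemma homdeg_X m : homdeg (mdegL p q m) ('X_[m] : S).
Proof. by move=> m'; rewrite msuppX mem_seq1 => /eqP ->. Qed.

Lemma homdegC (c : k) : homdeg (0 : L) (c%:MP : S).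
Proof.
move=> m; rewrite msuppC; case: ifP => // _; rewrite mem_seq1 => /eqP ->.
by rewrite /mdegL !mnm0E !mulr0n addr0.
Qed.

Lemma homdegZ (c : k) (d : L) (f : S) : homdeg d f -> homdeg d (c *: f).
Proof. by move=> h m /msuppZ_le; apply: h. Qed.

Lemma homdegN (d : L) (f : S) : homdeg d f -> homdeg d (- f).
Proof. by move=> h; rewrite -sub0r; apply: homdegB => //; apply: homdeg0. Qed.

Lemma homdegD (d : L) (f g : S) : homdeg d f -> homdeg d g -> homdeg d (f + g).
Proof. by move=> hf hg; rewrite -[g]opprK; apply: homdegB => //;
  apply: homdegN. Qed.

Lemma mdegL_mul b n : mdegL p q (U_(iv b) *+ n)%MM = dv p q b *+ n.
Proof.
by rewrite /mdegL !mulmnE; case: b; rewrite !mnm1E /= ?muln1 ?muln0 ?mul1n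
  ?mul0n;
  rewrite mulr0n ?addr0 ?add0r.
Qed.

Lemma homdeg_xv b n : homdeg (dv p q b *+ n) (xv k b ^+ n).
Proof. by rewrite xv_pow -mdegL_mul; apply: homdeg_X. Qed.

Section One.
Variable M : grmod k p q.
Implicit Types (u v : M) (x : L).

Lemma grN x u : gr x u -> gr x (- u).
Proof. by move=> h; rewrite -sub0r; apply: grB => //; apply: gr0. Qed.

Lemma grD x u v : gr x u -> gr x v -> gr x (u + v).
Proof. by move=> h h'; rewrite -[v]opprK; apply: grB => //; apply: grN. Qed.

Lemma gr_sum x I (r : seq I) (P : pred I) (F : I -> M) :
  (forall i, P i -> gr x (F i)) -> gr x (\sum_(i <- r | P i) F i).
Proof. by move=> h; elim/big_ind: _ => //; [exact: gr0 | exact: grD]. Qed.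

Lemma gr_xv b n x u : gr x u -> gr (dv p q b *+ n + x) (xv k b ^+ n *: u).
Proof. by apply: gr_scale; apply: homdeg_xv. Qed.

Lemma grC (c : k) x u : gr x u -> gr x (c%:MP *: u).
Proof. by move=> h; rewrite -[x]add0r; apply: gr_scale => //;
  apply: homdegC. Qed.

Lemma decomp_seq (s : seq (L * M)) : (forall z, z \in s -> gr z.1 z.2) ->
  decomp (@gr k p q M) (\sum_(z <- s) z.2) (fun x =>
    \sum_(z <- s | z.1 == x) z.2).
Proof.
move=> h; split.
  move=> x; rewrite big_seq_cond; apply: gr_sum => z /andP [zs /eqP <-].
  exact: h.
exists (undup [seq z.1 | z <- s]); split; first exact: undup_uniq.
  move=> x; rewrite mem_undup => hx; rewrite big1_seq // =>
    z /andP [/eqP zx zs].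
  by case/negP: hx; apply/mapP; exists z.
rewrite (exchange_big_dep predT) //=; apply: eq_big_seq => z zs.
rewrite -big_filter (perm_big [:: z.1]) ?big_seq1 //.
apply: uniq_perm => //; first by rewrite filter_uniq ?undup_uniq.
move=> y; rewrite mem_filter mem_seq1 mem_undup eq_sym; case: eqP => //= ->.
by apply/mapP; exists z.
Qed.

Lemma decomp_hom x u (c : L -> M) y : gr x u -> decomp (@gr k p q M) u c ->
  c y = if y == x then u else 0.
Proof.
move=> h hc; have := @decomp_seq [:: (x, u)]; rewrite big_seq1 => H.
rewrite (gr_uniq hc (H _)); last by move=> z; rewrite mem_seq1 => /eqP ->.
by rewrite big_mkcond big_seq1 eq_sym.
Qed.

Lemma decomp_homE x u : gr x u ->
  decomp (@gr k p q M) u (fun y => if y == x then u else 0).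
Proof.
move=> h; have [c hc] := gr_decomp u; split.
  by move=> y; case: eqP => [->//|_]; apply: gr0.
exists [:: x]; split=> //; last by rewrite big_seq1 eqxx.
by move=> y; rewrite mem_seq1 => /negPf ->.
Qed.

Lemma gr_expand u : exists s : seq (L * M),
  (forall z, z \in s -> gr z.1 z.2) /\ u = \sum_(z <- s) z.2.
Proof.
have [c [hc [s [_ _ e]]]] := gr_decomp u.
exists [seq (x, c x) | x <- s]; split; first by move=> z /mapP [x _ ->].
by rewrite big_map.
Qed.

Lemma grsub_linsub (U : M -> Prop) : grsub U -> linsub U.
Proof. by case. Qed.

Lemma grsub_expand (U : M -> Prop) u : grsub U -> U u ->
  exists s : seq (L * M),
    (forall z, z \in s -> gr z.1 z.2 /\ U z.2) /\ u = \sum_(z <- s) z.2.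
Proof.
case=> _ _ hU Uu; have [c hc] := gr_decomp u.
have [h [s [_ _ e]]] := hc.
exists [seq (x, c x) | x <- s]; split; last by rewrite big_map.
by move=> z /mapP [x _ ->]; split=> //=; apply: hU hc x.
Qed.

(** By [gr_uniq] the components of an element can be read off from any expression as a sum of
    homogeneous elements, so a single expression inside U suffices. *)
Lemma grsubI (U : M -> Prop) : linsub U ->
  (forall u, U u -> exists s : seq (L * M),
    (forall z, z \in s -> gr z.1 z.2 /\ U z.2) /\ u = \sum_(z <- s) z.2) ->
  grsub U.
Proof.
move=> hU h; split; [by case: hU | by case: hU | move=> u c /h [s [hs ->]] hc
  x].
rewrite (gr_uniq hc (decomp_seq _)); last by move=> z /hs [].
by rewrite big_seq_cond; apply: linsub_sum => // z /andP [/hs []].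
Qed.

Lemma grsub_comp (U : M -> Prop) (s : seq (L * M)) x : grsub U ->
  (forall z, z \in s -> gr z.1 z.2) -> U (\sum_(z <- s) z.2) ->
  U (\sum_(z <- s | z.1 == x) z.2).
Proof. by case=> _ _ h hs Us; apply: (h _ _ Us (decomp_seq hs)). Qed.

(** Splitting each coefficient into its monomials turns a combination of homogeneous generators into
    a sum of homogeneous elements. *)
Lemma grsub_span (I : finType) (h : I -> M) (d : I -> L) :
  (forall i, gr (d i) (h i)) ->
  grsub (fun u => exists a : I -> S, u = \sum_i a i *: h i).
Proof.
move=> hh; apply: grsubI.
  split; first by exists (fun=> 0); rewrite big1 // => i _; rewrite scale0r.
  move=> f u v [a ->] [b ->]; exists (fun i => f * a i + b i).
  rewrite scaler_sumr -big_split; apply: eq_bigr => i _.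
  by rewrite scalerDl scalerA.
move=> u [a ->]; exists (flatten [seq [seq (mdegL p q m + d i,
  ((a i)@_m *: 'X_[m]) *: h i)
   | m <- msupp (a i)] | i <- index_enum I]).
split.
  move=> z /flatten_mapP [i _ /mapP [m _ ->]] /=; split.
    by apply: gr_scale => //; apply: homdegZ; apply: homdeg_X.
  exists (fun j => if j == i then (a i)@_m *: 'X_[m] else 0).
  rewrite (bigD1 i) //= eqxx big1 ?addr0 // => j /negPf ->.
  by rewrite scale0r.
rewrite big_flatten big_map; apply: eq_bigr => i _.
by rewrite big_map /= -scaler_suml -mpolyE.
Qed.

Lemma grsub_cyclic (h : M) d : gr d h -> grsub (fun u =>
  exists a : S, u = a *: h).
Proof.
move=> gh; have [h0 hZ hD] := @grsub_span _ (fun=> h) (fun _ : 'I_1 =>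
  d) (fun=> gh).
have E u : (exists a : S, u = a *: h) <-> exists a : 'I_1 -> S,
  u = \sum_i a i *: h.
  split=> -[a ->]; [exists (fun=> a) | exists (a ord0)]; by rewrite big_ord1.
split; first exact/E.
  by move=> f u v /E hu /E hv; apply/E; apply: hZ.
by move=> u c /E hu hc x; apply/E; apply: (hD u).
Qed.

End One.

End GradedModules.

(** * Finite codimension tested by powers of the variables *)

Section Powers.
Variables (k : fieldType) (p q : nat).
Local Notation L := (LL p q).
Local Notation S := {mpoly k[2]}.

Lemma xv_mono (M : lmodType S) (A : M -> Prop) b N N' u : linsub A ->
  A (xv k b ^+ N *: u) -> (N <= N')%N -> A (xv k b ^+ N' *: u).
Proof.
by move=> hA h le; rewrite -(subnK le) -xvM -scalerA; apply: linsubZ.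
Qed.

Lemma xv_sum (M : lmodType S) (A : M -> Prop) b (I : eqType) (r : seq I) (F : I
  -> M) :
  linsub A -> (forall i, i \in r -> exists N, A (xv k b ^+ N *: F i)) ->
  exists N, forall i, i \in r -> A (xv k b ^+ N *: F i).
Proof.
move=> hA; elim: r => [|i r IH] h; first by exists 0%N.
have [|N hN] := IH; first by move=> j jr; apply: h; rewrite inE jr orbT.
have [N' hN'] := h i (mem_head _ _).
exists (maxn N N') => j; rewrite inE => /predU1P [->|/hN h'].
  exact: xv_mono hN' (leq_maxr _ _).
exact: xv_mono h' (leq_maxl _ _).
Qed.

Lemma linsub_zero (M : lmodType S) : linsub (fun u : M => u = 0).
Proof. by split=> // f u v -> ->; rewrite scaler0 addr0. Qed.

Lemma grsub_zero (M : grmod k p q) : grsub (fun u : M => u = 0).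
Proof.
apply: grsubI; first exact: linsub_zero.
by move=> u ->; exists [::]; split; rewrite ?big_nil.
Qed.

(** With one exponent N that works for all generators and both variables, only the multiples of the
    n generators by monomials with both exponents below N survive modulo A, and these are n N ^ 2
    elements. *)
Lemma cofindimI (M : lmodType S) (A : M -> Prop) n (e : 'I_n -> M) :
  linsub A -> (forall u, exists a : 'I_n -> S, u = \sum_i a i *: e i) ->
  (forall u b, exists N, A (xv k b ^+ N *: u)) -> cofindim A.
Proof.
move=> hA he h.
have [N hN] : exists N, forall b i, A (xv k b ^+ N *: e i).
  have H b := @xv_sum M A b _ (enum 'I_n) e hA (fun i _ => h (e i) b).
  have [[N1 h1] [N2 h2]] := (H false, H true).
  exists (maxn N1 N2) => b i; case: b.
    by apply: xv_mono (leq_maxr _ _) => //; apply: h2; rewrite mem_enum.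
  by apply: xv_mono (leq_maxl _ _) => //; apply: h1; rewrite mem_enum.
pose T := ('I_n * ('I_N * 'I_N))%type.
pose mn (z : 'I_N * 'I_N) : 'X_{1..2} := (U_(iv false) *+ z.1 + U_(iv true) *+
  z.2)%MM.
pose E (t : T) := 'X_[mn t.2] *: e t.1 : M.
exists #|{: T}|, (fun j => E (enum_val j)) => u.
have [a ->] := he u.
exists (fun j => let t := enum_val j in (a t.1)@_(mn t.2)).
have -> : kcomb (fun j : 'I_#|{: T}| => let t := enum_val j in (a t.1)@_(mn
  t.2))
  (fun j => E (enum_val j)) = \sum_(t : T) ((a t.1)@_(mn t.2))%:MP *: E t.
  rewrite /kcomb [RHS](reindex (@enum_val T (mem {: T}))) //=.
  exact/onW_bij/enum_val_bij.
rewrite -(pair_bigA _ (fun i z => ((a i)@_(mn z))%:MP *: E (i, z))) /= -sumrB.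
apply: linsub_sum => // i _; rewrite /E /=.
have -> : \sum_j ((a i)@_(mn j))%:MP *: ('X_[mn j] *: e i) =
  (\sum_j (a i)@_(mn j) *: 'X_[mn j]) *: e i.
  by rewrite scaler_suml; apply: eq_bigr => j _; rewrite scalerA mul_mpolyC.
rewrite -scalerBl.
(* [f] is the coefficient of [e i] without its monomials in the N by N box, so each remaining
   monomial is divisible by some x_b ^ N. *)
set f := _ - _.
have hf (m : 'X_{1..2}) : (forall b, (m (iv b) < N)%N) -> f@_m = 0.
  move=> hm; have lt0 := hm false; have lt1 := hm true.
  rewrite /f mcoeffB raddf_sum /= (bigD1 (Ordinal lt0, Ordinal lt1)) //=.
  have em (z : 'I_N * 'I_N) : (mn z == m) = (z == (Ordinal lt0, Ordinal lt1)).
    apply/eqP/eqP => [e0|->].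
      have e1 b : m (iv b) = (if b then z.2 else z.1) :> nat.
        by rewrite -e0 mnmDE !mulmUn; case: b; rewrite /= muln1 muln0 ?addn0.
      by case: z {e0} e1 => z1 z2 e1; congr pair; apply: val_inj;
        [apply: (esym (e1 false)) | apply: (esym (e1 true))].
    by apply: (@mnm2P _ _ false); rewrite mnmDE !mulmUn /= muln1 muln0 ?addn0.
  rewrite mcoeffZ mcoeffX em eqxx mulr1.
  have -> : mn (Ordinal lt0, Ordinal lt1) = m by apply/eqP; rewrite em.
  rewrite big1 ?addr0 ?subrr // => z /negPf nz.
  by rewrite mcoeffZ mcoeffX em nz mulr0.
rewrite [f]mpolyE scaler_suml; apply: linsub_sum => // m _.
have [[b hb]|hm] := classic (exists b, (N <= m (iv b))%N); last first.
  rewrite hf ?scale0r ?scale0r; first exact: linsub0.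
  by move=> b; rewrite ltnNge; apply/negP => hb; apply: hm; exists b.
have [g ->] : exists g, 'X_[m] = g * xv k b ^+ N :> S.
  exists 'X_[m - U_(iv b) *+ N]; rewrite xv_pow -mpolyXD; congr 'X_[_].
  by apply: (@mnm2P _ _ b); rewrite mnmDE mnmBE !mulmUn; case: b hb => /=; lia.
by rewrite scalerAl -scalerA; apply: linsubZ.
Qed.

Hypotheses (p_gt0 : (0 < p)%N) (q_gt0 : (0 < q)%N).

(* The elements x_b ^ j u lie in distinct degrees, so that a linear dependence
   of n + 1 of them modulo A puts one of them in A. *)
Lemma xv_pow_mem (M : grmod k p q) (A : M -> Prop) b x u n (e : 'I_n -> M) :
  grsub A -> gr x u ->
  (forall j, exists a, A (xv k b ^+ j *: u - kcomb a e)) ->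
  exists N, A (xv k b ^+ N *: u).
Proof.
move=> hA hu h; have lA := grsub_linsub hA.
have [a ha] := fin_all_exists (fun j : 'I_n.+1 => h j).
pose B := \matrix_(j < n.+1, i < n) a j i.
have : kermx B != 0.
  by rewrite -mxrank_eq0 mxrank_ker -lt0n subn_gt0 ltnS rank_leq_col.
move=> /rowV0Pn [c /sub_kermxP cB c0].
have [j0 cj0] : exists j, c 0 j != 0.
  apply/existsP; apply: contraNT c0; rewrite negb_exists => /forallP c0.
  by apply/eqP/rowP => j; rewrite mxE; apply/eqP/negbNE.
pose s := [seq (dv p q b *+ (j : 'I_n.+1) + x, (c 0 j)%:MP *: (xv k b ^+ j *:
  u))
   | j <- enum 'I_n.+1].
have hs z : z \in s -> gr z.1 z.2.
  by move=> /mapP [j _ ->] /=; apply: grC; apply: gr_xv.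
have As : A (\sum_(z <- s) z.2).
  rewrite big_map big_enum /=.
  have -> : \sum_(j < n.+1) (c 0 j)%:MP *: (xv k b ^+ j *: u) =
    \sum_(j < n.+1) (c 0 j)%:MP *: (xv k b ^+ j *: u - kcomb (a j) e) +
     rcomb e (c *m B).
    rewrite mulmx_sum_row rcomb_sum -big_split; apply: eq_bigr => j _.
    rewrite /= scalerBr; have -> : rcomb e (row j B) = kcomb (a j) e.
      by apply: eq_bigr => i _; rewrite !mxE.
    by rewrite subrK.
  rewrite cB rcomb0 addr0; apply: linsub_sum => // j _.
  exact: linsubZ.
have := grsub_comp (dv p q b *+ j0 + x) hA hs As.
rewrite big_map -big_filter (perm_big [:: j0]); last first.
  apply: uniq_perm => //; first by rewrite filter_uniq ?enum_uniq.
  move=> j; rewrite mem_filter mem_enum mem_seq1 andbT /=.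
  by apply/eqP/eqP => [/(dvMn_inj p_gt0 q_gt0)/val_inj | -> //].
rewrite big_seq1 /= => /(linsubZ lA (c 0 j0)^-1%:MP).
by rewrite !scalerA mulrA -mpolyCM mulVf // mpolyC1 mul1r => ?; exists j0.
Qed.

Lemma cofindim_xv (M : grmod k p q) (A : M -> Prop) b u :
  grsub A -> cofindim A -> exists N, A (xv k b ^+ N *: u).
Proof.
move=> hA [n [e he]]; have lA := grsub_linsub hA.
have [s [hs ->]] := gr_expand u.
have [|N hN] := @xv_sum M A b _ s (fun z => z.2) lA.
  by move=> z /hs hz; apply: (@xv_pow_mem M A b z.1 z.2 n e).
by exists N; rewrite scaler_sumr big_seq_cond; apply: linsub_sum =>
  // z /andP [/hN].
Qed.

(** This is [xv_pow_mem] for the zero submodule: D contains all x_b ^ j u, so its finite spanning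
    family serves for [e]. *)
Lemma findim_xv (M : grmod k p q) (D : M -> Prop) b u :
  grsub D -> findim D -> D u -> exists N, xv k b ^+ N *: u = 0.
Proof.
move=> hD [n [e [_ he]]] Du; have lD := grsub_linsub hD.
have [s [hs ->]] := grsub_expand hD Du.
have [|N hN] := @xv_sum M (fun u => u = 0) b _ s (fun z =>
  z.2) (@linsub_zero M).
  move=> z /hs [hz Dz].
  apply: (@xv_pow_mem M (fun u => u = 0) b z.1 z.2 n e) => //.
    exact: grsub_zero.
  move=> j; have [a ha] := he _ (linsubZ lD (xv k b ^+ j) Dz).
  by exists a; rewrite ha subrr.
by exists N; rewrite scaler_sumr big_seq_cond big1 // => z /andP [/hN].
Qed.

End Powers.

(** * The quotient category *)

Section Relations.
Variables (k : fieldType) (p q : nat).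
Local Notation L := (LL p q).
Local Notation S := {mpoly k[2]}.

Lemma decompD (M : grmod k p q) (u v : M) c d :
  decomp (@gr k p q M) u c -> decomp (@gr k p q M) v d ->
  decomp (@gr k p q M) (u + v) (fun x => c x + d x).
Proof.
move=> hc hd; have [h1 [s1 [_ z1 _]]] := hc; have [h2 [s2 [_ z2 _]]] := hd.
split; first by move=> x; apply: grD.
pose s := undup (s1 ++ s2).
have zs x : x \notin s -> c x = 0 /\ d x = 0.
  by rewrite mem_undup mem_cat negb_or => /andP [/z1 -> /z2 ->].
exists s; split; first exact: undup_uniq.
  by move=> x /zs [-> ->]; rewrite addr0.
rewrite big_split -(decomp_ext hc) ?undup_uniq // => [|x /zs []//].
by rewrite -(decomp_ext hd) ?undup_uniq // => x /zs [].
Qed.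

Lemma decomp0 (M : grmod k p q) : decomp (@gr k p q M) 0 (fun=> 0).
Proof. by split=> [x|]; [exact: gr0 | exists [::]; split;
  rewrite ?big_nil]. Qed.

Lemma findim_ext (M : lmodType S) (U V : M -> Prop) :
  (forall u, U u <-> V u) -> findim U -> findim V.
Proof.
move=> h [n [e [he g]]]; exists n, e; split; first by move=> i; apply/h.
by move=> u /h; apply: g.
Qed.

Definition addset (M : lmodType S) (A B : M -> Prop) : M -> Prop :=
  fun u => exists a b, [/\ A a, B b & u = a + b].

Lemma findim_add (M : lmodType S) (A B : M -> Prop) : A 0 -> B 0 ->
  findim A -> findim B -> findim (addset A B).
Proof.
move=> A0 B0 [m [e [he ge]]] [n [f [hf gf]]].
exists (m + n)%N, (fun i => match split i with inl j => e j | inr j => f j end).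
split.
  move=> i; case: (split i) => j.
    by exists (e j), 0; rewrite addr0.
  by exists 0, (f j); rewrite add0r.
move=> u [a [b [/ge [ca ->] /gf [cb ->] ->]]].
exists (fun i => match split i with inl j => ca j | inr j => cb j end).
by rewrite kcomb_cat.
Qed.

Lemma grsub_add (M : grmod k p q) (A B : M -> Prop) :
  grsub A -> grsub B -> grsub (addset A B).
Proof.
move=> hA hB; have [A0 AZ AD] := hA; have [B0 BZ BD] := hB; split.
- by exists 0, 0; rewrite addr0.
- move=> f u v [a [b [ha hb ->]]] [a' [b' [ha' hb' ->]]].
  exists (f *: a + a'), (f *: b + b'); split; [exact: AZ | exact: BZ |].
  by rewrite scalerDr addrACA.
- move=> u c [a [b [ha hb ->]]] hc x.
  have [ca hca] := gr_decomp a; have [cb hcb] := gr_decomp b.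
  rewrite (gr_uniq hc (decompD hca hcb)).
  by exists (ca x), (cb x); split=> //; [apply: AD hca x | apply: BD hcb x].
Qed.

Section Two.
Variables M N : grmod k p q.
Variable R : M -> N -> Prop.
Hypothesis hR : grrel R.

Lemma grrelS f u v : R u v -> R (f *: u) (f *: v).
Proof.
move=> h; rewrite -[f *: u]addr0 -[f *: v]addr0; apply: grrelZ => //.
exact: grrel0.
Qed.

Lemma grrelD u v u' v' : R u v -> R u' v' -> R (u + u') (v + v').
Proof. by move=> h h'; rewrite -[u]scale1r -[v]scale1r; apply: grrelZ. Qed.

Lemma grrel_sum I (r : seq I) (P : pred I) (F : I -> M) (G : I -> N) :
  (forall i, P i -> R (F i) (G i)) ->
  R (\sum_(i <- r | P i) F i) (\sum_(i <- r | P i) G i).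
Proof.
move=> h; elim/big_rec2: _ => [|i x y Pi hxy]; first exact: grrel0.
by apply: grrelD => //; apply: h.
Qed.

Lemma grsub_dom : grsub (dom R).
Proof.
split; first by exists 0; apply: grrel0.
  by move=> f u v [u' h] [v' h']; exists (f *: u' + v'); apply: grrelZ.
move=> u c [v h] hc x; have [d hd] := gr_decomp v.
by exists (d x); apply: grrel_decomp hc hd x.
Qed.

Lemma grsub_indet : grsub (indet R).
Proof.
split; first exact: grrel0.
  by move=> f u v h h'; rewrite /indet -[0]addr0 -{1}[0](scaler0 _ f);
    apply: grrelZ.
move=> v d h hd x; exact: (grrel_decomp hR h (decomp0 M) hd x).
Qed.

Lemma grrel_conv : grrel (fun v u => R u v).
Proof.
split; first exact: grrel0.
  by move=> f [u u'] [v v'] h h'; apply: grrelZ.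
by move=> [v u] c h /decomp_pair [hc hd] x; apply: (grrel_decomp hR h hd hc).
Qed.

(** Lets values be chosen homogeneous: keep the component of [v] in the degree of [u]. *)
Lemma grrel_homl x u v : R u v -> gr x u -> exists2 v', gr x v' & R u v'.
Proof.
move=> h hu; have [d hd] := gr_decomp v; exists (d x); first by case: hd.
by have := grrel_decomp hR h (decomp_homE hu) hd x; rewrite eqxx.
Qed.

Lemma grrel_homr x u v : R u v -> gr x v -> exists2 u', gr x u' & R u' v.
Proof.
move=> h hv; have [c hc] := gr_decomp u; exists (c x); first by case: hc.
by have := grrel_decomp hR h hc (decomp_homE hv) x; rewrite eqxx.
Qed.

Lemma grrel_plus D : grsub D -> grrel (fun u v => addset (R u) D v).
Proof.
move=> [D0 DZ DD]; split.
- by exists 0, 0; rewrite addr0; split=> //; apply: grrel0.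
- move=> f [u v] [u' v'] /= [a [d [ha hd ->]]] [a' [d' [ha' hd' ->]]].
  exists (f *: a + a'), (f *: d + d'); split; [exact: grrelZ | exact: DZ |].
  by rewrite scalerDr addrACA.
- move=> [u v] c /= [a [d [ha hd e]]] /decomp_pair [/= hc1 hc2] x.
  have [ca hca] := gr_decomp a; have [cd hcd] := gr_decomp d.
  rewrite e in hc2; rewrite (gr_uniq hc2 (decompD hca hcd)).
  by exists (ca x), (cd x); split=> //; [apply: grrel_decomp ha hc1 hca x |
    apply: DD hcd x].
Qed.

End Two.

Lemma grrel_cap (M N : grmod k p q) (R Q : M -> N -> Prop) :
  grrel R -> grrel Q -> grrel (fun u v => R u v /\ Q u v).
Proof.
move=> [R0 RZ RD] [Q0 QZ QD]; split=> //.
- by move=> f u v [] ? ? [] ? ?; split; [apply: RZ | apply: QZ].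
- by move=> u c [hu hu'] hc x; split; [apply: RD hc x | apply: QD hc x].
Qed.

Lemma grrel_radd (M N : grmod k p q) (R Q : M -> N -> Prop) :
  grrel R -> grrel Q -> grrel (fun u v => addset (R u) (Q u) v).
Proof.
move=> hR hQ; split.
- by exists 0, 0; rewrite addr0; split=> //; apply: grrel0.
- move=> f [u v] [u' v'] /= [a [d [ha hd ->]]] [a' [d' [ha' hd' ->]]].
  exists (f *: a + a'), (f *: d + d'); split; try exact: grrelZ.
  by rewrite scalerDr addrACA.
- move=> [u v] c /= [a [d [ha hd e]]] /decomp_pair [/= hc1 hc2] x.
  have [ca hca] := gr_decomp a; have [cd hcd] := gr_decomp d.
  rewrite e in hc2; rewrite (gr_uniq hc2 (decompD hca hcd)).
  by exists (ca x), (cd x); split=> //; [apply: grrel_decomp ha hc1 hca x |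
    apply: grrel_decomp hd hc1 hcd x].
Qed.

Hypotheses (p_gt0 : (0 < p)%N) (q_gt0 : (0 < q)%N).

Lemma cofindimP (X : coh k p q) (A : X -> Prop) : grsub A ->
  (forall u b, exists N, A (xv k b ^+ N *: u)) -> cofindim A.
Proof.
move=> hA h; have [n [e he]] := coh_fg X.
exact: (cofindimI (grsub_linsub hA) he h).
Qed.

Section QHoms.
Variables X Y : coh k p q.
Implicit Types f g : qhom X Y.

Lemma qdom f b u : exists N v, f (xv k b ^+ N *: u) v.
Proof.
exact: (cofindim_xv p_gt0 q_gt0 b u (grsub_dom (qrel_gr f)) (qrel_dom f)).
Qed.

Lemma qkill f b v : f 0 v -> exists N, xv k b ^+ N *: v = 0.
Proof.
exact: (findim_xv p_gt0 q_gt0 b (grsub_indet (qrel_gr f)) (qrel_indet f)).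
Qed.

(** A representative is multivalued, but two values differ by an element of the finite dimensional
    indeterminacy, which a power of x_b kills. *)
Lemma qkill2 f b u v w : f u v -> f u w ->
  exists N, xv k b ^+ N *: v = xv k b ^+ N *: w.
Proof.
move=> h h'; have [|N hN] := @qkill f b (v - w).
  by rewrite -(subrr u); apply: grrelB (qrel_gr f) h h'.
by exists N; apply/eqP; rewrite -subr_eq0 -scalerBr hN.
Qed.

(* The classes are equal iff they agree on the charts x_1 <> 0 and x_2 <> 0. *)
Lemma qeqE f g : qeq f g <->
  forall u b, exists N v, f (xv k b ^+ N *: u) v /\ g (xv k b ^+ N *: u) v.
Proof.
split=> [[h hh] u b | H].
  have [N [w hw]] := qdom h b u.
  have [[v fv] [v' gv] h1 h2] := hh _ (ex_intro _ w hw).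
  have [K hK] := qkill2 b (h1 _ fv) (h2 _ gv).
  exists (K + N)%N, (xv k b ^+ K *: v); rewrite -xvM -scalerA; split.
    exact: grrelS (qrel_gr f) _ _ _ fv.
  by rewrite hK; apply: grrelS (qrel_gr g) _ _ _ gv.
(* The common image is the intersection of f and g, enlarged by both indeterminacies so that it
   contains all values of f and of g on its domain; by [H] this domain has finite codimension. *)
pose D := addset (indet f) (indet g).
have gD : grsub D by apply: grsub_add; apply: grsub_indet; apply: qrel_gr.
pose R u := fun v => f u v /\ g u v.
have gR : grrel R by apply: grrel_cap; apply: qrel_gr.
have cR : cofindim (dom (fun u v => addset (R u) D v)).
  apply: cofindimP; first exact: (grsub_dom (grrel_plus gR gD)).
  move=> u b; have [N [v hv]] := H u b; exists N, v, v, 0.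
  by split; rewrite ?addr0 //; case: gD.
have f0 := grrel0 (qrel_gr f); have g0 := grrel0 (qrel_gr g).
have fR : findim (indet (fun u v => addset (R u) D v)).
  apply: (@findim_ext _ D); last by apply: findim_add => //; apply: qrel_indet.
  move=> u; split=> [Du|].
    by exists 0, u; split; rewrite ?add0r.
  move=> [v0 [d [[h1 h2] [a [b [ha hb ->]]] ->]]].
  exists (v0 + a), b; split; rewrite ?addrA //.
  by rewrite /indet -[0]addr0; apply: grrelD (qrel_gr f) _ _ _ _ h1 ha.
exists (QHom (grrel_plus gR gD) cR fR) => u [w [v [d [[fv gv] _ _]]]].
have Z v' : D (v' - v) -> addset (R u) D v'.
  by move=> h; exists v, (v' - v); split=> //; rewrite addrC subrK.
split; [by exists v | by exists v | move=> v' h | move=> v' h]; apply: Z.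
  exists (v' - v), 0; rewrite addr0; split=> //.
  by rewrite /indet -(subrr u); apply: grrelB (qrel_gr f) h fv.
exists 0, (v' - v); rewrite add0r; split=> //.
by rewrite /indet -(subrr u); apply: grrelB (qrel_gr g) h gv.
Qed.

Lemma qeq_refl f : qeq f f.
Proof. by apply/qeqE => u b; have [N [v hv]] := qdom f b u; exists N, v. Qed.

Lemma qeq_sym f g : qeq f g -> qeq g f.
Proof. by move/qeqE => h; apply/qeqE => u b; have [N [v []]] := h u b;
  exists N, v. Qed.

Lemma qrel_mul f b N M u v : f (xv k b ^+ N *: u) v ->
  f (xv k b ^+ (M + N) *: u) (xv k b ^+ M *: v).
Proof. by rewrite -xvM -scalerA; apply: grrelS (qrel_gr f) _ _ _. Qed.

Lemma qrel_mul' f b N M u v : f u (xv k b ^+ N *: v) ->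
  f (xv k b ^+ M *: u) (xv k b ^+ (M + N) *: v).
Proof. by rewrite -xvM -scalerA; apply: grrelS (qrel_gr f) _ _ _. Qed.

Lemma qeq_trans f g h : qeq f g -> qeq g h -> qeq f h.
Proof.
move=> /qeqE e1 /qeqE e2; apply/qeqE => u b.
have [N [v [fv gv]]] := e1 u b; have [N' [v' [gv' hv']]] := e2 u b.
have := qrel_mul N gv'; rewrite addnC => gv2.
have [K hK] := qkill2 b (qrel_mul N' gv) gv2.
exists (K + (N' + N))%N, (xv k b ^+ K *: (xv k b ^+ N' *: v)); split.
  by do 2!apply: qrel_mul.
by rewrite hK; apply: qrel_mul; rewrite addnC; apply: qrel_mul.
Qed.

Lemma qeq_ext f g : (forall u v, f u v <-> g u v) -> qeq f g.
Proof.
move=> h; apply/qeqE => u b; have [N [v hv]] := qdom f b u.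
by exists N, v; split=> //; apply/h.
Qed.

End QHoms.

Section Categories.
Variables X Y Z W : coh k p q.

Lemma qcomp_eq (f f' : qhom X Y) (g g' : qhom Y Z) :
  qeq f f' -> qeq g g' -> qeq (qcomp g f) (qcomp g' f').
Proof.
move=> /qeqE e1 /qeqE e2; apply/qeqE => u b.
have [N [v [fv fv']]] := e1 u b; have [M [w [gv gv']]] := e2 v b.
exists (M + N)%N, w; split; exists (xv k b ^+ M *: v);
  by split=> //; apply: qrel_mul.
Qed.

Lemma qcompA (f : qhom X Y) (g : qhom Y Z) (h : qhom Z W) :
  qeq (qcomp h (qcomp g f)) (qcomp (qcomp h g) f).
Proof.
apply: qeq_ext => u v; split.
  by move=> [z [[y [h1 h2]] h3]]; exists y; split=> //; exists z.
by move=> [y [h1 [z [h2 h3]]]]; exists z; split=> //; exists y.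
Qed.

Lemma qcomp1f (f : qhom X Y) : qeq (qcomp (qid Y) f) f.
Proof.
apply: qeq_ext => u v; split=> [[w [h <-]] // | h].
by exists v.
Qed.

Lemma qcompf1 (f : qhom X Y) : qeq (qcomp f (qid X)) f.
Proof.
apply: qeq_ext => u v; split=> [[w [<- h]] // | h].
by exists u.
Qed.

Lemma qcomp0f (f : qhom X Y) : qeq (qcomp (qzero Y Z) f) (qzero X Z).
Proof.
apply/qeqE => u b; have [N [v hv]] := qdom f b u; exists N, 0; split=> //.
by exists v.
Qed.

Lemma qcompf0 (f : qhom Y Z) : qeq (qcomp f (qzero X Y)) (qzero X Z).
Proof.
apply/qeqE => u b; exists 0%N, 0; split=> //; exists 0; split=> //.
exact: grrel0 (qrel_gr f).
Qed.

End Categories.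
End Relations.

(** * Invariance under isomorphism *)

Section Isomorphisms.
Variables (k : fieldType) (p q : nat).
Hypotheses (p_gt0 : (0 < p)%N) (q_gt0 : (0 < q)%N).
Implicit Types X Y Z W T E : coh k p q.

#[local] Instance qeq_equiv X Y : Equivalence (@qeq k p q X Y).
Proof.
split.
- by move=> f; apply: qeq_refl.
- by move=> f g; apply: qeq_sym.
- by move=> f g h; apply: qeq_trans.
Qed.

#[local] Instance qcomp_proper X Y Z :
  Proper (@qeq k p q Y Z ==> @qeq k p q X Y ==> @qeq k p q X Z) (@qcomp k p q X
    Y Z).
Proof. by move=> g g' hg f f' hf; apply: qcomp_eq. Qed.

Local Notation compA := (qcompA p_gt0 q_gt0).
Local Notation comp1f := (qcomp1f p_gt0 q_gt0).
Local Notation compf1 := (qcompf1 p_gt0 q_gt0).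
Local Notation comp0f := (qcomp0f p_gt0 q_gt0).
Local Notation compf0 := (qcompf0 p_gt0 q_gt0).

Lemma qiso_refl X : qiso X X.
Proof. by exists (qid X), (qid X); split; apply: comp1f. Qed.

Lemma qiso_sym X Y : qiso X Y -> qiso Y X.
Proof. by move=> [f [g [h1 h2]]]; exists g, f. Qed.

Lemma qiso_trans X Y Z : qiso X Y -> qiso Y Z -> qiso X Z.
Proof.
move=> [f [g [h1 h2]]] [f' [g' [h1' h2']]].
exists (qcomp f' f), (qcomp g g'); split.
  by rewrite -compA (compA f f' g') h1' comp1f.
by rewrite -compA (compA g' g f) h2 comp1f.
Qed.

Lemma hom_vanishes_iso X X' Y Y' : qiso X X' -> qiso Y Y' ->
  hom_vanishes X Y -> hom_vanishes X' Y'.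
Proof.
move=> [a [a' [ha ha']]] [b [b' [hb hb']]] h f.
have := h (qcomp b' (qcomp f a)) => e.
have : qeq (qcomp b (qcomp (qcomp b' (qcomp f a)) a')) (qzero X' Y').
  by rewrite e comp0f compf0; reflexivity.
by rewrite -!compA ha' compf1 compA hb' comp1f.
Qed.

(** An extension of X' by Y' becomes one of X by Y after composing its two maps with the
    isomorphisms. If s splits the new sequence, then [qcomp s a] splits the old one, because [a] is
    invertible. *)
Lemma ext1_vanishes_iso X X' Y Y' : qiso X X' -> qiso Y Y' ->
  ext1_vanishes X Y -> ext1_vanishes X' Y'.
Proof.
move=> [a' [a [ha' ha]]] [b [b' [hb hb']]] h E i pi [pi0 ker] [_ cok].
have z : qeq (qcomp (qcomp a pi) (qcomp i b)) (qzero Y X).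
  by rewrite -compA (compA b i pi) pi0 comp0f compf0; reflexivity.
have [||s hs] := h E (qcomp i b) (qcomp a pi).
- split=> // W f; rewrite -compA => hf.
  have [|g [hg ug]] := ker W f.
    by rewrite -[qcomp pi f]comp1f -ha -compA hf compf0; reflexivity.
  exists (qcomp b' g); split; first by rewrite -compA (compA g b' b) hb' comp1f.
  move=> g'; rewrite -compA => /ug <-.
  by rewrite compA hb comp1f; reflexivity.
- split=> // W f; rewrite compA => hf.
  have [|g [hg ug]] := cok W f.
    by rewrite -[qcomp f i]compf1 -hb' compA hf comp0f; reflexivity.
  exists (qcomp g a'); split; first by rewrite -compA (compA pi a a') ha comp1f.
  move=> g'; rewrite compA => /ug <-.
  by rewrite -compA ha' compf1; reflexivity.
exists (qcomp s a).
have : qeq (qcomp a' (qcomp (qcomp (qcomp a pi) s) a)) (qid X').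
  by rewrite hs comp1f.
by rewrite -!compA (compA _ a a') ha comp1f.
Qed.

Lemma tilting_iso X X' : qiso X X' -> tilting X -> tilting X'.
Proof.
move=> e [h1 h2]; split; first exact: ext1_vanishes_iso h1.
move=> Y h3 h4; apply: h2.
  by apply: hom_vanishes_iso h3 => //; [exact: qiso_sym | exact: qiso_refl].
by apply: ext1_vanishes_iso h4 => //; [exact: qiso_sym | exact: qiso_refl].
Qed.

Lemma is_summand_iso X T T' : qiso T T' -> is_summand X T -> is_summand X T'.
Proof.
move=> e [Y h]; exists Y; apply: qiso_trans h; exact: qiso_sym.
Qed.

End Isomorphisms.

(** * Graded maps and quotient modules *)

Section GradedMaps.
Variables (k : fieldType) (p q : nat).
Local Notation L := (LL p q).
Local Notation S := {mpoly k[2]}.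

Definition glin (M N : grmod k p q) (phi : M -> N) : Prop :=
  (forall f u v, phi (f *: u + v) = f *: phi u + phi v) /\
  forall x u, gr x u -> gr x (phi u).

Section Glin.
Variables (M N : grmod k p q) (phi : M -> N).
Hypothesis hphi : glin phi.

Lemma glin0 : phi 0 = 0.
Proof.
have := proj1 hphi 1 0 0; rewrite !scale1r addr0 => /eqP.
by rewrite -{1}[phi 0]addr0 (inj_eq (addrI _)) => /eqP.
Qed.

Lemma glinD u v : phi (u + v) = phi u + phi v.
Proof. by rewrite -[u]scale1r (proj1 hphi) !scale1r. Qed.

Lemma glinZ f u : phi (f *: u) = f *: phi u.
Proof. by rewrite -[_ *: u]addr0 (proj1 hphi) glin0 addr0. Qed.

Lemma glinB u v : phi (u - v) = phi u - phi v.
Proof. by rewrite glinD -scaleN1r glinZ scaleN1r. Qed.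

Lemma glin_sum I (r : seq I) (P : pred I) (F : I -> M) :
  phi (\sum_(i <- r | P i) F i) = \sum_(i <- r | P i) phi (F i).
Proof. by elim/big_rec2: _ => [|i y z _ <-]; [exact: glin0 | exact: glinD]. Qed.

Lemma glin_decomp u c : decomp (@gr k p q M) u c ->
  decomp (@gr k p q N) (phi u) (fun x => phi (c x)).
Proof.
move=> [h [s [us z e]]]; split; first by move=> x; apply: (proj2 hphi).
exists s; split=> //; first by move=> x /z ->; apply: glin0.
by rewrite e glin_sum.
Qed.

Lemma grrel_glin : grrel (fun u v => v = phi u).
Proof.
split=> /=; first by rewrite glin0.
  by move=> f [u v] [u' v'] /= -> ->; rewrite (proj1 hphi).
move=> [u v] c /= -> /decomp_pair [/= hc hd] x.
exact: (gr_uniq hd (glin_decomp hc)).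
Qed.

End Glin.

Lemma glin_comp (M N P : grmod k p q) (phi : M -> N) (psi : N -> P) :
  glin phi -> glin psi -> glin (fun u => psi (phi u)).
Proof.
move=> h h'; split=> [f u v|x u hu]; first by rewrite (proj1 h) (proj1 h').
by apply: (proj2 h'); apply: (proj2 h).
Qed.

Section Qmap.
Variables (X Y : coh k p q) (phi : X -> Y).
Hypothesis hphi : glin phi.

Lemma qmap_dom : cofindim (dom (M := X) (N := Y) (fun u v => v = phi u)).
Proof. by apply: cofindim_all => u; exists (phi u). Qed.

Lemma qmap_indet : findim (indet (M := X) (N := Y) (fun u v => v = phi u)).
Proof. by apply: findim_zero => u ->; apply: glin0. Qed.

Definition qmap : qhom X Y := QHom (grrel_glin hphi) qmap_dom qmap_indet.

End Qmap.

Section Qadd.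
Hypotheses (p_gt0 : (0 < p)%N) (q_gt0 : (0 < q)%N).
Variables (X Y : coh k p q) (f g : qhom X Y).

Lemma qadd_dom : cofindim (dom (M := X) (N := Y) (fun u v =>
  addset (f u) (g u) v)).
Proof.
apply: cofindimP.
  exact: (grsub_dom (grrel_radd (qrel_gr f) (qrel_gr g))).
move=> u b; have [N [v hv]] := qdom p_gt0 q_gt0 f b u.
have [N' [v' hv']] := qdom p_gt0 q_gt0 g b u.
exists (N' + N)%N, (xv k b ^+ N' *: v + xv k b ^+ N *: v').
exists (xv k b ^+ N' *: v), (xv k b ^+ N *: v'); split=> //.
  exact: qrel_mul.
by rewrite addnC; apply: qrel_mul.
Qed.

Lemma qadd_indet : findim (indet (M := X) (N := Y) (fun u v =>
  addset (f u) (g u) v)).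
Proof.
apply: findim_add; try exact: qrel_indet; exact: grrel0 (qrel_gr _).
Qed.

Definition qadd : qhom X Y :=
  QHom (grrel_radd (qrel_gr f) (qrel_gr g)) qadd_dom qadd_indet.

End Qadd.
End GradedMaps.

(** Bundled with its proof, so that the quotient structures below can be attached to [gsub_pred U]
    by instance inference. *)
Record gsub (k : fieldType) (p q : nat) (M : grmod k p q) := GSub {
  gsub_set :> M -> Prop;
  gsubP : grsub gsub_set
}.

Section Quotients.
Variables (k : fieldType) (p q : nat).
Local Notation L := (LL p q).
Local Notation S := {mpoly k[2]}.

(** The quotient construction takes a boolean predicate; excluded middle decides membership in a
    submodule. *)
Definition gsub_pred (M : grmod k p q) (U : gsub M) : {pred M} :=
  fun u => if excluded_middle_informative (U u) then true else false.

Lemma gsub_predP (M : grmod k p q) (U : gsub M) u : reflect (U u) (u \in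
  gsub_pred U).
Proof. by rewrite unfold_in; case: excluded_middle_informative => h;
  constructor. Qed.

Lemma gsub_zmod (M : grmod k p q) (U : gsub M) : zmod_closed (gsub_pred U).
Proof.
have lU := grsub_linsub (gsubP U).
split; first by apply/gsub_predP; apply: linsub0.
by move=> u v /gsub_predP hu /gsub_predP hv; apply/gsub_predP; apply: linsubB.
Qed.

HB.instance Definition _ (M : grmod k p q) (U : gsub M) :=
  GRing.isZmodClosed.Build M (gsub_pred U) (gsub_zmod U).

Section Quotient.
Variables (M : grmod k p q) (U : gsub M).

Definition quotT := {ideal_quot (gsub_pred U)}.

HB.instance Definition _ := GRing.Zmodule.on quotT.

Definition qpi (u : M) : quotT := \pi_({ideal_quot (gsub_pred U)})%qT u.

Definition qrepr (w : quotT) : M := repr (w : {ideal_quot (gsub_pred U)}).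

Lemma qreprK w : qpi (qrepr w) = w.
Proof. exact: reprK. Qed.

Lemma qpi_eq u v : qpi u = qpi v <-> U (u - v).
Proof.
split=> [/eqP h|/gsub_predP h]; last apply/eqP.
  by apply/gsub_predP; rewrite Quotient.idealrBE.
by move: h; rewrite Quotient.idealrBE.
Qed.

Lemma qpiD u v : qpi (u + v) = qpi u + qpi v.
Proof. exact: raddfD. Qed.

Lemma qpi0 : qpi 0 = 0.
Proof. exact: raddf0. Qed.

Definition qscale (f : S) (w : quotT) : quotT := qpi (f *: qrepr w).

Lemma qscaleE f u : qscale f (qpi u) = qpi (f *: u).
Proof.
apply/qpi_eq; rewrite -scalerBr; apply: linsubZ.
  exact: grsub_linsub (gsubP U).
by apply/qpi_eq; apply: qreprK.
Qed.

Lemma qscaleA f g w : qscale f (qscale g w) = qscale (f * g) w.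
Proof. by rewrite -[w]qreprK !qscaleE scalerA. Qed.

Lemma qscale1 : left_id 1 qscale.
Proof. by move=> w; rewrite -[w]qreprK !qscaleE scale1r. Qed.

Lemma qscaleDr : right_distributive qscale +%R.
Proof.
by move=> f w w'; rewrite -[w]qreprK -[w']qreprK -qpiD !qscaleE scalerDr qpiD.
Qed.

Lemma qscaleDl w : {morph qscale^~ w : f g / f + g}.
Proof. by move=> f g; rewrite -[w]qreprK !qscaleE scalerDl qpiD. Qed.

HB.instance Definition _ :=
  GRing.Zmodule_isLmodule.Build S quotT qscaleA qscale1 qscaleDr qscaleDl.

Lemma qpiZ f u : qpi (f *: u) = f *: qpi u.
Proof. by rewrite -qscaleE. Qed.

Lemma qpi_sum I (r : seq I) (P : pred I) (F : I -> M) :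
  qpi (\sum_(i <- r | P i) F i) = \sum_(i <- r | P i) qpi (F i).
Proof. by elim/big_rec2: _ => [|i y z _ <-]; [exact: qpi0 | exact: qpiD]. Qed.

Definition gr_quot (x : L) (w : quotT) := exists2 u, gr x u & w = qpi u.

Lemma gr_quot0 x : gr_quot x 0.
Proof. by exists 0; [exact: gr0 | rewrite qpi0]. Qed.

Lemma gr_quotB x u v : gr_quot x u -> gr_quot x v -> gr_quot x (u - v).
Proof.
move=> [u' h ->] [v' h' ->]; exists (u' - v'); first exact: grB.
by rewrite qpiD -[- v']scaleN1r qpiZ scaleN1r.
Qed.

Lemma gr_quot_scale d x f w : homdeg d f -> gr_quot x w ->
  gr_quot (d + x) (f *: w).
Proof.
by move=> hf [u hu ->]; exists (f *: u); [exact: gr_scale | rewrite qpiZ].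
Qed.

Lemma decomp_quot u c : decomp (@gr k p q M) u c ->
  decomp gr_quot (qpi u) (fun x => qpi (c x)).
Proof.
move=> [h [s [us z ->]]]; split; first by move=> x; exists (c x).
exists s; split=> //; first by move=> x /z ->; rewrite qpi0.
exact: qpi_sum.
Qed.

Lemma gr_quot_decomp w : exists c, decomp gr_quot w c.
Proof.
have [c hc] := gr_decomp (qrepr w); exists (fun x => qpi (c x)).
by rewrite -[w]qreprK; apply: decomp_quot.
Qed.

Lemma decomp_quot_lift w c : decomp gr_quot w c ->
  exists d u, [/\ decomp (@gr k p q M) u d, w = qpi u & forall x,
    c x = qpi (d x)].
Proof.
move=> [h [s [us z ->]]].
(* Components that vanish are lifted to zero, so that the lifted family is still supported on the
   finite list [s]. *)
have H x : exists u, [/\ gr x u, c x = qpi u & c x = 0 -> u = 0].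
  have [c0|c0] := eqVneq (c x) 0; first by exists 0; rewrite qpi0; split=> //;
    exact: gr0.
  by have [u hu e] := h x; exists u; split=> // e'; rewrite e' eqxx in c0.
pose d x := proj1_sig (constructive_indefinite_description _ (H x)).
have hd x : [/\ gr x (d x), c x = qpi (d x) & c x = 0 -> d x = 0].
  exact: proj2_sig (constructive_indefinite_description _ (H x)).
exists d, (\sum_(x <- s) d x); split; last by move=> x; case: (hd x).
  split; first by move=> x; case: (hd x).
  by exists s; split=> // x /z c0; case: (hd x) => _ _ ->.
by rewrite qpi_sum; apply: eq_bigr => x _; case: (hd x).
Qed.

(** The lifts of the two decompositions differ by a decomposition of [u - u'], which lies in the
    graded submodule U; hence so do all its components. *)
Lemma gr_quot_uniq w c c' : decomp gr_quot w c -> decomp gr_quot w c' ->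
  c =1 c'.
Proof.
move=> /decomp_quot_lift [d [u [hd wu cd]]] /decomp_quot_lift [d' [u' [hd' wu'
  cd']]] x.
rewrite cd cd'; apply/qpi_eq.
have : U (u - u') by apply/qpi_eq; rewrite -wu.
have [_ _ h] := gsubP U => hu; apply: (h _ (fun x => d x + - d' x) hu).
apply: (decompD hd (glin_decomp (phi := fun u => - u) _ hd')).
by split=> [f v v'|y v]; [rewrite opprD scalerN | exact: grN].
Qed.

Definition quot_mod : grmod k p q :=
  @GrMod k p q quotT gr_quot gr_quot0 gr_quotB gr_quot_scale gr_quot_decomp
    gr_quot_uniq.

Lemma glin_qpi : glin (N := quot_mod) qpi.
Proof. by split=> [f u v|x u hu]; [rewrite qpiD qpiZ | exists u]. Qed.

Lemma glin_quot (N : grmod k p q) (phi : M -> N) :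
  glin phi -> (forall u, U u -> phi u = 0) -> glin (M := quot_mod) (fun w =>
    phi (qrepr w)).
Proof.
move=> h h0.
have E u : phi (qrepr (qpi u)) = phi u.
  apply/eqP; rewrite -subr_eq0 -(glinB h); apply/eqP/h0.
  by apply/qpi_eq; rewrite qreprK.
split=> [f u v|x w [u hu ->]]; last by rewrite E; apply: (proj2 h).
rewrite -[u]qreprK -[v]qreprK -qpiZ -qpiD !E.
exact: (proj1 h).
Qed.

Lemma quot_fg : fingen M -> fingen quot_mod.
Proof.
move=> [n [e he]]; exists n, (fun i => qpi (e i)) => w.
have [a ha] := he (qrepr w); exists a.
by rewrite -[w]qreprK ha qpi_sum; apply: eq_bigr => i _; rewrite qpiZ.
Qed.

End Quotient.

Lemma quot_reprE (M N : grmod k p q) (U : gsub M) (phi : M -> N) u : glin phi ->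
  (forall u, U u -> phi u = 0) -> phi (qrepr (qpi U u)) = phi u.
Proof.
move=> h h0; apply/eqP; rewrite -subr_eq0 -(glinB h); apply/eqP/h0.
by apply/qpi_eq; rewrite qreprK.
Qed.

Definition quot (X : coh k p q) (U : gsub X) : coh k p q := Coh (quot_fg U
  (coh_fg X)).

End Quotients.

(** * Cech cohomology *)

Section Sections.
Variables (k : fieldType) (p q : nat).
Local Notation L := (LL p q).
Local Notation S := {mpoly k[2]}.
Local Notation dv := (dv p q).
Local Notation xv := (xv k).
Local Notation X12 := (xv false * xv true).
Hypotheses (p_gt0 : (0 < p)%N) (q_gt0 : (0 < q)%N).

(** As S(x)_y = S_(x + y), the generator 1 has degree - x; this is where the degrees n x_b - x of
    local sections, and the argument - x of [H0_vanishes] and [H1_vanishes], come from. *)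
Lemma gr_line_xv x b n : @gr k p q (line_mod k x) (dv b *+ n - x) (xv b ^+ n :
  S^o).
Proof. by rewrite /= /gr_line addrC subrK; apply: homdeg_xv. Qed.

Lemma qeq_line x (Y : coh k p q) (f g : qhom (line k x) Y) :
  (forall b, exists N v, f (xv b ^+ N : S^o) v /\ g (xv b ^+ N : S^o) v) ->
    qeq f g.
Proof.
move=> h; apply/(qeqE p_gt0 q_gt0) => u b; have [N [v [fv gv]]] := h b.
exists N, ((u : S) *: v).
have -> : xv b ^+ N *: u = (u : S) *: (xv b ^+ N : S^o) :> line k x.
  by rewrite /GRing.scale /= mulrC.
by split; [apply: (grrelS (qrel_gr f)) | apply: (grrelS (qrel_gr g))].
Qed.

Section Pairmap.
Variables (x : L) (M : coh k p q) (N : nat) (w : bool -> M).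
Hypothesis hw : forall b, gr (dv b *+ N - x) (w b).
Hypothesis cw : xv true ^+ N *: w false = xv false ^+ N *: w true.

(** The graph of x_b ^ N -> w b on the ideal generated by x_1 ^ N and x_2 ^ N, which has finite
    codimension in S(x): two local sections that agree on the overlap are glued to a morphism. *)
Definition pairrel (f : line k x) (e : M) : Prop := exists a : bool -> S,
  (f, e) = \sum_b a b *: ((xv b ^+ N : S^o, w b) : dsum_mod (line k x) M).

Lemma pairrelE (f : line k x) e : pairrel f e <-> exists a : bool -> S,
  (f : S) = a true * xv true ^+ N + a false * xv false ^+ N /\
  e = a true *: w true + a false *: w false.
Proof.
rewrite /pairrel; split=> -[a h]; exists a; move: h; rewrite big_bool /=.
  by case.
by move=> [-> ->].
Qed.

Lemma pairrel_gr : grrel pairrel.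
Proof.
have hP b : @gr k p q (dsum_mod (line k x) M) (dv b *+ N - x) (xv b ^+ N : S^o,
  w b).
  by split; [exact: gr_line_xv | exact: hw].
have [h0 hZ hD] := grsub_span hP.
split; first exact: h0.
  by move=> f [u1 u2] [v1 v2] h h'; apply: (hZ f (u1, u2) (v1, v2) h h').
move=> [u1 u2] c h hc y; have := hD _ c h hc y.
by rewrite /pairrel -surjective_pairing.
Qed.

Lemma pairrel_gen b : pairrel (xv b ^+ N : S^o) (w b).
Proof.
exists (fun b' => (b' == b)%:R); rewrite big_bool.
by case: b; rewrite /= scale0r scale1r ?addr0 ?add0r.
Qed.

Lemma pairrel_dom : cofindim (dom pairrel).
Proof.
apply: cofindimP => //; first exact: (grsub_dom pairrel_gr).
move=> u b; exists N, ((u : S) *: w b).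
have -> : xv b ^+ N *: u = (u : S) *: (xv b ^+ N : S^o) :> line k x.
  by rewrite /GRing.scale /= mulrC.
apply: (grrelS pairrel_gr); exact: pairrel_gen.
Qed.

(** By [koszul] every syzygy of the two powers is a multiple of the obvious one, which [cw] sends to
    zero; so the graph is single valued. *)
Lemma pairrel_indet : findim (indet pairrel).
Proof.
apply: findim_zero => e /pairrelE [a [/= h ->]].
have [|g [-> ->]] := @koszul k (a false) (a true) false N N.
  by rewrite [in RHS]h addrC; congr (_ + _); rewrite mulrC.
rewrite scaleNr [_ * g]mulrC [xv _ ^+ _ * g]mulrC -!scalerA cw.
by rewrite addrC subrr.
Qed.

Definition pairmap : qhom (line k x) M := QHom pairrel_gr pairrel_dom
  pairrel_indet.

End Pairmap.

(** Converse of [pairmap]. The values at the two powers can be taken homogeneous by [grrel_homl],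
    but at first they are compatible on the overlap only up to torsion. *)
Lemma qhom_pair x (M : coh k p q) (f : qhom (line k x) M) : exists N (w : bool
  -> M),
  [/\ forall b, gr (dv b *+ N - x) (w b),
      xv true ^+ N *: w false = xv false ^+ N *: w true
    & forall b, f (xv b ^+ N : S^o) (w b)].
Proof.
have H b := qdom p_gt0 q_gt0 f b (1 : S^o).
have [Nb hN] : exists Nb : bool -> nat, forall b, exists v,
  f (xv b ^+ (Nb b) : S^o) v.
  have [[N1 [v1 h1]] [N2 [v2 h2]]] := (H true, H false).
  exists (fun b => if b then N1 else N2) => -[];
  [exists v1; move: h1 | exists v2; move: h2]; by rewrite /GRing.scale /= mulr1.
pose N := (Nb true + Nb false)%N.
have H2 b : exists2 v, gr (dv b *+ N - x) v & f (xv b ^+ N : S^o) v.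
  have [v hv] := hN b; apply: (grrel_homl (qrel_gr f)); last exact: gr_line_xv.
  have -> : xv b ^+ N = xv b ^+ (N - Nb b) *: (xv b ^+ Nb b : S^o).
    rewrite /GRing.scale /= xvM subnK // /N; case: (b); rewrite ?leq_addr //.
    exact: leq_addl.
  exact: (grrelS (qrel_gr f) _ hv).
have [[v1 g1 f1] [v0 g0 f0]] := (H2 true, H2 false).
have [K hK] : exists K, xv false ^+ K *: (xv true ^+ N *: v0) =
    xv false ^+ K *: (xv false ^+ N *: v1).
  apply: (@qkill2 _ _ _ p_gt0 q_gt0 _ _ f false (xv false ^+ N * xv true ^+ N :
    S^o)).
    rewrite mulrC; exact: (grrelS (qrel_gr f) (xv true ^+ N) f0).
  exact: (grrelS (qrel_gr f) (xv false ^+ N) f1).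
(* Raising the exponent by K absorbs the torsion, so that compatibility holds exactly. *)
exists (K + N)%N, (fun b => xv b ^+ K *: if b then v1 else v0); split.
- by move=> b; rewrite mulrnDr -addrA; apply: gr_xv; case: b.
- rewrite /= -xvM -scalerA [_ *: (_ *: v0)]scalerA [xv true ^+ N * _]mulrC
  -scalerA hK.
  by rewrite !scalerA; congr (_ *: _); rewrite exprD; ring.
- by move=> b; rewrite -xvM; apply: (grrelS (qrel_gr f)); case: b.
Qed.

(* The degree y parts of the Cech cohomology groups H^0 and H^1 of M vanish.
   The pair w stands for the section w b / x_b ^ N, and m for
   m / (x_1 x_2) ^ n. *)
Definition H0_vanishes (M : grmod k p q) (y : L) : Prop :=
  forall N (w : bool -> M), (forall b, gr (dv b *+ N + y) (w b)) ->
  xv true ^+ N *: w false = xv false ^+ N *: w true ->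
  forall b, exists K, xv b ^+ K *: w b = 0.

Definition H1_vanishes (M : grmod k p q) (y : L) : Prop := forall n (m : M),
  gr (dv false *+ n + (dv true *+ n + y)) m ->
  exists N (w : bool -> M), (n <= N)%N /\
    X12 ^+ (N - n) *: m = xv true ^+ N *: w false + xv false ^+ N *: w true.

Lemma H0_hom x (M : coh k p q) : H0_vanishes M (- x) ->
  hom_vanishes (line k x) M.
Proof.
move=> h f; have [N [w [gw cw fw]]] := qhom_pair f.
apply: qeq_line => b; have [K hK] := h N w gw cw b.
exists (K + N)%N, 0; split=> //; rewrite -hK -xvM.
exact: (grrelS (qrel_gr f) _ (fw b)).
Qed.

Lemma hom_H0 x (M : coh k p q) : hom_vanishes (line k x) M ->
  H0_vanishes M (- x).
Proof.
move=> h N w gw cw b.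
have /(qeqE p_gt0 q_gt0) /(_ (xv b ^+ N : S^o) b) := h (pairmap gw cw).
move=> [N' [v [h1 h2]]]; rewrite /= in h2; rewrite h2 in h1.
have h3 := grrelS (pairrel_gr gw) (xv b ^+ N') (pairrel_gen x N w b).
have [K hK] := qkill2 p_gt0 q_gt0 (f := pairmap gw cw) b h3 h1.
by exists (K + N')%N; rewrite -xvM -scalerA hK scaler0.
Qed.

(** [H1_vanishes] leaves the degrees of the cochain free. Both sides of the equation are compared in
    the degree [D] of the left one, and only the components of [w b] that contribute to it are
    kept. *)
Lemma H1_hom (M : grmod k p q) y n (m : M) : H1_vanishes M y ->
  gr (dv false *+ n + (dv true *+ n + y)) m ->
  exists N (w : bool -> M), [/\ (n <= N)%N, forall b, gr (dv b *+ N + y) (w b) &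
    X12 ^+ (N - n) *: m = xv true ^+ N *: w false + xv false ^+ N *: w true].
Proof.
move=> h gm; have [N [w [nN e]]] := h n m gm.
have [s0 [h0 e0]] := gr_expand (w false); have [s1 [h1 e1]] := gr_expand (w
  true).
pose D := dv false *+ N + (dv true *+ N + y).
pose s (b : bool) := if b then s1 else s0.
have hs b z : z \in s b -> gr z.1 z.2 by case: b => /=; [apply: h1 | apply: h0].
pose w' b := \sum_(z <- s b | dv (~~ b) *+ N + z.1 == D) z.2.
exists N, w'; split=> //.
  move=> b; rewrite /w' big_seq_cond; apply: gr_sum => z /andP [/hs hz /eqP zD].
  have <- : z.1 = dv b *+ N + y; last exact: hz.
  apply: (addrI (dv (~~ b) *+ N)); rewrite zD /D.
  by case: (b); rewrite //= addrCA.
pose t := [seq (dv true *+ N + z.1, xv true ^+ N *: z.2) | z <- s0] ++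
  [seq (dv false *+ N + z.1, xv false ^+ N *: z.2) | z <- s1].
have ht z : z \in t -> gr z.1 z.2.
  by rewrite mem_cat => /orP [] /mapP [z' h' ->] /=; apply: gr_xv;
    [apply: h0 | apply: h1].
have gD : gr D (X12 ^+ (N - n) *: m).
  rewrite exprMn -scalerA /D -(subnKC nN) addnC.
  have -> : dv false *+ (N - n + n) + (dv true *+ (N - n + n) + y) =
    dv false *+ (N - n) + (dv true *+ (N - n) + (dv false *+ n + (dv true *+ n +
      y))).
    by rewrite !mulrnDr -!addrA; congr (_ + _); rewrite addrCA.
  rewrite addnK; do 2!apply: gr_xv; exact: gm.
have et : X12 ^+ (N - n) *: m = \sum_(z <- t) z.2.
  by rewrite e big_cat !big_map /= e0 e1 !scaler_sumr.
have := decomp_seq ht; rewrite -et => /(decomp_hom D gD); rewrite eqxx => <-.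
by rewrite big_cat !big_map /= !scaler_sumr.
Qed.

End Sections.

(** * Extensions *)

Section Extensions.
Variables (k : fieldType) (p q : nat).
Local Notation L := (LL p q).
Local Notation S := {mpoly k[2]}.
Local Notation dv := (dv p q).
Local Notation xv := (xv k).
Local Notation X12 := (xv false * xv true).
Hypotheses (p_gt0 : (0 < p)%N) (q_gt0 : (0 < q)%N).

(** The projection of X modulo the image of pi and the zero morphism both vanish after pi, so they
    coincide by the uniqueness in the universal property of the cokernel. *)
Lemma cokernel_onto (M E X : coh k p q) (i : qhom M E) (pi : qhom E X) b v :
  is_cokernel i pi -> exists N e, pi e (xv b ^+ N *: v).
Proof.
move=> [_ cok].
pose U : gsub X := GSub (grsub_dom (grrel_conv (qrel_gr pi))).
pose W : coh k p q := quot U.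
pose c : qhom X W := qmap (Y := W) (glin_qpi U).
have [|g [_ ug]] := cok W (qzero E W); first exact: qcomp0f.
have h0 : qeq (qcomp (qzero X W) pi) (qzero E W) by apply: qcomp0f.
have h1 : qeq (qcomp c pi) (qzero E W).
  apply/(qeqE p_gt0 q_gt0) => u b'; have [N [w hw]] := qdom p_gt0 q_gt0 pi b' u.
  exists N, 0; split=> //; exists w; split=> //=.
  by rewrite -(qpi0 U); apply/qpi_eq; rewrite sub0r; apply: linsubN;
    [exact: grsub_linsub (gsubP U) | exists (xv b' ^+ N *: u)].
have : qeq c (qzero X W).
  apply: (qeq_trans p_gt0 q_gt0 (ug _ h1)).
  by apply: (qeq_sym p_gt0 q_gt0); apply: ug.
move=> /(qeqE p_gt0 q_gt0) /(_ v b) [N [w [/= h2 h3]]].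
rewrite h3 -(qpi0 U) in h2; have := (proj1 (qpi_eq U _ _) (esym h2)).
by rewrite subr0 => -[e he]; exists N, e.
Qed.

Lemma xv12_pow n : X12 ^+ n = xv false ^+ n * xv true ^+ n.
Proof. exact: exprMn. Qed.

(* A lift is obtained by correcting arbitrary lifts on the two charts by the
   Cech cochain that the vanishing of H^1 provides. *)
Lemma lift_line (M E X : coh k p q) (i : qhom M E) (pi : qhom E X) x
    (f : qhom (line k x) X) :
  is_kernel i pi -> is_cokernel i pi -> H1_vanishes M (- x) ->
  exists s : qhom (line k x) E, qeq (qcomp pi s) f.
Proof.
move=> [pi0 ker] cok v1.
have [n [a [e [fa pe ge ca]]]] : exists n (a : bool -> X) (e : bool -> E),
    [/\ forall b, f (xv b ^+ n : S^o) (a b), forall b, pi (e b) (a b),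
        forall b, gr (dv b *+ n - x) (e b) &
        xv true ^+ n *: a false = xv false ^+ n *: a true].
  have [N [a [ga ca fa]]] := qhom_pair p_gt0 q_gt0 f.
  have [[K1 [e1 h1]] [K2 [e2 h2]]] :=
    (cokernel_onto true (a true) cok, cokernel_onto false (a false) cok).
  pose K := (K1 + K2)%N.
  have H b : exists2 e, gr (dv b *+ (K + N) - x) e & pi e (xv b ^+ K *: a b).
    have hg : gr (dv b *+ (K + N) - x) (xv b ^+ K *: a b).
      by rewrite mulrnDr -addrA; apply: gr_xv.
    case: b hg => hg.
      apply: (grrel_homr (qrel_gr pi) (u := xv true ^+ K2 *: e1)) => //.
      by rewrite /K addnC; apply: qrel_mul'.
    apply: (grrel_homr (qrel_gr pi) (u := xv false ^+ K1 *: e2)) => //.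
    by apply: qrel_mul'.
  have [[e1' g1 p1] [e2' g2 p2]] := (H true, H false).
  exists (K + N)%N, (fun b => xv b ^+ K *: a b), (fun b =>
    if b then e1' else e2').
  split; try by case.
    by move=> b; rewrite -xvM; apply: (grrelS (qrel_gr f) _ (fa b)).
  transitivity ((xv true ^+ K * xv false ^+ K) *: (xv true ^+ N *: a false)).
    by rewrite !scalerA exprD; congr (_ *: _); ring.
  by rewrite ca !scalerA exprD; congr (_ *: _); ring.
(* The difference of the two lifts on the overlap, with denominator (x_1 x_2) ^ n; it lies in the
   kernel of pi. *)
pose wv := xv true ^+ n *: e false - xv false ^+ n *: e true.
have gwv : gr (dv false *+ n + (dv true *+ n - x)) wv.
  apply: grB; last by apply: gr_xv.
  by rewrite addrCA; apply: gr_xv.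
have pwv : pi wv 0.
  rewrite -(subrr (xv true ^+ n *: a false)) {2}ca.
  by apply: grrelB (qrel_gr pi) _ _; apply: (grrelS (qrel_gr pi)).
(* With this twist, multiplying [wv] by polynomials is a degree preserving map from O(z), to which
   the universal property of the kernel applies; a multiple of [wv] by a power of x_1 x_2 then comes
   from some m in M. *)
pose z := - (dv false *+ n + (dv true *+ n - x)).
have hphi : @glin k p q (line k z) E (fun g : S => g *: wv).
  split; first by move=> g u v; rewrite scalerDl scalerA.
  move=> y u hu; have -> : y = z + y + (dv false *+ n + (dv true *+ n - x)).
    by rewrite addrAC addNr add0r.
  exact: gr_scale.
have [|g [hg _]] := ker _ (qmap (X := line k z) hphi).
  apply: qeq_line => // b; exists 0%N, 0; split=> //.
  exists ((xv b ^+ 0) *: wv); split=> //.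
  by rewrite -(scaler0 _ (xv b ^+ 0)); apply: (grrelS (qrel_gr pi)).
have [N1 [m [gm im]]] : exists N1 m,
    gr (dv false *+ (N1 + n) + (dv true *+ (N1 + n) - x)) m /\ i m (X12 ^+ N1 *:
      wv).
  move/(qeqE p_gt0 q_gt0): hg => /(_ (1 : S^o) false) [N1 [v [[m [_ im]] /=
    ev]]].
  have im' : i (xv true ^+ N1 *: m) (X12 ^+ N1 *: wv).
    rewrite xv12_pow mulrC -scalerA; apply: (grrelS (qrel_gr i)).
    by move: im; rewrite ev /GRing.scale /= mulr1.
  have [|m' gm' im2] := grrel_homr (qrel_gr i) (x := dv false *+ (N1 + n) + (dv
    true *+ (N1 + n) - x)) im'.
    rewrite xv12_pow -scalerA.
    have -> : dv false *+ (N1 + n) + (dv true *+ (N1 + n) - x) =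
       dv false *+ N1 + (dv true *+ N1 + (dv false *+ n + (dv true *+ n - x))).
      by rewrite !mulrnDr -!addrA; congr (_ + _); rewrite addrCA.
    by do 2!apply: gr_xv.
  by exists N1, m'.
have [N [w [nN gw ew]]] := H1_hom v1 gm.
have Hc b : exists K, exists e0, i (xv b ^+ K *: w b) e0 /\ pi e0 0.
  move/(qeqE p_gt0 q_gt0): pi0 => /(_ (w b) b) [K [v [[e0 [h1 h2]] /= v0]]].
  by exists K, e0; rewrite -v0.
have [K hK] : exists K, forall b, exists e0, i (xv b ^+ K *: w b) e0 /\ pi e0 0.
  have [[K1 [c1 [i1 p1]]] [K2 [c2 [i2 p2]]]] := (Hc true, Hc false).
  exists (K1 + K2)%N => -[].
    exists (xv true ^+ K2 *: c1); rewrite addnC -xvM -scalerA; split.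
      exact: (grrelS (qrel_gr i)).
    by rewrite -(scaler0 _ (xv true ^+ K2)); apply: (grrelS (qrel_gr pi)).
  exists (xv false ^+ K1 *: c2); rewrite -xvM -scalerA; split.
    exact: (grrelS (qrel_gr i)).
  by rewrite -(scaler0 _ (xv false ^+ K1)); apply: (grrelS (qrel_gr pi)).
pose N2 := (K + N)%N.
have hc b : exists c, [/\ gr (dv b *+ N2 - x) c,
  i (xv b ^+ K *: w b) c & pi c 0].
  have [c0 [h1 h2]] := hK b; have [d hd] := gr_decomp c0.
  have hgr : gr (dv b *+ N2 - x) (xv b ^+ K *: w b).
    by rewrite /N2 mulrnDr -addrA; apply: gr_xv.
  exists (d (dv b *+ N2 - x)); split; first by case: hd.
    by have := grrel_decomp (qrel_gr i) h1 (decomp_homE hgr) hd (dv b *+ N2 -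
      x); rewrite eqxx.
  exact: (grrel_decomp (qrel_gr pi) h2 hd (decomp0 X)).
have [[c1 [gc1 ic1 pc1]] [c0 [gc0 ic0 pc0]]] := (hc true, hc false).
have nN2 : (N1 + n <= N2)%N by rewrite /N2; lia.
(* The lifts are corrected by the images [c1] and [c0] of the cochain, with opposite signs, so that
   its coboundary cancels [wv]. *)
pose e1 := xv true ^+ (N2 - n) *: e true + c1.
pose e0 := xv false ^+ (N2 - n) *: e false - c0.
have ge' b y : gr (dv b *+ n - x) y -> gr (dv b *+ N2 - x) (xv b ^+ (N2 - n) *:
  y).
  have -> : dv b *+ N2 - x = dv b *+ (N2 - n) + (dv b *+ n - x).
    by rewrite addrA -mulrnDr subnK //; lia.
  exact: gr_xv.
have ge1 : gr (dv true *+ N2 - x) e1 by apply: grD => //; apply: ge'.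
have ge0 : gr (dv false *+ N2 - x) e0 by apply: grB => //; apply: ge'.
have pi1 : pi e1 (xv true ^+ (N2 - n) *: a true).
  rewrite -[_ *: a true]addr0; apply: (grrelD (qrel_gr pi)) => //.
  exact: (grrelS (qrel_gr pi)).
have pi0' : pi e0 (xv false ^+ (N2 - n) *: a false).
  rewrite -[_ *: a false]subr0; apply: (grrelB (qrel_gr pi)) => //.
  exact: (grrelS (qrel_gr pi)).
have eqe : xv true ^+ N2 *: e0 - xv false ^+ N2 *: e1 =
   X12 ^+ (N2 - n) *: wv - (xv true ^+ N2 *: c0 + xv false ^+ N2 *: c1).
  rewrite /e0 /e1 /wv !scalerBr !scalerDr !scalerA.
  have -> : xv true ^+ N2 * xv false ^+ (N2 - n) = X12 ^+ (N2 - n) * xv true ^+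
    n.
    have {1}-> : N2 = (N2 - n + n)%N by lia.
    by rewrite xv12_pow exprD; ring.
  have -> : xv false ^+ N2 * xv true ^+ (N2 - n) = X12 ^+ (N2 - n) * xv false ^+
    n.
    have {1}-> : N2 = (N2 - n + n)%N by lia.
    by rewrite xv12_pow exprD; ring.
  by rewrite !opprD !addrA; congr (_ - _); rewrite addrAC.
(* Both sides are values of i at the same multiple of m, hence equal only up to torsion; the
   exponent [K3] is absorbed into the denominators afterwards. *)
have [K3 hK3] : exists K3, xv false ^+ K3 *: (X12 ^+ (N2 - n) *: wv) =
    xv false ^+ K3 *: (xv true ^+ N2 *: c0 + xv false ^+ N2 *: c1).
  apply: (@qkill2 _ _ _ p_gt0 q_gt0 _ _ i false (X12 ^+ (N2 - (N1 + n)) *: m)).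
    have -> : X12 ^+ (N2 - n) = X12 ^+ (N2 - (N1 + n)) * X12 ^+ N1.
      by rewrite -exprD; congr (_ ^+ _); lia.
    by rewrite -scalerA; apply: (grrelS (qrel_gr i)).
  have -> : X12 ^+ (N2 - (N1 + n)) *: m =
     xv true ^+ N2 *: (xv false ^+ K *: w false) + xv false ^+ N2 *: (xv true ^+
       K *: w true).
    have -> : (N2 - (N1 + n) = K + (N - (N1 + n)))%N by rewrite /N2; lia.
    rewrite exprD -scalerA ew scalerDr !scalerA xv12_pow /N2 !exprD.
    by congr (_ *: _ + _ *: _); ring.
  by apply: (grrelD (qrel_gr i)); apply: (grrelS (qrel_gr i)).
clearbody e0 e1 N2; pose e' (b : bool) := xv b ^+ K3 *: if b then e1 else e0.
have ge'' b : gr (dv b *+ (K3 + N2) - x) (e' b).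
  by rewrite mulrnDr -addrA; apply: gr_xv; case: b.
have ce' : xv true ^+ (K3 + N2) *: e' false = xv false ^+ (K3 + N2) *: e' true.
  apply/eqP; rewrite -subr_eq0; apply/eqP.
  transitivity ((xv true ^+ K3 * xv false ^+ K3) *: (xv true ^+ N2 *: e0 - xv
    false ^+ N2 *: e1)).
    by rewrite /e' /= scalerBr !scalerA !exprD; congr (_ *: _ - _ *: _); ring.
  by rewrite eqe -scalerA scalerBr hK3 subrr scaler0.
exists (pairmap ge'' ce').
apply: qeq_line => // b.
exists (K3 + N2)%N, (xv b ^+ K3 *: (xv b ^+ (N2 - n) *: a b)); split.
  exists (e' b); split; first exact: (pairrel_gen x (K3 + N2) e' b).
  by apply: (grrelS (qrel_gr pi)); case: b.
rewrite -xvM; apply: (grrelS (qrel_gr f) (xv b ^+ K3)).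
have -> : N2 = (N2 - n + n)%N by lia.
rewrite addnK -xvM; exact: (grrelS (qrel_gr f) _ (fa b)).
Qed.

End Extensions.

(** * Finite dimensional subspaces and images *)

Section FiniteDimension.
Variables (k : fieldType).
Local Notation S := {mpoly k[2]}.

Lemma findim_sub (M : lmodType S) (U D : M -> Prop) : linsub U ->
  (forall u, U u -> D u) -> findim D -> findim U.
Proof.
move=> lU UD [n [e [_ ge]]].
have [||r [b [Wb bgen]]] := @subspace_basis k n (fun b => U (rcomb e b)).
- by rewrite rcomb0; apply: linsub0.
- by move=> a u v hu hv; rewrite rcombZ; apply: (proj2 lU).
exists r, (fun i => rcomb e (b i)); split=> // u hu.
have [a ha] := ge _ (UD _ hu).
have [|c hc] := bgen (\row_j a j); first by rewrite rcomb_row -ha.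
by exists c; rewrite ha -rcomb_row hc rcomb_sum.
Qed.

(** The image of A lies in D, hence is finite dimensional. Beyond it only those coefficient vectors
    matter whose combination of the [e i] is congruent modulo A to an element of the domain, and
    they form a subspace of k ^ n. *)
Lemma findim_image (p q : nat) (X V : grmod k p q) (R : X -> V -> Prop)
    (A : X -> Prop) (D : V -> Prop) : grrel R -> linsub A -> cofindim A ->
  findim D -> (forall u v, A u -> R u v -> D v) -> findim (fun v =>
    exists u, R u v).
Proof.
move=> hR lA [n [e he]] fD AD.
have [n' [e' [h' g']]] : findim (fun v => exists2 u, A u & R u v).
  apply: (findim_sub _ _ fD) => [|v [u hu /(AD _ _ hu)] //].
  split; first by exists 0; [apply: linsub0 | apply: grrel0].
  move=> f v v' [u hu Ru] [u' hu' Ru'].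
  by exists (f *: u + u'); [apply: (proj2 lA) | apply: grrelZ].
pose W b := exists uv : X * V, R uv.1 uv.2 /\ A (uv.1 - rcomb e b).
have [||r [b [Wb bgen]]] := @subspace_basis k n W.
- exists 0; split; first exact: grrel0.
  by rewrite rcomb0 subr0; apply: linsub0.
- move=> a b b' [[u v] /= [h1 h2]] [[u' v'] /= [h1' h2']].
  exists (a%:MP *: u + u', a%:MP *: v + v'); split; first exact: grrelZ.
  by rewrite rcombZ opprD addrACA -scalerBr; apply: (proj2 lA).
have [uv huv] := fin_all_exists Wb.
exists (r + n')%N,
  (fun i => match split i with inl j => (uv j).2 | inr j => e' j end); split.
  move=> i; case: (split i) => j; first by exists (uv j).1; case: (huv j).
  by have [u _ hu] := h' j; exists u.
move=> v [u Ruv]; have [a ha] := he u.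
have [|c hc] := bgen (\row_j a j); first by exists (u, v); rewrite rcomb_row.
have [|d hd] := g' (v - kcomb c (fun i => (uv i).2)).
  exists (u - kcomb c (fun i => (uv i).1)); last first.
    by apply: grrelB => //; apply: grrel_kcomb => // i; case: (huv i).
  have -> : u - kcomb c (fun i => (uv i).1) =
      (u - kcomb a e) - kcomb c (fun i => (uv i).1 - rcomb e (b i)).
    have -> : kcomb c (fun i => (uv i).1 - rcomb e (b i)) =
        kcomb c (fun i => (uv i).1) - rcomb e (\sum_i c i *: b i).
      by rewrite rcomb_sum /kcomb -sumrB; apply: eq_bigr => i _;
        rewrite scalerBr.
    by rewrite -hc rcomb_row opprB addrA subrK.
  apply: linsubB => //; apply: linsub_sum => // i _.
  by apply: linsubZ => //; case: (huv i).
exists (fun i => match split i with inl j => c j | inr j => d j end).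
by rewrite kcomb_cat -hd addrC subrK.
Qed.

End FiniteDimension.

(** * From exact sequences of graded modules to kernels and cokernels in the quotient category *)

Section HonestSequences.
Variables (k : fieldType) (p q : nat).
Local Notation L := (LL p q).
Local Notation S := {mpoly k[2]}.
Hypotheses (p_gt0 : (0 < p)%N) (q_gt0 : (0 < q)%N).
Variables (M E X : coh k p q) (i : M -> E) (pi : E -> X).
Hypotheses (hi : glin i) (hpi : glin pi).
Hypothesis i_inj : forall u, i u = 0 -> u = 0.
Hypothesis pi_i : forall u, pi (i u) = 0.
Hypothesis ker_pi : forall e, pi e = 0 -> exists u, e = i u.
(** Surjectivity up to powers of the variables is the right condition here: the map to S(x) given by
    x_1 ^ n and x_2 ^ n has an image of finite codimension only. *)
Hypothesis pi_onto : forall x b, exists N e, pi e = xv k b ^+ N *: x.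

(** The factorization of f is f followed by the converse of i. Injectivity of i bounds its
    indeterminacy, and the vanishing of pi f gives it a domain of finite codimension. *)
Lemma honest_kernel : is_kernel (qmap hi) (qmap hpi).
Proof.
split.
  apply/(qeqE p_gt0 q_gt0) => u b; exists 0%N, 0; split=> //.
  by exists (i (xv k b ^+ 0 *: u)).
move=> W f /(qeqE p_gt0 q_gt0) f0.
pose R := relcomp f (fun (e : E) (u : M) => e = i u).
have gc : grrel (fun (e : E) (u : M) => e = i u) := grrel_conv (grrel_glin hi).
have gR : grrel R by apply: grrel_comp gc; apply: qrel_gr.
have ex u b : exists N e m, f (xv k b ^+ N *: u) e /\ e = i m.
  have [N [v [[e [fe ev]] /= v0]]] := f0 u b.
  have [|m hm] := ker_pi (e := e); first by rewrite -ev.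
  by exists N, e, m.
have cR : cofindim (dom R).
  apply: cofindimP; first exact: grsub_dom.
  by move=> u b; have [N [e [m [h1 h2]]]] := ex u b; exists N, m, e.
have fR : findim (indet R).
  apply: (findim_comp (qrel_gr f) gc (qrel_indet f)).
  by apply: findim_zero => u /esym /i_inj.
exists (QHom gR cR fR); split.
  apply/(qeqE p_gt0 q_gt0) => u b; have [N [e [m [h1 h2]]]] := ex u b.
  by exists N, e; split=> //; exists m; split=> //; exists e.
move=> g' /(qeqE p_gt0 q_gt0) h; apply/(qeqE p_gt0 q_gt0) => u b.
have [N [e [[m [h1 h2]] h3]]] := h u b.
by exists N, m; split=> //; exists e.
Qed.

(** The factorization of f is the converse of pi followed by f. The point is its indeterminacy, the
    image of f i: as f i is zero in the quotient category, its values on the domain of the witness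
    [h] lie in the indeterminacy of [h], and [findim_image] applies. *)
Lemma honest_cokernel : is_cokernel (qmap hi) (qmap hpi).
Proof.
split; first by case: honest_kernel.
move=> W f [h hh].
pose R := relcomp (fun (x : X) (e : E) => x = pi e) f.
have gc : grrel (fun (x : X) (e : E) => x = pi e) := grrel_conv (grrel_glin
  hpi).
have gR : grrel R by apply: grrel_comp gc _; apply: qrel_gr.
have ex x b : exists N e v, xv k b ^+ N *: x = pi e /\ f e v.
  have [N [e he]] := pi_onto x b; have [N' [v hv]] := qdom p_gt0 q_gt0 f b e.
  exists (N' + N)%N, (xv k b ^+ N' *: e), v; split=> //.
  by rewrite (glinZ hpi) he scalerA xvM.
have cR : cofindim (dom R).
  apply: cofindimP; first exact: grsub_dom.
  by move=> u b; have [N [e [v [h1 h2]]]] := ex u b; exists N, v, e.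
have fR : findim (indet R).
  have : findim (fun v => exists u, qcomp f (qmap hi) u v).
    apply: (@findim_image k p q M W _ (dom h) (indet h)).
    - exact: qrel_gr (qcomp f (qmap hi)).
    - exact: grsub_linsub (grsub_dom (qrel_gr h)).
    - exact: qrel_dom.
    - exact: qrel_indet.
    move=> u v /hh [_ _ h1 h2] /h1 h3; rewrite /indet -(subrr u) -[v]subr0.
    by apply: (grrelB (qrel_gr h)) h3 _; apply: h2.
  apply: findim_ext => v; split.
    by move=> [u [e [-> fv]]]; exists (i u); rewrite pi_i.
  by move=> [e [/esym/ker_pi [u ->] fv]]; exists u, (i u).
exists (QHom gR cR fR); split.
  apply/(qeqE p_gt0 q_gt0) => e b; have [N [v fv]] := qdom p_gt0 q_gt0 f b e.
  exists N, v; split=> //; exists (pi (xv k b ^+ N *: e)); split=> //.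
  by exists (xv k b ^+ N *: e).
move=> g' /(qeqE p_gt0 q_gt0) h'; apply/(qeqE p_gt0 q_gt0) => x b.
have [N [e he]] := pi_onto x b.
have [N' [v [[x' [/= ex' gv]] fv]]] := h' e b.
have e1 : x' = xv k b ^+ (N' + N) *: x by rewrite ex' (glinZ hpi) he scalerA
  xvM.
rewrite e1 in gv.
exists (N' + N)%N, v; split=> //; exists (xv k b ^+ N' *: e); split=> //.
by rewrite (glinZ hpi) he scalerA xvM.
Qed.

End HonestSequences.

(** * An extension whose splitting kills a given Cech class *)

Section Pushout.
Variables (k : fieldType) (p q : nat).
Local Notation L := (LL p q).
Local Notation S := {mpoly k[2]}.
Local Notation dv := (dv p q).
Local Notation xv := (xv k).
Local Notation X12 := (xv false * xv true).
Hypotheses (p_gt0 : (0 < p)%N) (q_gt0 : (0 < q)%N).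
Variables (x : L) (M W : coh k p q) (n : nat) (m : M).
Hypothesis gm : gr (dv false *+ n + (dv true *+ n - x)) m.

Let line_n b : coh k p q := line k (x - dv b *+ n).
Let P : coh k p q := dsum M (dsum (line_n false) (line_n true)).
(* Dividing P by kap gives the pushout along m of the Koszul sequence of x_1 ^ n
   and x_2 ^ n. *)
Let kap : P := (- m, (xv true ^+ n : S^o, - xv false ^+ n : S^o)).

Lemma kap_gr : gr (dv false *+ n + (dv true *+ n - x)) kap.
Proof.
have e0 : x - dv false *+ n + (dv false *+ n + (dv true *+ n - x)) = dv true *+
  n.
  by rewrite -addrA addKr addrC subrK.
have e1 : x - dv true *+ n + (dv false *+ n + (dv true *+ n - x)) = dv false *+
  n.
  rewrite [dv false *+ n + _]addrCA -addrA addKr [dv false *+ n + _]addrC.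
  by rewrite addrA subrr add0r.
split; [exact: grN | split; rewrite /= /gr_line].
  by rewrite e0; apply: homdeg_xv.
by rewrite e1; apply: homdegN; apply: homdeg_xv.
Qed.

Let U : gsub P := GSub (grsub_cyclic kap_gr).
(** The summand W is carried along unchanged, because Ext^1 is only assumed to vanish for O(x)
    together with the other summands. *)
Let E : coh k p q := dsum (quot U) W.
Let phi (u : P) : line k x := (u.2.1 : S) * xv false ^+ n + (u.2.2 : S) * xv
  true ^+ n.

Lemma phi_glin : glin phi.
Proof.
split=> [f [u [v w]] [u' [v' w']]|y [u [v w]] [_ [/= hv hw]]]; rewrite /phi /=.
  rewrite /GRing.scale /= /GRing.scale /=; ring.
have e b : x + y = (x - dv b *+ n + y) + dv b *+ n by rewrite addrAC subrK.
have hv' : homdeg (x - dv false *+ n + y) (v : S) := hv.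
have hw' : homdeg (x - dv true *+ n + y) (w : S) := hw.
apply: homdegD.
  by rewrite (e false); apply: (homdegM hv'); apply: homdeg_xv.
by rewrite (e true); apply: (homdegM hw'); apply: homdeg_xv.
Qed.

Lemma phi_kap u : U u -> phi u = 0.
Proof.
move=> [g ->]; rewrite (glinZ phi_glin) /phi /= mulNr mulrC subrr.
by rewrite scaler0.
Qed.

Let i (u : M) : E := (qpi U (u, 0), 0).
Let pi (e : E) : dsum (line k x) W := (phi (qrepr e.1), e.2).

Lemma pushout_i_glin : glin i.
Proof.
split=> [f u v|y u hu].
  rewrite /i; congr pair; last by rewrite /= scaler0 addr0.
  transitivity (f *: qpi U (u, 0) + qpi U (v, 0)) => //.
  rewrite -qpiZ -qpiD; congr (qpi U _).
  by congr pair; rewrite /= scaler0 addr0.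
split; last exact: gr0.
exists (u, 0) => //; split=> //=; exact: (@gr0 _ _ _ (dsum (line_n false)
  (line_n true))).
Qed.

Lemma pushout_pi_glin : glin pi.
Proof.
have h := glin_quot phi_glin phi_kap.
split=> [f [u1 u2] [v1 v2]|y [u1 u2] [h1 h2]].
  by congr pair; apply: (proj1 h).
by split=> //=; apply: (proj2 h).
Qed.

Lemma pushout_i_inj u : i u = 0 -> u = 0.
Proof.
move=> /(congr1 (fun z : E => z.1)) /= h; have : U ((u,
  0) - 0) by apply/qpi_eq; rewrite qpi0.
rewrite subr0 => -[g e].
have : g * xv true ^+ n = 0 := esym (congr1 (fun z : P => z.2.1 : S) e).
move/eqP; rewrite mulf_eq0 (negPf (xv_neq0 _ _ _)) orbF => /eqP g0.
by have := congr1 (fun z : P => z.1) e; rewrite /= g0 scale0r.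
Qed.

Lemma pushout_pi_i u : pi (i u) = 0.
Proof.
rewrite /pi /i /= quot_reprE; [|exact: phi_glin|exact: phi_kap].
by rewrite /phi /= !mul0r addr0.
Qed.

Lemma pushout_normal (u : P) h :
  u.2.1 = xv true ^+ n * h :> S -> u.2.2 = - (xv false ^+ n * h) :> S ->
  u - (u.1 + h *: m, 0) = h *: kap.
Proof.
case: u => u1 [u2 u3] /= -> ->; congr pair; last congr pair => /=.
- by rewrite /= opprD addrA subrr sub0r scalerN.
- by rewrite /= subr0 mulrC.
- by rewrite /= subr0 /GRing.scale /= mulrN mulrC.
Qed.

Lemma pushout_ker e : pi e = 0 -> exists u, e = i u.
Proof.
case: e => w o e0.
have h : ((qrepr w).2.1 : S) * xv false ^+ n + ((qrepr w).2.2 : S) * xv true ^+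
  n = 0.
  exact: (congr1 (fun z : dsum (line k x) W => z.1 : S) e0).
have -> : o = 0 := congr1 (fun z : dsum (line k x) W => z.2) e0.
have [|g [e1 e2]] := @koszul k (qrepr w).2.1 (qrepr w).2.2 false n n.
  by rewrite -[RHS]h; congr (_ + _); rewrite mulrC.
exists ((qrepr w).1 + g *: m); rewrite /i; congr pair.
rewrite -{1}[w]qreprK; apply/qpi_eq; exists g.
exact: pushout_normal.
Qed.

Lemma pushout_onto u b : exists N e, pi e = xv b ^+ N *: u.
Proof.
case: u => f o; exists n.
pose v : P := (0, if b then (0, f) else (f, 0)).
exists (qpi U v, xv b ^+ n *: o); congr pair => /=.
rewrite quot_reprE; [|exact: phi_glin|exact: phi_kap].
by rewrite /phi /v; case: b {v}; rewrite /= ?mul0r ?add0r ?addr0 mulrC.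
Qed.

Hypothesis ext0 : ext1_vanishes (dsum (line k x) W) M.

(** A splitting over O(x) gives elements [u b] of P that [phi] maps to x_b ^ N' and whose difference
    on the overlap is a multiple c of [kap]. Solving for c by [koszul] and comparing the components
    in M exhibits (x_1 x_2) ^ (N' - n) m as a coboundary. *)
Lemma pushout_H1 : exists N (w : bool -> M), (n <= N)%N /\
    X12 ^+ (N - n) *: m = xv true ^+ N *: w false + xv false ^+ N *: w true.
Proof.
have [s hs] := ext0 (honest_kernel p_gt0 q_gt0 pushout_i_glin pushout_pi_glin
  pushout_i_inj pushout_pi_i pushout_ker)
  (honest_cokernel p_gt0 q_gt0 pushout_i_glin pushout_pi_glin pushout_i_inj
    pushout_pi_i pushout_ker pushout_onto).
pose io (f : line k x) : dsum (line k x) W := (f, 0).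
have hio : glin io.
  split=> [f u v|y u hu]; first by congr pair; rewrite /= scaler0 addr0.
  by split=> //; apply: gr0.
have [N [w [_ cw sw]]] := qhom_pair p_gt0 q_gt0 (qcomp s (qmap hio)).
have Hb b : exists K, xv b ^+ K *: pi (w b) = xv b ^+ K *: io (xv b ^+ N : S^o).
  have [u [eu su]] := sw b; rewrite /= in eu; rewrite {u}eu in su.
  move/(qeqE p_gt0 q_gt0): hs => /(_ (io (xv b ^+ N : S^o)) b) [N' [v [h1 h2]]].
  rewrite /= in h2; subst v.
  have h3 : qcomp (qmap pushout_pi_glin) s (io (xv b ^+ N : S^o)) (pi (w b)).
    by exists (w b); split; [exact: su | reflexivity].
  have h4 := grrelS (qrel_gr (qcomp (qmap pushout_pi_glin) s)) (xv b ^+ N') h3.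
  have [K hK] := qkill2 p_gt0 q_gt0 b h4 h1.
  by exists (K + N')%N; rewrite -xvM -!scalerA hK.
have [[K1 h1] [K2 h2]] := (Hb true, Hb false).
(* [K] absorbs the torsion on both charts; its summand n ensures n <= N'. *)
pose K := (K1 + K2 + n)%N; pose N' := (K + N)%N.
have hpi b : pi (xv b ^+ K *: w b) = io (xv b ^+ N' : S^o).
  have -> : io (xv b ^+ N' : S^o) = xv b ^+ K *: io (xv b ^+ N : S^o).
    by rewrite /N' -xvM; congr pair; rewrite /= scaler0.
  rewrite (glinZ pushout_pi_glin) /K; case: b.
    have -> : (K1 + K2 + n = (K2 + n) + K1)%N by lia.
    by rewrite -xvM -!scalerA h1.
  have -> : (K1 + K2 + n = (K1 + n) + K2)%N by lia.
  by rewrite -xvM -!scalerA h2.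
have cw' : xv true ^+ N' *: (xv false ^+ K *: w false) = xv false ^+ N' *: (xv
  true ^+ K *: w true).
  transitivity ((xv true ^+ K * xv false ^+ K) *: (xv true ^+ N *: w false)).
    by rewrite !scalerA /N' exprD; congr (_ *: _); ring.
  by rewrite cw !scalerA /N' exprD; congr (_ *: _); ring.
have nN' : (n <= N')%N by rewrite /N' /K; lia.
clearbody N'; pose u b : P := qrepr (xv b ^+ K *: w b).1.
have hu b : ((u b).2.1 : S) * xv false ^+ n + ((u b).2.2 : S) * xv true ^+ n =
  xv b ^+ N'.
  exact: (congr1 (fun z : dsum (line k x) W => z.1 : S) (hpi b)).
have [c hc] : U (xv true ^+ N' *: u false - xv false ^+ N' *: u true).
  apply/qpi_eq.
  have hq b b' : qpi U (xv b ^+ N' *: u b') = xv b ^+ N' *: (xv b' ^+ K *: w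
    b').1.
    by rewrite -[X in _ = _ *: X]qreprK; apply: qpiZ.
  refine (etrans (hq true false) (etrans _ (esym (hq false true)))).
  exact (congr1 (fun z : E => z.1) cw').
clearbody u.
have eN b : xv b ^+ N' = xv b ^+ (N' - n) * xv b ^+ n by rewrite xvM subnK.
have [|h [ef0 eg0]] := @koszul k ((u false).2.1 - xv false ^+ (N' - n) : S) (u
  false).2.2 false n n.
  apply: (addIr (xv false ^+ N')); rewrite add0r -{2}(hu false) eN; ring.
have [|h' [ef1 eg1]] := @koszul k ((u true).2.1 : S) ((u true).2.2 - xv true ^+
  (N' - n) : S) false n n.
  apply: (addIr (xv true ^+ N')); rewrite add0r -{2}(hu true) eN /=; ring.
have e1 : xv true ^+ N' *: (u false).1 - xv false ^+ N' *: (u true).1 = - (c *: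
  m).
  by rewrite -[RHS]scalerN; apply: (congr1 (fun z : P => z.1) hc).
have e2 : xv true ^+ N' * ((u false).2.1 : S) - xv false ^+ N' * ((u true).2.1 :
  S) = c * xv true ^+ n.
  exact: (congr1 (fun z : P => z.2.1 : S) hc).
(* The component in O(x - n x_1), divided by x_2 ^ n. *)
have ec : c = X12 ^+ (N' - n) + xv true ^+ N' * h - xv false ^+ N' * h'.
  apply: (mulIf (xv_neq0 k true n)); rewrite -e2 ef1.
  have -> : ((u false).2.1 : S) = xv false ^+ (N' - n) + xv true ^+ n * h.
    by rewrite -[RHS]addrC; apply/eqP; rewrite -subr_eq; apply/eqP.
  rewrite xv12_pow (eN true) /=; ring.
exists N', (fun b => if b then (u true).1 + h' *: m else - (u false).1 - h *:
  m).
split; first exact: nN'.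
have {}ec : X12 ^+ (N' - n) = c - xv true ^+ N' * h + xv false ^+ N' * h' by
  rewrite ec; ring.
have {}e1 : c *: m = xv false ^+ N' *: (u true).1 - xv true ^+ N' *: (u
  false).1.
  by rewrite -[LHS]opprK -e1 opprB.
rewrite {}ec 2!scalerDl {}e1 scaleNr -2!scalerA scalerBr scalerDr scalerN.
by rewrite [RHS]addrCA -!addrA.
Qed.

End Pushout.

Section ExtVanishing.
Variables (k : fieldType) (p q : nat).
Hypotheses (p_gt0 : (0 < p)%N) (q_gt0 : (0 < q)%N).

Lemma ext1_H1 (x : LL p q) (M W : coh k p q) :
  ext1_vanishes (dsum (line k x) W) M -> H1_vanishes M (- x).
Proof. by move=> h n m gm; apply: pushout_H1 gm h. Qed.

End ExtVanishing.

(** * Sums of line bundles *)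

Section SumsOfLines.
Variables (k : fieldType) (p q : nat).
Local Notation L := (LL p q).
Local Notation S := {mpoly k[2]}.
Local Notation dv := (dv p q).
Local Notation xv := (xv k).
Local Notation X12 := (xv false * xv true).
Local Notation D := (dsum_lines k).
Implicit Types s t : seq L.

Fixpoint lcoord s (i : nat) : D s -> S :=
  if s is x :: s' then
    fun u => if i is i'.+1 then @lcoord s' i' u.2 else u.1
  else fun=> 0.

Fixpoint lbase s (i : nat) : D s :=
  if s is x :: s' then
    if i is i'.+1 then (0, lbase s' i') else (1 : S^o, 0)
  else 0.

Lemma lcoord_lin s i f (u v : D s) : lcoord i (f *: u + v) = f * lcoord i u +
  lcoord i v.
Proof. by elim: s i u v => [|x s IH] [|i] u v /=; rewrite ?mulr0 ?addr0 //. Qed.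

Lemma lcoordZ s i f (u : D s) : lcoord i (f *: u) = f * lcoord i u.
Proof. by elim: s i u => [|x s IH] [|i] u /=; rewrite ?mulr0. Qed.

Lemma lcoordD s i (u v : D s) : lcoord i (u + v) = lcoord i u + lcoord i v.
Proof. by elim: s i u v => [|x s IH] [|i] u v /=; rewrite ?addr0. Qed.

Lemma lcoord0 s i : lcoord i (0 : D s) = 0.
Proof. by elim: s i => [|x s IH] [|i] /=. Qed.

Lemma lcoord_sum s i I (r : seq I) (P : pred I) (F : I -> D s) :
  lcoord i (\sum_(j <- r | P j) F j) = \sum_(j <- r | P j) lcoord i (F j).
Proof. by elim/big_rec2: _ => [|j y z _ <-]; [exact: lcoord0 | exact: lcoordD].
  Qed.

Lemma lcoord_ba s i j : (i < size s)%N -> lcoord j (lbase s i) = (j == i)%:R.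
Proof.
elim: s i j => // x s IH [|i] [|j] //=; first by rewrite lcoord0.
by rewrite ltnS => /IH ->.
Qed.

Lemma lbase_expand s (u : D s) : u = \sum_(i < size s) lcoord i u *: lbase s i.
Proof.
elim: s u => [|x s IH] u /=; first by rewrite big_ord0; apply: thinmx0.
case: u => a u; rewrite big_ord_recl /=.
have -> : \sum_(i < size s) lcoord i u *: ((0 : line k x), lbase s i) = (0,
  u) :> D (x :: s).
  rewrite [in RHS](IH u); elim/big_rec2: _ => // i y z _ ->.
  by congr pair; rewrite /= scaler0 addr0.
by congr pair; rewrite /= ?scaler0 ?add0r // addr0 /GRing.scale /= mulr1.
Qed.

Lemma lcoord_inj s (u v : D s) : (forall i, (i < size s)%N ->
  lcoord i u = lcoord i v) -> u = v.
Proof.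
by move=> h; rewrite [u]lbase_expand [v]lbase_expand; apply: eq_bigr => i _;
  rewrite h.
Qed.

Lemma lines_torsionfree s f (u : D s) : f != 0 -> f *: u = 0 -> u = 0.
Proof.
move=> f0 h; apply: lcoord_inj => i _; rewrite lcoord0; apply/eqP.
have := lcoord0 s i; rewrite -h lcoordZ => /eqP.
by rewrite mulf_eq0 (negPf f0).
Qed.

Lemma lcoord_gr s i y (u : D s) : gr y u -> homdeg (nth 0 s i + y) (lcoord i u).
Proof.
elim: s i u => [|x s IH] [|i] u /=; try by move=> _; apply: homdeg0.
  by case.
by case=> _; apply: IH.
Qed.

Lemma lcoord_glin s i : (i < size s)%N -> glin (N := line k (nth 0 s i)) (fun u
  : D s => lcoord i u).
Proof. by move=> hi; split=> [f u v|y u]; [exact: lcoord_lin | exact: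
  lcoord_gr]. Qed.

Lemma lbase_glin s i : (i < size s)%N ->
  glin (M := line k (nth 0 s i)) (fun f : S => f *: lbase s i).
Proof.
move=> hi; split=> [f u v|y u hu]; first by rewrite scalerDl scalerA.
elim: s i hi u hu => // x s IH [|i] /= hi u hu.
  split=> /=; last by rewrite scaler0; apply: (@gr0 k p q (D s)).
  by rewrite /GRing.scale /= mulr1.
split=> /=; last exact: IH.
by rewrite scaler0; apply: (@gr0 k p q (line k x)).
Qed.

Hypotheses (p_gt0 : (0 < p)%N) (q_gt0 : (0 < q)%N).

(** Two values differ by torsion ([qkill2]), and a sum of line bundles has none. *)
Lemma qhom_lines_fun s (X : coh k p q) (f : qhom X (D s)) u v w : f u v ->
  f u w -> v = w.
Proof.
move=> h h'; have [K hK] := qkill2 p_gt0 q_gt0 true h h'.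
apply/eqP; rewrite -subr_eq0; apply/eqP; apply: (lines_torsionfree (xv_neq0 k
  true K)).
by rewrite scalerBr hK subrr.
Qed.

Lemma hom_vanishes_lines s X : (forall x, x \in s ->
  hom_vanishes (line k x) X) ->
  hom_vanishes (D s) X.
Proof.
move=> h f; apply/(qeqE p_gt0 q_gt0) => u b.
have H (i : 'I_(size s)) : exists N, f (xv b ^+ N *: (lcoord i u *: lbase s i))
  0.
  have := h _ (mem_nth 0 (ltn_ord i)) (qcomp f (qmap (X := line k (nth 0 s i))
    (lbase_glin (ltn_ord i)))).
  move/(qeqE p_gt0 q_gt0) => /(_ (lcoord i u : S^o) b) [N [v [[w [/= ->
    h1]] h2]]].
  by exists N; rewrite scalerA -h2.
have lf : linsub (fun w => f w 0).
  split; first exact: grrel0 (qrel_gr f).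
  by move=> g w w' h1 h2; have := grrelZ g (qrel_gr f) h1 h2;
    rewrite scaler0 addr0.
have [N hN] := xv_sum (r := enum 'I_(size s)) lf (fun i _ => H i).
exists N, 0; split=> //; rewrite [u]lbase_expand scaler_sumr.
by apply: (linsub_sum lf) => i _; apply: hN; rewrite mem_enum.
Qed.

Lemma hom_vanishes_line s X x : x \in s -> hom_vanishes (D s) X ->
  hom_vanishes (line k x) X.
Proof.
move=> xs h f; have hi : (index x s < size s)%N by rewrite index_mem.
have e := nth_index 0 xs; rewrite -e in f *.
apply/(qeqE p_gt0 q_gt0) => u b.
have /(qeqE p_gt0 q_gt0) := h (qcomp f (qmap (lcoord_glin hi))).
move=> /(_ ((u : S) *: lbase s (index x s)) b) [N [v [[w [/= -> h1]] h2]]].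
exists N, 0; split=> //; rewrite -h2; move: h1.
by rewrite !lcoordZ lcoord_ba // eqxx mulr1.
Qed.

Lemma H1_lines s y : (forall x, x \in s -> H1_vanishes (line k x) y) <->
  H1_vanishes (D s) y.
Proof.
split=> [h n m gm|h x xs n m gm].
  have H (i : 'I_(size s)) : exists N, exists w : bool -> S, (n <= N)%N /\
    X12 ^+ (N - n) * lcoord i m = xv true ^+ N * w false + xv false ^+ N * w
      true.
    have [N [w [nN e]]] := h _ (mem_nth 0 (ltn_ord i)) n (lcoord i m : S^o)
      (@lcoord_gr s i _ _ gm).
    by exists N, w.
  have [Nf hNf] := fin_all_exists H.
  pose N := (n + \sum_i Nf i)%N.
  have leN (i : 'I_(size s)) : (Nf i <= N)%N by rewrite /N (bigD1 i) //=; lia.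
  have nN : (n <= N)%N by rewrite /N leq_addr.
  clearbody N; have {}H (i : 'I_(size s)) : exists w : bool -> S,
    X12 ^+ (N - n) * lcoord i m = xv true ^+ N * w false + xv false ^+ N * w
      true.
    have [w [nNi e]] := hNf i; have le := leN i.
    exists (fun b => xv b ^+ (N - Nf i) * w b).
    have -> : (N - n = (N - Nf i) + (Nf i - n))%N by lia.
    rewrite exprD -mulrA e xv12_pow.
    have eN b : xv b ^+ N = xv b ^+ (N - Nf i) * xv b ^+ Nf i by rewrite xvM
      subnK.
    rewrite (eN true) (eN false); ring.
  have [w hw] := fin_all_exists H.
  exists N, (fun b => \sum_i w i b *: lbase s i); split=> //.
  rewrite [m]lbase_expand !scaler_sumr -big_split; apply: eq_bigr => i _.
  by rewrite /= !scalerA -scalerDl hw.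
have hi : (index x s < size s)%N by rewrite index_mem.
have e := nth_index 0 xs; rewrite -e in m gm *.
have [N [w [nN ew]]] := h n _ (proj2 (lbase_glin hi) _ _ gm).
exists N, (fun b => lcoord (index x s) (w b)); split=> //.
have := congr1 (@lcoord s (index x s)) ew.
by rewrite !lcoordZ lcoordD !lcoordZ lcoord_ba // eqxx mulr1.
Qed.

(** [lift_line] lifts the inclusion of each summand along pi. Composed with the projections, these
    lifts are added up one index at a time by [qadd], which lifts the partial sums of the
    identity. *)
Lemma ext1_lines s (M : coh k p q) : (forall x,
  x \in s -> H1_vanishes M (- x)) ->
  ext1_vanishes (D s) M.
Proof.
move=> h E i pi ker cok.
have H r : all (fun j => j < size s)%N r -> exists g : qhom (D s) E,
  forall u b, exists N e,
    g (xv b ^+ N *: u) e /\ pi e (xv b ^+ N *: \sum_(j <- r) lcoord j u *: lbase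
      s j).
  elim: r => [|j r IH] /=.
    move=> _; exists (qzero (D s) E) => u b; exists 0%N, 0; split=> //.
    by rewrite big_nil scaler0; apply: grrel0 (qrel_gr pi).
  move=> /andP [hj /IH [g hg]].
  have [s0 hs0] := lift_line p_gt0 q_gt0 (qmap (X := line k (nth 0 s j))
    (lbase_glin hj)) ker cok (h _ (mem_nth 0 hj)).
  exists (qadd p_gt0 q_gt0 (qcomp s0 (qmap (lcoord_glin hj))) g) => u b.
  have [N [e [ge pe]]] := hg u b.
  move/(qeqE p_gt0 q_gt0): hs0 => /(_ (lcoord j u : S^o) b) [N' [v [[e' [se
    pe']] /= hv]]].
  exists (N + N')%N, (xv b ^+ N *: e' + xv b ^+ N' *: e); split.
    exists (xv b ^+ N *: e'), (xv b ^+ N' *: e); split=> //.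
      apply: (@qrel_mul _ _ _ _ _ (qcomp s0 (qmap (lcoord_glin hj)))).
      exists (lcoord j (xv b ^+ N' *: u)); split=> //.
      by rewrite lcoordZ.
    by rewrite addnC; apply: (qrel_mul _ ge).
  rewrite big_cons scalerDr; apply: (grrelD (qrel_gr pi)).
    by apply: (@qrel_mul' _ _ _ _ _ pi); move: pe'; rewrite hv scalerA.
  by rewrite addnC; apply: (@qrel_mul' _ _ _ _ _ pi).
have [|g hg] := H (iota 0 (size s)); first by apply/allP => j; rewrite mem_iota.
exists g; apply/(qeqE p_gt0 q_gt0) => u b.
have [N [e [ge pe]]] := hg u b.
exists N, (xv b ^+ N *: u); split=> //.
exists e; split=> //; move: pe.
have -> : iota 0 (size s) = index_iota 0 (size s) by rewrite /index_iota subn0.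
by rewrite big_mkord -lbase_expand.
Qed.

End SumsOfLines.

(** * Uniqueness of the decomposition into line bundles *)

Section KrullSchmidt.
Variables (k : fieldType) (p q : nat).
Local Notation L := (LL p q).
Local Notation S := {mpoly k[2]}.
Local Notation dv := (dv p q).
Local Notation xv := (xv k).
Local Notation D := (dsum_lines k).
Implicit Types s t : seq L.

Definition gr_iso (X Y : coh k p q) : Prop := exists (phi : X ->
  Y) (psi : Y -> X),
  [/\ glin phi, glin psi, cancel phi psi & cancel psi phi].

Lemma gr_iso_refl X : gr_iso X X.
Proof. by exists id, id; split. Qed.

Lemma gr_iso_sym X Y : gr_iso X Y -> gr_iso Y X.
Proof. by move=> [phi [psi [h1 h2 h3 h4]]]; exists psi, phi. Qed.

Lemma gr_iso_trans X Y Z : gr_iso X Y -> gr_iso Y Z -> gr_iso X Z.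
Proof.
move=> [f [g [h1 h2 h3 h4]]] [f' [g' [h1' h2' h3' h4']]].
exists (fun u => f' (f u)), (fun u => g (g' u)); split; try exact: glin_comp.
  by move=> u; rewrite h3'.
by move=> u; rewrite h4.
Qed.

Lemma gr_iso_dsum X Y Z : gr_iso X Y -> gr_iso (dsum Z X) (dsum Z Y).
Proof.
move=> [f [g [h1 h2 h3 h4]]].
exists (fun u => (u.1, f u.2)), (fun u => (u.1, g u.2)); split.
- split=> [a u v|y u [hu hu']]; first by rewrite (proj1 h1).
  by split=> //; apply: (proj2 h1).
- split=> [a u v|y u [hu hu']]; first by rewrite (proj1 h2).
  by split=> //; apply: (proj2 h2).
- by move=> [u v] /=; rewrite h3.
- by move=> [u v] /=; rewrite h4.
Qed.

Lemma gr_iso_swap X Y Z : gr_iso (dsum X (dsum Y Z)) (dsum Y (dsum X Z)).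
Proof.
exists (fun u => (u.2.1, (u.1, u.2.2))), (fun u => (u.2.1, (u.1, u.2.2)));
  split.
- by split=> [a u v|y u [hu [hu' hu'']]] //; split.
- by split=> [a u v|y u [hu [hu' hu'']]] //; split.
- by case=> [u [v w]].
- by case=> [u [v w]].
Qed.

Lemma gr_iso_dsum0 x : gr_iso (line k x) (D [:: x]).
Proof.
exists (fun f => (f, 0)), (fun u => u.1); split.
- split=> [f u v|y u hu]; first by congr pair; apply/esym; apply: thinmx0.
  by split.
- by split=> [f u v|y u []].
- by [].
- by case=> u v /=; congr pair; apply/esym; apply: thinmx0.
Qed.

Lemma gr_iso_rem s x : x \in s -> gr_iso (D s) (D (x :: rem x s)).
Proof.
elim: s => // y s IH; rewrite inE /=; have [-> _|yx] := eqVneq y x.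
  exact: gr_iso_refl.
move=> /= /IH h.
exact: gr_iso_trans (gr_iso_dsum _ h) (gr_iso_swap _ _ _).
Qed.

Lemma gr_iso_perm s t : perm_eq s t -> gr_iso (D s) (D t).
Proof.
elim: s t => [|x s IH] t h.
  by move: h; rewrite perm_sym => /perm_nilP ->; apply: gr_iso_refl.
have xt : x \in t by rewrite -(perm_mem h) mem_head.
apply: (gr_iso_trans _ (gr_iso_sym (gr_iso_rem xt))).
apply: gr_iso_dsum; apply: IH.
by rewrite -(perm_cons x) (permPl h) perm_to_rem.
Qed.

Hypotheses (p_gt0 : (0 < p)%N) (q_gt0 : (0 < q)%N).

Lemma gr_iso_qiso X Y : gr_iso X Y -> qiso X Y.
Proof.
move=> [f [g [h1 h2 h3 h4]]]; exists (qmap h1), (qmap h2).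
split; apply: qeq_ext => // u v; split=> /=.
- by move=> [w [-> ->]]; rewrite h3.
- by move=> <-; exists (f u); rewrite h3.
- by move=> [w [-> ->]]; rewrite h4.
- by move=> <-; exists (g u); rewrite h4.
Qed.

Lemma qiso_perm s t : perm_eq s t -> qiso (D s) (D t).
Proof. by move=> h; apply/gr_iso_qiso/gr_iso_perm. Qed.

Lemma mem_summand s x : x \in s -> is_summand (line k x) (D s).
Proof. by move=> xs; exists (D (rem x s)); apply/gr_iso_qiso/gr_iso_rem. Qed.

(** If m + m' has degree zero, its exponents are (t p, - t q), and both are nonnegative only for t =
    0. *)
Lemma mdegL_anti m m' : mdegL p q m = - mdegL p q m' -> mdegL p q m = 0.
Proof.
move=> e; have : mdegL p q (m + m')%MM = 0 by rewrite mdegLD e addNr.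
rewrite mdegL_el => /(el_eq0 _ p_gt0) [t [h1 h2]].
rewrite mdegL_el; apply/(el_eq0 _ p_gt0); exists 0.
by move: h1 h2; rewrite !mnmDE; nia.
Qed.

(** By [koszul] two local sections that agree on the overlap come from one polynomial g of degree z
    + y, and there is no monomial of that degree. *)
Lemma H0_line z y : (forall m, mdegL p q m <> z + y) ->
  H0_vanishes (line k z) y.
Proof.
move=> h N w gw cw b; exists 0%N.
have [|g [e0 e1]] := @koszul k (w false : S) (- (w true : S)) true N N.
  by move: cw; rewrite /GRing.scale /= => ->; rewrite mulrN subrr.
suff g0 : g = 0.
  rewrite scale1r; case: b; last by rewrite e0 g0 mulr0.
  by rewrite -[w true]opprK e1 g0 mulr0 oppr0 oppr0.
apply/mpolyP => m; rewrite mcoeff0; apply/eqP/negbNE; apply/negP => gm.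
case: (h m); apply: (addrI (dv false *+ N)).
have gw0 : homdeg (z + (dv false *+ N + y)) (w false : S) := gw false.
have h2 : mdegL p q (m + U_(iv false) *+ N)%MM = z + (dv false *+ N + y).
  apply: gw0; rewrite mcoeff_msupp e0 mcoeffMxv mnmDE mulmUn eqxx muln1 leq_addl
    addmK.
  exact: gm.
by rewrite [LHS]addrC -(mdegL_mul p q false N) -mdegLD h2 mdegL_mul addrCA.
Qed.

Lemma hom_vanishes_line_line (x z : L) : (forall m, mdegL p q m <> z - x) ->
  hom_vanishes (line k x) (line k z).
Proof. by move=> h; apply: H0_hom => //; apply: H0_line. Qed.

Lemma hom_line_or (x z : L) : x <> z ->
  hom_vanishes (line k x) (line k z) \/ hom_vanishes (line k z) (line k x).
Proof.
move=> xz.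
have [[m hm]|h] := classic (exists m, mdegL p q m = z - x); last first.
  by left; apply: hom_vanishes_line_line => m hm; apply: h; exists m.
right; apply: hom_vanishes_line_line => m' hm'; apply: xz.
have := @mdegL_anti m m'; rewrite hm hm' opprB => /(_ erefl) /eqP.
by rewrite subr_eq0 => /eqP.
Qed.

(** The identity of O(x) factors through [D s]. If x is not in s, each composite O(x) -> O(s_i) ->
    O(x) vanishes because one of its factors does by [hom_line_or], so the identity would kill a
    power of x_2. *)
Lemma summand_mem s x : is_summand (line k x) (D s) -> x \in s.
Proof.
move=> [Y [f [g [_ fg]]]]; apply: NNPP => /negP xs.
move/(qeqE p_gt0 q_gt0): fg => /(_ ((1 : S^o), 0) true) [N [v [[w [gw fw]] /=
  ev]]].
subst v.
have hio : @glin k p q (line k x) (dsum (line k x) Y) (fun f => (f, 0)).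
  split=> [a u v|y u hu]; first by congr pair; rewrite /= ?scaler0 ?addr0.
  by split=> //; apply: gr0.
have hpr : @glin k p q (dsum (line k x) Y) (line k x) (fun u => u.1).
  by split=> [a u v|y u []].
pose a : qhom (line k x) (D s) := qcomp g (qmap hio).
pose b : qhom (D s) (line k x) := qcomp (qmap hpr) f.
have aw : a (xv true ^+ N : S^o) w.
  exists ((xv true ^+ N : S^o), 0); split=> //.
  have <- : xv true ^+ N *: ((1 : S^o, 0) : dsum (line k x) Y) = (xv true ^+ N :
    S^o, 0).
    congr pair; last exact: scaler0.
    exact: mulr1.
  exact: gw.
have bw : b w (xv true ^+ N : S^o).
  exists (xv true ^+ N *: ((1 : S^o), 0)); split; first exact: fw.
  by rewrite /= /GRing.scale /= mulr1.
have lb : linsub (fun w => b w 0).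
  split; first exact: grrel0 (qrel_gr b).
  by move=> c u u' h1 h2; have := grrelZ c (qrel_gr b) h1 h2;
    rewrite scaler0 addr0.
have H (i : 'I_(size s)) : exists K, b (xv true ^+ K *: (lcoord i w *: lbase k s
  i)) 0.
  have ne : x <> nth 0 s i by move=> e; move: xs; rewrite e mem_nth.
  have [h|h] := hom_line_or ne.
    have := h (qcomp (qmap (lcoord_glin k (ltn_ord i))) a).
    move/(qeqE p_gt0 q_gt0) => /(_ (xv true ^+ N : S^o) true) [K [v [[w' [aw' /=
      ew]] v0]]].
    have := qhom_lines_fun p_gt0 q_gt0 aw' (grrelS (qrel_gr a) (xv true ^+ K)
      aw).
    move=> ew'; exists 0%N; suff -> : lcoord i w = 0 by rewrite scale0r scaler0;
      apply: linsub0 lb.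
    have : lcoord i w' = 0 by rewrite -ew.
    move/eqP; rewrite ew' lcoordZ mulf_eq0 (negPf (xv_neq0 _ _ _)) => /eqP //.
  have := h (qcomp b (qmap (X := line k (nth 0 s i)) (lbase_glin k (ltn_ord
    i)))).
  move/(qeqE p_gt0 q_gt0) => /(_ (lcoord i w : S^o) true) [K [v [[w' [/= ew h1]]
    /= h2]]].
  by exists K; rewrite {}h2 {}ew in h1; rewrite scalerA; exact: h1.
have [K hK] := xv_sum (r := enum 'I_(size s)) lb (fun i _ => H i).
have h0 : b (xv true ^+ K *: w) 0.
  rewrite [w]lbase_expand scaler_sumr.
  by apply: (linsub_sum lb) => i _; apply: hK; rewrite mem_enum.
have h1 := grrelS (qrel_gr b) (xv true ^+ K) bw.
have [K' hK'] := qkill2 p_gt0 q_gt0 true h1 h0.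
have : xv true ^+ K' * (xv true ^+ K * xv true ^+ N) = 0.
  by rewrite -[RHS](mulr0 (xv true ^+ K')); exact: hK'.
by rewrite !xvM => /eqP; rewrite (negPf (xv_neq0 _ _ _)).
Qed.

Lemma summandP s x : is_summand (line k x) (D s) <-> x \in s.
Proof. by split; [exact: summand_mem | exact: mem_summand]. Qed.

Lemma qiso_line (x z : L) : qiso (line k x) (line k z) -> x = z.
Proof.
move=> h; have : x \in [:: z]; last by rewrite mem_seq1 => /eqP.
apply: summand_mem.
apply: (is_summand_iso p_gt0 q_gt0 (T := D [:: x]));
  last by apply: mem_summand; rewrite mem_head.
apply: (qiso_trans p_gt0 q_gt0 (Y := line k x)).
  by apply: qiso_sym; apply/gr_iso_qiso/gr_iso_dsum0.
by apply: (qiso_trans p_gt0 q_gt0 h); apply/gr_iso_qiso/gr_iso_dsum0.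
Qed.

(* Evaluation at the point (1, 1) turns the matrices of mutually inverse
   morphisms into mutually inverse matrices over [k]. *)
Lemma qiso_size s t : qiso (D s) (D t) -> (size s <= size t)%N.
Proof.
move=> [f [g [gf _]]].
have Hf (i : 'I_(size s)) : exists N, exists w,
    f (xv true ^+ N *: lbase k s i) w /\ g w (xv true ^+ N *: lbase k s i).
  move/(qeqE p_gt0 q_gt0): gf => /(_ (lbase k s i) true) [N [v [[w [fw gw]] /=
    ev]]].
  by subst v; exists N, w.
have [Nf hN] := fin_all_exists Hf; have [w hw] := fin_all_exists hN.
have Hg (j : 'I_(size t)) : exists K, exists c,
  g (xv true ^+ K *: lbase k t j) c.
  exact: qdom.
have lg : linsub (dom g) := grsub_linsub (grsub_dom (qrel_gr g)).
have [K hK] := xv_sum (r := enum 'I_(size t)) lg (fun i _ => Hg i).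
have [c hc] := fin_all_exists (fun j : 'I_(size t) => hK j (mem_enum _ j)).
pose ev (P : S) : k := meval (fun=> 1) P.
have evX n : ev (xv true ^+ n) = 1.
  by rewrite /ev xv_pow mevalX big1 // => i _; rewrite expr1n.
pose A := \matrix_(i < size s, j < size t) ev (lcoord j (w i)).
pose B := \matrix_(j < size t, l < size s) ev (lcoord l (c j)).
have AB : A *m B = 1%:M.
  apply/matrixP => i l; rewrite !mxE.
  have e : \sum_(j < size t) lcoord j (w i) *: c j = xv true ^+ K *: (xv true ^+
    Nf i *: lbase k s i).
    apply: (qhom_lines_fun p_gt0 q_gt0 (f := g) (u := xv true ^+ K *: w i));
      last first.
      by apply: (grrelS (qrel_gr g)); case: (hw i).
    rewrite {1}[w i]lbase_expand scaler_sumr; apply: (grrel_sum (qrel_gr g)) =>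
      j _.
    by rewrite scalerA mulrC -scalerA; apply: (grrelS (qrel_gr g)).
  have := congr1 (fun u => ev (lcoord l u)) e.
  rewrite lcoord_sum !lcoordZ lcoord_ba // /ev raddf_sum !mevalM -!/(ev _) !evX
    !mul1r.
  move=> e'; transitivity (ev ((l == i :> nat)%:R)); last first.
    by rewrite eq_sym /ev; case: (i == l :> nat) (val_eqE i l) => <-;
      rewrite ?meval1 ?meval0.
  rewrite -e'; apply: eq_bigr => j _; rewrite !mxE /ev -mevalM.
  by rewrite lcoordZ.
have := mxrankM_maxl A B; rewrite AB mxrank1 => h.
exact: leq_trans h (rank_leq_col _).
Qed.

End KrullSchmidt.

(** * Cech cohomology of test objects *)

Section CechVanishing.
Variables (k : fieldType) (p q : nat).
Local Notation L := (LL p q).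
Local Notation S := {mpoly k[2]}.
Local Notation dv := (dv p q).
Local Notation xv := (xv k).
Local Notation X12 := (xv false * xv true).
Local Notation mdegL := (mdegL p q).
Local Notation delta := (dv false + dv true).
Hypotheses (p_gt0 : (0 < p)%N) (q_gt0 : (0 < q)%N).

Lemma split_powers (f : S) n :
  (forall m : 'X_{1..2}, m \in msupp f -> (n <= m (iv false))%N \/ (n <= m (iv
    true))%N) ->
  exists g h, f = xv true ^+ n * g + xv false ^+ n * h.
Proof.
move=> hf; pose P (u : S) := exists g h, u = xv true ^+ n * g + xv false ^+ n *
  h.
suff : P f by [].
rewrite [f]mpolyE big_seq_cond; elim/big_ind: _.
- by exists 0, 0; rewrite !mulr0 addr0.
- by move=> _ _ [g [h ->]] [g' [h' ->]]; exists (g + g'), (h + h'); ring.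
move=> m /andP [/hf [hm|hm] _].
  have [|g ->] := @xv_dvd k (f@_m *: 'X_[m]) false n; last first.
    by exists 0, g; rewrite mulr0 add0r.
  move=> m' hm'; rewrite mcoeffZ mcoeffX; case: eqP => [e|_]; rewrite ?mulr0 //.
  by move: hm'; rewrite -e ltnNge hm.
have [|g ->] := @xv_dvd k (f@_m *: 'X_[m]) true n; last first.
  by exists g, 0; rewrite mulr0 addr0.
move=> m' hm'; rewrite mcoeffZ mcoeffX; case: eqP => [e|_]; rewrite ?mulr0 //.
by move: hm'; rewrite -e ltnNge hm.
Qed.

Definition mnm2 (a b : nat) : 'X_{1..2} := (U_(iv false) *+ a + U_(iv true) *+
  b)%MM.

Lemma mnm2E a b c : mnm2 a b (iv c) = if c then b else a.
Proof. by rewrite mnmDE !mulmUn; case: c; rewrite /= ?muln0 ?muln1 ?addn0. Qed.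

Lemma mdegL_mnm2 a b : mdegL (mnm2 a b) = dv false *+ a + dv true *+ b.
Proof. by rewrite mdegLD !mdegL_mul. Qed.

Lemma mdegL_split (m : 'X_{1..2}) : mdegL m = dv false *+ m (iv false) + dv true
  *+ m (iv true).
Proof. by []. Qed.

(** The Cech classes of a line bundle have the basis 1 / (x_1 ^ a x_2 ^ b) with a, b > 0; [delta]
    accounts for exponents starting at 1. *)
Lemma H1_lineP z y :
  H1_vanishes (line_mod k z) y <-> forall m, z + y + (mdegL m + delta) <> 0.
Proof.
split=> [h m e|h n f gf].
  pose a := (m (iv false)).+1; pose b := (m (iv true)).+1.
  have e' : mdegL m + delta = dv false *+ a + dv true *+ b.
    by rewrite mdegL_split addrACA /a /b !mulrSr.
  (* Over the denominator (x_1 x_2) ^ (a + b) the class 1 / (x_1 ^ a x_2 ^ b) has numerator x_1 ^ b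
     x_2 ^ a, whence [mnm2 b a]. *)
  pose n := (a + b)%N.
  have [N [w [nN /= ew]]] : exists N (w : bool -> S), (n <= N)%N /\
      X12 ^+ (N - n) * 'X_[mnm2 b a] = xv true ^+ N * w false + xv false ^+ N *
        w true.
    have [|N [w [nN ew]]] := h n ('X_[mnm2 b a] : S^o); last by exists N, w.
    have -> : dv false *+ n + (dv true *+ n + y) = dv false *+ b + dv true *+ a
      - z.
      have -> : y = - (z + (mdegL m + delta)).
        by apply/eqP; rewrite -addr_eq0 addrCA addrA e.
      by rewrite e' /n; case: (el_surj z) => z1 [z2 ->]; el_solve.
    rewrite /= /gr_line addrC subrK -mdegL_mnm2; exact: homdeg_X.
  have : 'X_[mnm2 (N - n + b) (N - n + a)] =
      xv false ^+ N * w true + xv true ^+ N * w false.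
    rewrite addrC -ew xv12_pow !xv_pow -!mpolyXD; congr 'X_[_].
    by apply: (@mnm2P _ _ false); rewrite /mnm2 !mnmDE !mulmUn /=; lia.
  by apply: xv_pow_nmem; rewrite mnm2E /= /n /a /b; lia.
exists n; have [|g [g' e]] := @split_powers (f : S) n; last first.
  exists (fun b => if b then g' else g); split=> //.
  by rewrite subnn expr0 scale1r; apply: e.
move=> m hm; have em : mdegL m = z + (dv false *+ n + (dv true *+ n + y)) := gf
  m hm.
have [h1|h1] := leqP n (m (iv false)); first by left.
have [h2|h2] := leqP n (m (iv true)); first by right.
(* A monomial of f with both exponents below n would give a class in a degree that [h] excludes. *)
case: (h (mnm2 (n - (m (iv false)).+1) (n - (m (iv true)).+1))).
rewrite mdegL_mnm2.
transitivity (z + (dv false *+ n + (dv true *+ n + y)) - mdegL m);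
  last by rewrite em subrr.
rewrite mdegL_split; case: (el_surj z) => z1 [z2 ->];
  case: (el_surj y) => y1 [y2 ->].
el_solve.
Qed.

(** Since x_b is invertible on the overlap, every class is x_b times a class in degree y: with x'
    the other variable, m / (x_1 x_2) ^ n is x_b times x' m / (x_1 x_2) ^ (n + 1). *)
Lemma H1_shift (M : grmod k p q) y b : H1_vanishes M y ->
  H1_vanishes M (dv b + y).
Proof.
move=> h n m gm.
have [|N [w [nN e]]] := h n.+1 (xv (~~ b) ^+ 1 *: m).
  have -> : dv false *+ n.+1 + (dv true *+ n.+1 + y) =
      dv (~~ b) *+ 1 + (dv false *+ n + (dv true *+ n + (dv b + y))).
    by case: (el_surj y) => y1 [y2 ->]; case: (b); el_solve.
  exact: gr_xv.
exists N, (fun c => xv b *: w c); split; first exact: ltnW.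
have := congr1 (fun u => xv b *: u) e.
rewrite scalerDr !scalerA ![xv b * _]mulrC -!scalerA => <-.
rewrite !scalerA; congr (_ *: _).
have -> : (N - n = (N - n.+1).+1)%N by lia.
by rewrite exprS expr1; case: b {gm e} => /=; ring.
Qed.

(* A section s with charts w is a multiple of x_1 on the first chart and of x_2
   on the second one; the vanishing of H^1 turns this into s = x_1 c + x_2 a
   with global sections c and a. *)
Lemma H0_shift (M : grmod k p q) y : H0_vanishes M (dv false + y) ->
  H0_vanishes M (dv true + y) ->
  H1_vanishes M y -> H0_vanishes M (delta + y).
Proof.
move=> h0 h1 hv N w gw cw.
have [|N' [v [nN gv ev]]] := H1_hom (n := N.+1) (m := xv true ^+ N *: w false)
  hv.
  have -> : dv false *+ N.+1 + (dv true *+ N.+1 + y) =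
      dv true *+ N + (dv false *+ N + (delta + y)).
    by case: (el_surj y) => y1 [y2 ->]; el_solve.
  exact: gr_xv.
pose r := (N' - N.+1)%N.
have eN : N' = (r + N + 1)%N by rewrite /r; lia.
(* The scaling is such that x_1 a + x_2 c equals x_b ^ (r + 1) w b on the chart of x_b, so that
   killing a and c kills w. *)
pose a (b : bool) := if b then xv true *: v true else xv false ^+ r *: w false -
  xv true *: v false.
pose c (b : bool) := if b then xv true ^+ r *: w true - xv false *: v true else
  xv false *: v false.
have sh b b' u : gr (dv b *+ N' + y) u -> gr (dv b *+ N' + (dv b' + y)) (xv b'
  *: u).
  move=> gu; have -> : dv b *+ N' + (dv b' + y) = dv b' *+ 1 + (dv b *+ N' + y).
    by rewrite mulr1n addrCA.
  by rewrite -[xv b']expr1; apply: gr_xv.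
have sh' b : gr (dv b *+ N' + (dv (~~ b) + y)) (xv b ^+ r *: w b).
  have -> : dv b *+ N' + (dv (~~ b) + y) = dv b *+ r + (dv b *+ N + (delta +
    y)).
    by rewrite eN; case: (el_surj y) => y1 [y2 ->]; case: (b); el_solve.
  exact: gr_xv.
have ga b : gr (dv b *+ N' + (dv true + y)) (a b).
  by case: b; [apply: sh | apply: grB; [exact: (sh' false) | exact: sh]].
have gc b : gr (dv b *+ N' + (dv false + y)) (c b).
  by case: b; [apply: grB; [exact: (sh' true) | exact: sh] | apply: sh].
have ca : xv true ^+ N' *: a false = xv false ^+ N' *: a true.
  rewrite /= scalerBr !scalerA.
  have -> : (xv true ^+ N' * xv true) *: v false =
      xv true *: (X12 ^+ r *: (xv true ^+ N *: w false)) - xv true *: (xv false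
        ^+ N' *: v true).
    by rewrite ev scalerDr addrK scalerA mulrC.
  rewrite !scalerA xv12_pow opprB addrCA -scalerBl eN !exprD expr1.
  by rewrite [X in _ + X *: _](_ : _ = 0) ?scale0r ?addr0; [congr (_ *: _) |];
    ring.
have cc : xv true ^+ N' *: c false = xv false ^+ N' *: c true.
  rewrite /= scalerBr !scalerA.
  have -> : (xv true ^+ N' * xv false) *: v false =
      xv false *: (X12 ^+ r *: (xv true ^+ N *: w false)) - xv false *: (xv
        false ^+ N' *: v true).
    by rewrite ev scalerDr addrK scalerA mulrC.
  rewrite cw !scalerA xv12_pow eN !exprD expr1.
  by congr (_ *: _ - _ *: _); ring.
have va := h1 N' a ga ca; have vc := h0 N' c gc cc.
clearbody r; case.
  have [[K hK] [K' hK']] := (vc true, va true).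
  exists (K' + 1 + K + r)%N; move: hK; rewrite /= scalerBr scalerA xvM => /eqP.
  rewrite subr_eq0 => /eqP hK.
  rewrite -addnA -xvM -scalerA hK exprD expr1 !scalerA.
  move: hK'; rewrite /= scalerA => hK'.
  transitivity ((xv true ^+ K * xv false) *: ((xv true ^+ K' * xv true) *: v
    true)).
    by rewrite scalerA; congr (_ *: _); ring.
  by rewrite hK' scaler0.
have [[K hK] [K' hK']] := (va false, vc false).
exists (K' + 1 + K + r)%N; move: hK; rewrite /= scalerBr scalerA xvM => /eqP.
rewrite subr_eq0 => /eqP hK.
rewrite -addnA -xvM -scalerA hK exprD expr1 !scalerA.
move: hK'; rewrite /= scalerA => hK'.
transitivity ((xv false ^+ K * xv true) *: ((xv false ^+ K' * xv false) *: v
  false)).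
  by rewrite scalerA; congr (_ *: _); ring.
by rewrite hK' scaler0.
Qed.

(** A homogeneous element of degree y, multiplied by x_b ^ a, is a global section (exponent 0, the
    same numerator on both charts) in a degree where H^0 vanishes. *)
Lemma H0_zero (M : coh k p q) :
  (forall y b, exists a, H0_vanishes M (dv b *+ a + y)) -> is_zero M.
Proof.
move=> h; apply/(qeqE p_gt0 q_gt0) => u b.
have [s [hs ->]] := gr_expand u.
have [|N hN] := @xv_sum k M (fun u => u = 0) b _ s (fun z =>
  z.2) (@linsub_zero k M).
  move=> z /hs gz; have [a ha] := h z.1 b.
  have [||K hK] := ha 0%N (fun=> xv b ^+ a *: z.2) _ _ b.
  - by move=> c; rewrite mulr0n add0r; apply: gr_xv.
  - by rewrite !expr0.
  by exists (K + a)%N; rewrite -xvM -scalerA.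
exists N, 0; split=> //=; rewrite scaler_sumr big_seq_cond big1 // =>
  z /andP [/hN //].
Qed.

Lemma line_nonzero (z : L) : ~ is_zero (line k z).
Proof.
move=> /(qeqE p_gt0 q_gt0) /(_ (1 : S^o) true) [N [v [/= e v0]]].
move: e; rewrite v0 /GRing.scale /= mulr1 => /eqP.
by rewrite (negPf (xv_neq0 _ _ _)).
Qed.

Section Torsion.
Variables (z : L) (b : bool).

Lemma xv_gr_line : @gr k p q (line k z) (dv b - z) (xv b : S^o).
Proof.
by have := @gr_line_xv k p q z b 1; rewrite expr1 mulr1n.
Qed.

(** S(z) / (x_b), a sheaf concentrated at the point x_b = 0. It has no H^1, and H^0 at most in the
    degrees that differ from - z by a multiple of the other generator; this is how it singles out a
    row or a column. *)
Definition torsion : coh k p q := @quot k p q (line k z) (GSub (grsub_cyclic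
  xv_gr_line)).

Let T0 (f : S) : qpi (GSub (grsub_cyclic xv_gr_line)) (xv b * f : S^o) = 0.
Proof.
rewrite -(qpi0 (GSub (grsub_cyclic xv_gr_line))); apply/qpi_eq; exists f.
by rewrite subr0 mulrC.
Qed.

Lemma torsion_kill (u : torsion) : xv b *: u = 0.
Proof. by rewrite -[u]qreprK -qpiZ; apply: T0. Qed.

Lemma H1_torsion y : H1_vanishes torsion y.
Proof.
move=> n m gm; exists n.+1, (fun=> 0); split=> //.
rewrite !scaler0 addr0 subSnn expr1.
have -> : X12 = xv (~~ b) * xv b by case: (b); rewrite //= mulrC.
by rewrite -scalerA torsion_kill scaler0.
Qed.

(** On the chart of x_b all sections are zero. On the other one, an element not divisible by x_b
    contains a pure power of the other variable, which pins down its degree. *)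
Lemma H0_torsion y : (forall j : int, z + y <> dv (~~ b) *~ j) ->
  H0_vanishes torsion y.
Proof.
move=> h N w gw _ c; have [->|cb] := eqVneq c b.
  by exists 1%N; rewrite expr1; apply: torsion_kill.
have {cb}-> : c = ~~ b by case: c b cb => -[].
exists 0%N; rewrite scale1r; have [u gu ->] := gw (~~ b).
have [|g eg] := @xv_dvd k (u : S) b 1; last by rewrite eg expr1; apply: T0.
move=> m; rewrite ltnS leqn0 => /eqP m0; apply: memN_msupp_eq0;
  apply/negP => mu.
have e : mdegL m = z + (dv (~~ b) *+ N + y) := gu m mu.
case: (h ((m (iv (~~ b)))%:Z - N%:Z)).
rewrite mulrzBr -!pmulrn.
apply/eqP; rewrite -(inj_eq (addrI (dv (~~ b) *+ N))) addrCA -e mdegL_split.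
by move: m0; case: (b) => /= ->; rewrite mulr0n ?addr0 ?add0r addrC subrK.
Qed.

Lemma torsion_nonzero : ~ is_zero torsion.
Proof.
move=> /(qeqE p_gt0 q_gt0) /(_ (qpi (GSub (grsub_cyclic xv_gr_line)) (1 : S^o) :
  torsion) (~~ b)) [N [v [/= e v0]]].
move: e; rewrite v0 -qpiZ -(qpi0 (GSub (grsub_cyclic xv_gr_line))) =>
  /qpi_eq [a].
rewrite subr0 /GRing.scale /= mulr1 => e.
apply: (@xv_pow_nmem k b 1 N.+1 a 0 (U_(iv (~~ b)) *+ N)%MM).
- by rewrite mulmUn; case: (b); rewrite muln0.
- by rewrite mulmUn eqxx muln1.
by rewrite -xv_pow e mulr0 addr0 expr1 mulrC.
Qed.

End Torsion.

End CechVanishing.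

(** * Tilting bundles in coordinates *)

Section TiltingCoordinates.
Variables (k : fieldType) (p q : nat).
Local Notation L := (LL p q).
Local Notation S := {mpoly k[2]}.
Local Notation dv := (dv p q).
Local Notation mdegL := (mdegL p q).
Local Notation delta := (dv false + dv true).
Local Notation D := (dsum_lines k).
Implicit Types s : seq L.

(* The degree of the line bundle of the arc D^{i/p}_{j/q}. *)
Definition arc (i j : int) : L := el p q i (- j).

Lemma arcE i j : vx1 p q *~ i - vx2 p q *~ j = arc i j.
Proof. by rewrite /arc /el mulrNz. Qed.

Lemma arc_surj z : exists i j, z = arc i j.
Proof. by have [a [b ->]] := el_surj z; exists a, (- b);
  rewrite /arc opprK. Qed.

Lemma arc_diff i j i' j' : i' < i -> j < j' ->
  exists m, arc i j - arc i' j' = mdegL m + delta.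
Proof.
move=> hi hj; exists (mnm2 (absz (i - i' - 1)%R) (absz (j' - j - 1)%R)).
by rewrite mdegL_mnm2 /arc; el_solve.
Qed.

Lemma arc_eq_sub i j x (m : 'X_{1..2}) (d : nat) :
  x = arc i j + (mdegL m + delta *+ d) ->
  x = arc (i + (m (iv false))%:Z + d%:Z) (j - (m (iv true))%:Z - d%:Z).
Proof. by move=> ->; rewrite mdegL_split /arc; el_solve. Qed.

Hypotheses (p_gt0 : (0 < p)%N) (q_gt0 : (0 < q)%N).

Lemma arc_eqP i j i' j' : arc i j = arc i' j' <->
  exists t : int, i = i' + t * p%:Z /\ j = j' + t * q%:Z.
Proof.
by apply: (iff_trans (el_eq _ p_gt0 _ _ _ _)); split=> -[t [h1 h2]]; exists t;
  lia.
Qed.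

Lemma ext1_lines_H1 s x (M : coh k p q) : x \in s -> ext1_vanishes (D s) M ->
  H1_vanishes M (- x).
Proof.
move=> xs h; apply: (ext1_H1 p_gt0 q_gt0 (W := D (rem x s))).
apply: (ext1_vanishes_iso p_gt0 q_gt0 _ (qiso_refl p_gt0 q_gt0 M) h).
exact/(gr_iso_qiso p_gt0 q_gt0)/gr_iso_rem.
Qed.

Section Tilting.
Variable s : seq L.
Hypothesis ts : tilting (D s).

Lemma tilting_noncrossing i j i' j' : arc i j \in s -> arc i' j' \in s ->
  i' < i -> j' <= j.
Proof.
move=> hx hz hi; rewrite leNgt; apply/negP => /(arc_diff hi) [m hm].
have := ext1_lines_H1 hx (proj1 ts) => /H1_lines /(_ _ hz) /H1_lineP /(_ m).
by apply=> //; rewrite -hm addrA subrK subrr.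
Qed.

Lemma tilting_torsion b z : exists2 x, x \in s & exists j : int,
  z - x = dv (~~ b) *~ j.
Proof.
apply: NNPP => H; apply: (@torsion_nonzero k p q p_gt0 q_gt0 z b).
apply: (proj2 ts).
  apply: hom_vanishes_lines => // x xs; apply: H0_hom => //;
    apply: H0_torsion => j hj.
  by apply: H; exists x => //; exists j.
by apply: ext1_lines => // x xs; apply: H1_torsion.
Qed.

Lemma tilting_column i : exists j, arc i j \in s.
Proof.
have [x xs [j hj]] := tilting_torsion false (arc i 0); exists j.
suff -> : arc i j = x by [].
rewrite -[x](subKr (arc i 0)) hj /arc; el_solve.
Qed.

Lemma tilting_row j : exists i, arc i j \in s.
Proof.
have [x xs [i hi]] := tilting_torsion true (arc 0 j); exists (- i).
suff -> : arc (- i) j = x by [].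
rewrite -[x](subKr (arc 0 j)) hi /arc; el_solve.
Qed.

(** The sheaf O(i x_1 - j x_2) is nonzero, so T has Hom or Ext^1 into it: the first alternative is
    the degree condition for a nonzero Hom from a summand, the second for a nonzero Ext^1. *)
Lemma tilting_test i j : exists i' j', arc i' j' \in s /\
  (i' <= i /\ j <= j' \/ i < i' /\ j' < j).
Proof.
apply: NNPP => H; apply: (@line_nonzero k p q p_gt0 q_gt0 (arc i j)).
apply: (proj2 ts).
  apply: hom_vanishes_lines => // x xs; apply: hom_vanishes_line_line =>
    // m hm.
  apply: H; exists (i - (m (iv false))%:Z), (j + (m (iv true))%:Z); split;
    last by left; lia.
  suff -> : arc (i - (m (iv false))%:Z) (j + (m (iv true))%:Z) = x by [].
  by rewrite -[x](subKr (arc i j)) -hm mdegL_split /arc; el_solve.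
apply: ext1_lines => // x xs; apply/H1_lineP => // m hm.
apply: H; exists (i + (m (iv false))%:Z + 1%:Z), (j - (m (iv true))%:Z - 1%:Z).
split; last by right; lia.
rewrite -(@arc_eq_sub i j x m 1) //.
apply/eqP; rewrite mulr1n -subr_eq0 -oppr_eq0 opprB; apply/eqP.
by rewrite -hm addrAC.
Qed.

End Tilting.

Lemma tiltingI s :
  (forall i j i' j', arc i j \in s -> arc i' j' \in s -> i' < i -> j' <= j) ->
  (forall M : coh k p q, (forall x, x \in s -> H0_vanishes M (- x) /\
    H1_vanishes M (- x)) -> is_zero M) ->
  tilting (D s).
Proof.
move=> nc gen; split.
  apply: ext1_lines => // x xs; apply/H1_lines => // z zs;
    apply/H1_lineP => // m hm.
  have [i [j ez]] := arc_surj z.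
  have ex : x = arc i j + (mdegL m + delta *+ 1).
    by apply/eqP; rewrite mulr1n -ez -subr_eq0 -oppr_eq0 opprB -hm addrAC.
  have := nc _ _ i j _ _; rewrite -ez; move: xs; rewrite (arc_eq_sub ex) => xs.
  by move=> /(_ _ _ xs zs); lia.
move=> X h1 h2; apply: gen => x xs; split.
  by apply: (hom_H0 p_gt0 q_gt0); apply: hom_vanishes_line xs h1.
exact: ext1_lines_H1 h2.
Qed.

Lemma has_arcP (T : coh k p q) s i j : qiso T (D s) ->
  has_arc T i j <-> arc i j \in s.
Proof.
move=> e; rewrite /has_arc arcE; split=> [h|h].
  by apply/summandP => //; exact: (is_summand_iso p_gt0 q_gt0 e h).
apply: (is_summand_iso p_gt0 q_gt0 (qiso_sym e)); exact/summandP.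
Qed.

End TiltingCoordinates.

(** * Staircases *)

Section Staircases.
Variables p q : nat.
Hypotheses (p_gt0 : (0 < p)%N) (q_gt0 : (0 < q)%N).
Implicit Types c d : p.-tuple int.

Lemma int_max (P : int -> bool) (j0 B : int) : P j0 -> (forall j,
  P j -> j <= B) ->
  exists2 m, P m & forall j, P j -> j <= m.
Proof.
move=> h0 hB; have [n hn] : exists n : nat, B - j0 <= n%:Z by exists (absz (B -
  j0)%R); lia.
elim: n j0 h0 hn => [|n IH] j0 h0 hn.
  by exists j0 => // j /hB; lia.
have [[j1 hj1 lt]|h] := classic (exists2 j1, P j1 & j0 < j1).
  by apply: (IH j1 hj1); lia.
exists j0 => // j hj; rewrite leNgt; apply/negP => lt.
by apply: h; exists j.
Qed.

Lemma int_min (P : int -> bool) (j0 B : int) : P j0 -> (forall j,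
  P j -> B <= j) ->
  exists2 m, P m & forall j, P j -> m <= j.
Proof.
move=> h0 hB; have [||m hm h] := @int_max (fun j => P (- j)) (- j0) (- B).
- by rewrite opprK.
- by move=> j /hB; lia.
by exists (- m) => // j hj; have := h (- j); rewrite opprK => /(_ hj); lia.
Qed.

(* The i-th entry, counted from 0, of the extension of c to the integers by
   c_(i + p) = c_i + q. *)
Definition cx c (i : int) : int := c`_(absz (i %% p%:Z)%Z) + (i %/ p%:Z)%Z *
  q%:Z.

(* The horizontal step of the staircase from i to i + 1 is at height c_i. *)
Definition stair c (i j : int) : bool := cx c (i - 1) <= j <= cx c i.

Lemma cx_shift c i t : cx c (i + t * p%:Z) = cx c i + t * q%:Z.
Proof.
have p0 : p%:Z != 0 by lia.
by rewrite /cx [i + _]addrC modzMDl divzMDl // mulrDl [t * _ + _]addrC addrA.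
Qed.

Lemma stair_shift c i j t : stair c (i + t * p%:Z) (j + t * q%:Z) = stair c i j.
Proof.
rewrite /stair; have -> : i + t * p%:Z - 1 = i - 1 + t * p%:Z by lia.
by rewrite !cx_shift !lerD2r.
Qed.

Lemma cx_ord c (i : 'I_p) : cx c i%:Z = tnth c i.
Proof.
have lt := ltn_ord i; rewrite /cx modz_nat divz_nat divn_small // mul0r addr0.
by rewrite modn_small // (tnth_nth 0).
Qed.

Lemma int_residue (i : int) : exists (r : 'I_p) (t : int), i = r%:Z + t * p%:Z.
Proof.
have p0 : p%:Z != 0 by lia.
have h1 := modz_ge0 i p0; have h2 := ltz_pmod i (d := p%:Z).
have lt : (absz (i %% p%:Z)%Z < p)%N by lia.
exists (Ordinal lt), (i %/ p%:Z)%Z; rewrite /= gez0_abs //.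
by rewrite {1}(divz_eq i p%:Z) addrC.
Qed.

Lemma cx_inj c d : cx c =1 cx d -> c = d.
Proof. by move=> h; apply: eq_from_tnth => i; rewrite -!cx_ord h. Qed.

Lemma cx_step c i : Lambda_vertex q c -> cx c i <= cx c (i + 1).
Proof.
move=> /andP [sc lc]; have [r [t ->]] := int_residue i.
have -> : r%:Z + t * p%:Z + 1 = (r%:Z + 1) + t * p%:Z by lia.
rewrite !cx_shift lerD2r cx_ord (tnth_nth 0).
have [lt|ge] := ltnP r.+1 p.
  have -> : r%:Z + 1 = (Ordinal lt)%:Z by rewrite /=; lia.
  rewrite cx_ord (tnth_nth 0) /=.
  by apply: (sortedP 0 sc); rewrite size_tuple.
(* The last step of the period: here the condition c_p <= c_1 + q enters. *)
have e : r.+1 = p by apply/eqP; rewrite eqn_leq ge ltn_ord.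
have -> : r%:Z + 1 = 0 + 1 * p%:Z by lia.
rewrite cx_shift (cx_ord c (Ordinal p_gt0)) (tnth_nth 0) mul1r nth0 /=.
move: lc; rewrite -nth_last (set_nth_default 0) ?size_tuple; last by lia.
by have -> : p.-1 = r by lia.
Qed.

Lemma cx_mono c i i' : Lambda_vertex q c -> i <= i' -> cx c i <= cx c i'.
Proof.
move=> hc le; have -> : i' = i + (absz (i' - i)%R)%:Z by lia.
elim: (absz _) => [|n IH]; first by rewrite addr0.
apply: (le_trans IH); have -> : i + n.+1%:Z = i + n%:Z + 1 by lia.
exact: cx_step.
Qed.

Lemma stair_step c i j : Lambda_vertex q c -> stair c i j ->
  stair c (i + 1) j -> j = cx c i.
Proof. by move=> hc; rewrite /stair addrK => /andP [h1 h2] /andP [h3 h4];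
  lia. Qed.

Lemma stair_cx c i : Lambda_vertex q c -> stair c i (cx c i) && stair c (i + 1)
  (cx c i).
Proof.
move=> hc; rewrite /stair addrK; have := cx_step (i - 1) hc;
  have := cx_step i hc.
by rewrite subrK; lia.
Qed.

Lemma stair_inj c d : Lambda_vertex q c -> Lambda_vertex q d ->
  (forall i j, stair c i j = stair d i j) -> c = d.
Proof.
move=> hc hd h; apply: cx_inj => i.
by have /andP [h1 h2] := stair_cx i hc; apply: stair_step; rewrite -?h.
Qed.

Lemma stair_nc c i j i' j' : Lambda_vertex q c -> stair c i j ->
  stair c i' j' ->
  i' < i -> j' <= j.
Proof.
move=> hc /andP [h1 _] /andP [_ h2] lt.
have le : i' <= i - 1 by lia.
exact: le_trans h2 (le_trans (cx_mono hc le) h1).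
Qed.

Section Reconstruction.
Variable A : int -> int -> bool.
Hypothesis Ap : forall i j t : int, A (i + t * p%:Z) (j + t * q%:Z) = A i j.
Hypothesis Anc : forall i j i' j', A i j -> A i' j' -> i' < i -> j' <= j.
Hypothesis Acol : forall i, exists j, A i j.
Hypothesis Arow : forall j, exists i, A i j.
Hypothesis Atest : forall i j : int, exists i' j' : int, A i' j' /\
  (i' <= i /\ j <= j' \/ i < i' /\ j' < j).

(** The top m of column i and the bottom n of column i + 1 satisfy m <= n because arcs do not cross.
    A gap m < n is excluded by [Atest] at (i, m + 1): either kind of witness would cross or lie in
    the gap. *)
Lemma stair_exists i : exists j : int, A i j && A (i + 1) j.
Proof.
have [j0 h0] := Acol i; have [j1 h1] := Acol (i + 1).
have [|m hm mx] := int_max (P := A i) (B := j1) h0.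
  by move=> j hj; apply: Anc h1 hj _; lia.
have [|n hn mn] := int_min (P := A (i + 1)) (B := m) h1.
  by move=> j hj; apply: Anc hj hm _; lia.
have le : m <= n by apply: Anc hn hm _; lia.
have [e|ne] := eqVneq m n; first by exists m; rewrite hm e hn.
have [i' [j' [h [[h2 h3]|[h2 h3]]]]] := Atest i (m + 1).
  have [e|ne'] := eqVneq i' i; first by rewrite e in h; have := mx _ h; lia.
  by have := Anc hm h; lia.
have [e|ne'] := eqVneq i' (i + 1); first by rewrite e in h; have := mn _ h; lia.
by have := Anc h hn; lia.
Qed.

Definition stair_fun (i : int) : int := xchoose (stair_exists i).

Lemma stair_funP i : A i (stair_fun i) /\ A (i + 1) (stair_fun i).
Proof. by apply/andP; exact: (xchooseP (stair_exists i)). Qed.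

Lemma stair_fun_uniq i j : A i j -> A (i + 1) j -> j = stair_fun i.
Proof.
move=> h1 h2; have [h3 h4] := stair_funP i.
by have := Anc h2 h3; have := Anc h4 h1; lia.
Qed.

Lemma stair_fun_step i : stair_fun i <= stair_fun (i + 1).
Proof.
have [_ h1] := stair_funP i; have [_ h2] := stair_funP (i + 1).
by apply: Anc h2 h1 _; lia.
Qed.

Lemma stair_fun_shift i t : stair_fun (i + t * p%:Z) = stair_fun i + t * q%:Z.
Proof.
have [h1 h2] := stair_funP i; apply/esym/stair_fun_uniq; first by rewrite Ap.
have -> : i + t * p%:Z + 1 = i + 1 + t * p%:Z by lia.
by rewrite Ap.
Qed.

(** [Arow] provides some point at height j; noncrossing with the two ends of column i forces it into
    that column unless j is itself the height of an end. *)
Lemma stair_funE i j : A i j = (stair_fun (i - 1) <= j <= stair_fun i).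
Proof.
have [h1 h2] := stair_funP (i - 1); have [h3 h4] := stair_funP i.
rewrite subrK in h2; apply/idP/andP => [h|[le1 le2]].
  by split; [apply: Anc h h1 _ | apply: Anc h4 h _]; lia.
have [i' h] := Arow j; have [e|ne] := eqVneq i' i; first by rewrite -e.
have [lt|ge] := ltP i' i.
  have [e|ne'] := eqVneq j (stair_fun (i - 1)); first by rewrite e.
  by have := Anc h2 h; lia.
have [e|ne'] := eqVneq j (stair_fun i); first by rewrite e.
by have := Anc h h3; lia.
Qed.

Lemma stair_reconstruct : exists c, Lambda_vertex q c /\ forall i j,
  A i j = stair c i j.
Proof.
pose c := [tuple stair_fun (i : 'I_p)%:Z | i < p].
have cE i : cx c i = stair_fun i.
  have [r [t ->]] := int_residue i; rewrite cx_shift stair_fun_shift cx_ord.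
  by rewrite tnth_mktuple.
exists c; split; last by move=> i j; rewrite stair_funE /stair !cE.
apply/andP; split.
  apply/(sortedP 0) => i; rewrite size_tuple => lt.
  have lt' : (i < p)%N by lia.
  rewrite -(tnth_nth 0 c (Ordinal lt)) -(tnth_nth 0 c (Ordinal lt'))
    !tnth_mktuple /=.
  by have -> : i.+1%:Z = i%:Z + 1 by [lia]; apply: stair_fun_step.
rewrite -nth_last -nth0 size_tuple.
have lt : (p.-1 < p)%N by lia.
rewrite -(tnth_nth 0 c (Ordinal lt)) -(tnth_nth 0 c (Ordinal p_gt0))
  !tnth_mktuple /=.
apply: (le_trans (stair_fun_step _)).
have -> : p.-1%:Z + 1 = 0 + 1 * p%:Z by lia.
by rewrite stair_fun_shift mul1r.
Qed.

End Reconstruction.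

End Staircases.

(** * Propagation of vanishing above a staircase *)

Section StaircaseGeneration.
Variables (k : fieldType) (p q : nat).
Hypotheses (p_gt0 : (0 < p)%N) (q_gt0 : (0 < q)%N).
Local Notation dv := (dv p q).
Local Notation arc := (arc p q).
Variable c : p.-tuple int.
Hypothesis hc : Lambda_vertex q c.
Variable M : coh k p q.

Let V i j := H0_vanishes M (- arc i j) /\ H1_vanishes M (- arc i j).

Hypothesis hV : forall i j, stair q c i j -> V i j.

(** The Koszul sequence starts at O(arc i j), has O(arc (i + 1) j) and O(arc i (j - 1)) in the
    middle and ends at O(arc (i + 1) (j - 1)); so vanishing at three corners of a unit square passes
    to the fourth. *)
Lemma koszul_flip i j : V i (j - 1) -> V (i + 1) (j - 1) -> V (i + 1) j ->
  V i j.
Proof.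
have e1 : - arc i j = dv false + dv true + - arc (i + 1) (j - 1) by rewrite
  /arc; el_solve.
have e2 : - arc i (j - 1) = dv false + - arc (i + 1) (j - 1) by rewrite /arc;
  el_solve.
have e3 : - arc (i + 1) j = dv true + - arc (i + 1) (j - 1) by rewrite /arc;
  el_solve.
rewrite /V e1 e2 e3 => -[h1 _] [_ h2] [h3 _]; split; first exact: H0_shift.
by rewrite -addrA; do 2!apply: H1_shift => //.
Qed.

(** Outer induction on the number n of columns to the right within which the staircase reaches
    height j, inner induction on the distance above the top of column i: of the other three corners
    of the square, one is lower in the same column and two are one column further right. *)
Lemma above_stair n i j : cx q c (i - 1) <= j -> j <= cx q c (i + n%:Z) ->
  V i j.
Proof.
elim: n i j => [|n IH] i j h1 h2.
  by apply: hV; rewrite addr0 in h2; rewrite /stair h1.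
have [le|lt] := lerP j (cx q c i); first by apply: hV; rewrite /stair h1.
have -> : j = cx q c i + (absz (j - cx q c i)%R)%:Z by lia.
have : cx q c i + (absz (j - cx q c i)%R)%:Z <= cx q c (i + n.+1%:Z) by lia.
elim: (absz _) => [|e IHe] le.
  by rewrite addr0; apply: hV; case/andP: (stair_cx p_gt0 q_gt0 i hc).
have e1 : i + n.+1%:Z = i + 1 + n%:Z by lia.
apply: koszul_flip.
- by have -> : cx q c i + e.+1%:Z - 1 = cx q c i + e%:Z by [lia]; apply: IHe;
  lia.
- by apply: IH; rewrite ?addrK -?e1; lia.
- by apply: IH; rewrite ?addrK -?e1; lia.
Qed.

Lemma stair_generates : is_zero M.
Proof.
have qabs (a b : int) : b <= a + (absz (b - a)%R)%:Z * q%:Z.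
  have : b - a <= (absz (b - a)%R)%:Z by lia.
  by move: (absz _) => n; nia.
have H i j : cx q c (i - 1) <= j -> V i j.
  (* Moving p columns to the right raises the staircase by q >= 1, so this many columns suffice to
     reach height j. *)
  move=> h; apply: (@above_stair (p * absz (j - cx q c i)%R)) => //.
  have -> : i + (p * absz (j - cx q c i)%R)%N%:Z = i + (absz (j - cx q c
    i)%R)%:Z * p%:Z by lia.
  by rewrite cx_shift //; apply: qabs.
apply: H0_zero => // y b; have [i [j ey]] := arc_surj (- y).
(* A shift by x_2 moves the point up. A shift by x_1 moves it left, here by whole periods, so that
   the staircase drops by a multiple of q. *)
rewrite -[y]opprK ey; case: b.
  exists (absz (j - cx q c (i - 1))%R).
  have -> : dv true *+ absz (j - cx q c (i - 1))%R - arc i j =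
    - arc i (j + (absz (j - cx q c (i - 1))%R)%:Z) by rewrite /arc; el_solve.
  apply: (proj1 (H i _ _)); by move: (cx q c (i - 1)) => z; lia.
pose m := absz (j - cx q c (i - 1))%R; exists (m * p)%N.
have -> : dv false *+ (m * p) - arc i j = - arc (i + (- m%:Z) * p%:Z) j.
  by rewrite /arc; el_solve.
apply: (proj1 (H (i + - m%:Z * p%:Z) j _)).
have -> : i + - m%:Z * p%:Z - 1 = i - 1 + - m%:Z * p%:Z by lia.
rewrite cx_shift // /m; have : cx q c (i - 1) - j <= (absz (j - cx q c (i -
  1))%R)%:Z by lia.
by move: (absz _) => n; nia.
Qed.

End StaircaseGeneration.

(** * The tilting bundle of a staircase *)

Section StaircaseBundle.
Variables (k : fieldType) (p q : nat).
Hypotheses (p_gt0 : (0 < p)%N) (q_gt0 : (0 < q)%N).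
Local Notation L := (LL p q).
Local Notation arc := (arc p q).
Local Notation D := (dsum_lines k).
Variable c : p.-tuple int.
Hypothesis hc : Lambda_vertex q c.

Definition stair_arcs : seq L := undup
  [seq arc r%:Z (cx q c (r%:Z - 1) + d%:Z) | r <- iota 0 p,
     d <- iota 0 (absz (cx q c r%:Z - cx q c (r%:Z - 1))%R).+1].

Lemma stair_arcsP i j : (arc i j \in stair_arcs) = stair q c i j.
Proof.
rewrite mem_undup; apply/allpairsPdep/idP => [[r [d [hr hd /(arc_eqP p_gt0
  q_gt0) [t [-> ->]]]]]|h].
  rewrite stair_shift // /stair.
  move: hr hd; rewrite !mem_iota => hr hd.
  have := cx_step p_gt0 q_gt0 (r%:Z - 1) hc; rewrite subrK => le.
  by apply/andP; lia.
have [r [t e]] := int_residue p_gt0 q_gt0 i.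
have h' : stair q c r%:Z (j - t * q%:Z).
  by rewrite -(stair_shift p_gt0 q_gt0 _ _ _ t) subrK -e.
exists (nat_of_ord r), (absz (j - t * q%:Z - cx q c (r%:Z - 1))%R); split.
- by rewrite mem_iota add0n ltn_ord.
- by rewrite mem_iota; case/andP: h'; lia.
apply/(arc_eqP p_gt0 q_gt0); exists t; split; first exact: e.
by case/andP: h'; lia.
Qed.

Lemma stair_tilting : tilting (D stair_arcs).
Proof.
apply: tiltingI => //.
  by move=> i j i' j'; rewrite !stair_arcsP; apply: stair_nc.
move=> M h; apply: (stair_generates p_gt0 q_gt0 hc) => i j hij.
by apply: h; rewrite stair_arcsP.
Qed.

Lemma stair_multfree : multfree_bundle (D stair_arcs).
Proof.
exists stair_arcs; split; first exact: qiso_refl.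
move=> i j /(qiso_line p_gt0 q_gt0); rewrite !(tnth_nth 0) /= => /eqP.
by rewrite nth_uniq ?undup_uniq // => /eqP /val_inj.
Qed.

Definition stair_bundle : tilting_bundle k p q :=
  TiltingBundle stair_tilting stair_multfree.

Lemma stair_bundleP i j : has_arc stair_bundle i j <-> stair q c i j.
Proof.
rewrite -stair_arcsP; apply: has_arcP => //; exact: qiso_refl.
Qed.

End StaircaseBundle.

(** * The staircase of a tilting bundle *)

Section TiltingBundles.
Variables (k : fieldType) (p q : nat).
Hypotheses (p_gt0 : (0 < p)%N) (q_gt0 : (0 < q)%N).
Local Notation L := (LL p q).
Local Notation arc := (arc p q).
Local Notation D := (dsum_lines k).
Implicit Types T : tilting_bundle k p q.

Lemma tilting_bundle_lines T : exists2 s : seq L, uniq s & qiso T (D s).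
Proof.
have [s [e h]] := tb_multfree_bundle T; exists s => //.
apply/(uniqP 0) => i j; rewrite !inE => hi hj eij.
have := h (Ordinal hi) (Ordinal hj); rewrite !(tnth_nth 0) /= eij.
by move=> /(_ (qiso_refl p_gt0 q_gt0 _)) [].
Qed.

Lemma tilting_stair T : exists c : Lambda p q,
  forall i j, has_arc T i j <-> stair q (val c) i j.
Proof.
have [s us e] := tilting_bundle_lines T.
have ts : tilting (D s) := tilting_iso p_gt0 q_gt0 e (tb_tilting T).
have [|||||c [hc h]] := @stair_reconstruct p q p_gt0 q_gt0 (fun i j =>
  arc i j \in s).
- move=> i j t; congr (_ \in s); apply/(arc_eqP p_gt0 q_gt0); exists t; lia.
- by move=> i j i' j' h1 h2 h3; apply: (tilting_noncrossing p_gt0 q_gt0 ts h1 h2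
  h3).
- exact: (tilting_column p_gt0 q_gt0 ts).
- exact: (tilting_row p_gt0 q_gt0 ts).
- exact: (tilting_test p_gt0 q_gt0 ts).
exists (exist _ c hc) => i j.
by apply: (iff_trans (has_arcP p_gt0 q_gt0 i j e)); rewrite h.
Qed.

Lemma qiso_arcs T T' : (forall i j, has_arc T i j <-> has_arc T' i j) ->
  qiso T T'.
Proof.
move=> h; have [s us e] := tilting_bundle_lines T;
  have [s' us' e'] := tilting_bundle_lines T'.
apply: (qiso_trans p_gt0 q_gt0 e).
apply: (qiso_trans p_gt0 q_gt0 _ (qiso_sym e')); apply: qiso_perm => //.
apply: uniq_perm => // x; have [i [j ->]] := arc_surj x.
have h1 := has_arcP p_gt0 q_gt0 i j e; have h2 := has_arcP p_gt0 q_gt0 i j e'.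
have h3 := h i j.
by apply/idP/idP => [/h1/h3/h2|/h2/h3/h1].
Qed.

(** [differ_by_one] does not ask its lists to be duplicate free. Any list for T contains the members
    of a duplicate free one by [summandP] and is at most as long by [qiso_size]. *)
Lemma tilting_bundle_uniq T s : qiso T (D s) -> uniq s.
Proof.
move=> e; have [t ut e'] := tilting_bundle_lines T.
have st : qiso (D s) (D t) by apply: (qiso_trans p_gt0 q_gt0 (qiso_sym e) e').
apply: (leq_size_uniq ut _ (qiso_size p_gt0 q_gt0 st)) => x xt.
apply/(summandP k p_gt0 q_gt0); apply: (is_summand_iso p_gt0 q_gt0 (qiso_sym
  st)).
exact/summandP.
Qed.

End TiltingBundles.

(** * Flips *)

Section Flips.
Variables p q : nat.
Hypotheses (p_gt0 : (0 < p)%N) (q_gt0 : (0 < q)%N).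
Local Notation arc := (arc p q).
Implicit Types c d : p.-tuple int.

Lemma dist_one c d : \sum_(i < p) `|tnth c i - tnth d i| = 1 <->
  exists r : 'I_p, (cx q d r%:Z = cx q c r%:Z + 1 \/ cx q d r%:Z = cx q c r%:Z -
    1) /\
    forall i : 'I_p, i != r -> cx q d i%:Z = cx q c i%:Z.
Proof.
split=> [h|[r [hr hn]]].
  have [r hr] : exists r, `|tnth c r - tnth d r| != 0.
    apply: NNPP => H; move: h; rewrite big1 // => i _.
    by apply/eqP/negbNE/negP => hi; apply: H; exists i.
  exists r; move: h; rewrite (bigD1 r) //= => h.
  have ge0 : 0 <= \sum_(i < p | i != r) `|tnth c i - tnth d i| by apply:
    sumr_ge0.
  have s0 : \sum_(i < p | i != r) `|tnth c i - tnth d i| = 0.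
    move: ge0 h; move: (\sum_(i < p | _) _) => z ge0 h.
    have := normr_ge0 (tnth c r - tnth d r).
    by move: hr h; move: (`|tnth c r - tnth d r|) => y; lia.
  rewrite s0 addr0 in h; split.
    by rewrite !cx_ord //; move: h; move: (tnth c r) (tnth d r) => x y; lia.
  move=> i ir; rewrite !cx_ord //.
  have := psumr_eq0P (P := fun i => i != r) (fun i _ => normr_ge0 _) s0 ir.
  by move/eqP; rewrite normr_eq0 subr_eq0 => /eqP.
rewrite (bigD1 r) //= big1 ?addr0; last first.
  by move=> i /hn; rewrite !cx_ord // => ->; rewrite subrr normr0.
by move: hr; rewrite !cx_ord //; move: (tnth c r) (tnth d r) => x y; lia.
Qed.

Lemma residue_inj (r r' : 'I_p) (t t' : int) :
  r%:Z + t * p%:Z = r'%:Z + t' * p%:Z -> r = r'.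
Proof.
move=> h; apply: val_inj => /=; have lt := ltn_ord r; have lt' := ltn_ord r'.
have [e|[le|le]] : t = t' \/ (t + 1 <= t' \/ t' + 1 <= t) by lia.
- by move: h; rewrite e; lia.
- by have : (t + 1) * p%:Z <= t' * p%:Z by [nia]; lia.
- by have : (t' + 1) * p%:Z <= t * p%:Z by [nia]; lia.
Qed.

Lemma flip_cx c d (r : 'I_p) : cx q d r%:Z = cx q c r%:Z + 1 ->
  (forall i : 'I_p, i != r -> cx q d i%:Z = cx q c i%:Z) ->
  forall i : int, (exists t, i = r%:Z + t * p%:Z) /\ cx q d i = cx q c i + 1 \/
    (forall t, i <> r%:Z + t * p%:Z) /\ cx q d i = cx q c i.
Proof.
move=> hr hn i; have [r0 [t ->]] := int_residue p_gt0 q_gt0 i.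
have [e|ne] := eqVneq r0 r.
  by left; rewrite e; split; [exists t | rewrite !cx_shift // hr addrAC].
right; split; last by rewrite !cx_shift // hn.
by move=> t' h; move/eqP: ne; apply; apply: residue_inj h.
Qed.

(** Raising c_r takes the bottom point c_r from column r + 1 and puts c_r + 1 on top of column r.
    For p = 1 both happen to every column, which is the first of the four cases on i - 1 and i
    modulo p. *)
Lemma flip_stair c d (r : 'I_p) : Lambda_vertex q c ->
  cx q d r%:Z = cx q c r%:Z + 1 ->
  (forall i : 'I_p, i != r -> cx q d i%:Z = cx q c i%:Z) ->
  forall i j, stair q d i j <->
    stair q c i j /\ arc i j <> arc (r%:Z + 1) (cx q c r%:Z) \/
    arc i j = arc r%:Z (cx q c r%:Z + 1).
Proof.
move=> hc hr hn i j.
have A1 : arc i j = arc (r%:Z + 1) (cx q c r%:Z) <->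
    (exists t, i - 1 = r%:Z + t * p%:Z) /\ j = cx q c (i - 1).
  apply: (iff_trans (arc_eqP p_gt0 q_gt0 _ _ _ _));
    split=> [[t [h1 h2]]|[[t ht] h2]].
    have e : i - 1 = r%:Z + t * p%:Z by lia.
    by split; [exists t | rewrite e cx_shift].
  by exists t; split; [lia | rewrite h2 ht cx_shift].
have A2 : arc i j = arc r%:Z (cx q c r%:Z + 1) <->
    (exists t, i = r%:Z + t * p%:Z) /\ j = cx q c i + 1.
  apply: (iff_trans (arc_eqP p_gt0 q_gt0 _ _ _ _));
    split=> [[t [h1 h2]]|[[t ht] h2]].
    by split; [exists t | rewrite h1 cx_shift // h2 addrAC].
  by exists t; split; [|rewrite h2 ht cx_shift // addrAC].
have F := flip_cx hr hn.
have le := cx_step p_gt0 q_gt0 (i - 1) hc; rewrite subrK in le.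
rewrite /stair; apply: (iff_trans (B := (cx q c (i - 1) <= j <= cx q c i) /\
   ~ ((exists t, i - 1 = r%:Z + t * p%:Z) /\ j = cx q c (i - 1)) \/
   ((exists t, i = r%:Z + t * p%:Z) /\ j = cx q c i + 1))); last first.
  by split=> -[[h1 h2]|h]; [left; split=> // /A1 | right; apply/A2 | left;
    split=> // /A1 | right; apply/A2].
move: (cx q c (i - 1)) (cx q c i) le (F (i - 1)) (F i) => C1 C2 le F1 F2.
case: F1 => -[P1 ->]; case: F2 => -[P2 ->]; split.
- move=> /andP [h1 h2]; have [e|ne] := eqVneq j (C2 + 1); first by right.
  left; split; first by apply/andP; lia.
  by move=> [_ e]; lia.
- move=> [[/andP [h1 h2] h3]|[_ e]]; last by apply/andP; lia.
  have ne : j <> C1 by move=> e; apply: h3.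
  by apply/andP; lia.
- move=> /andP [h1 h2]; left; split; first by apply/andP; lia.
  by move=> [_ e]; lia.
- move=> [[/andP [h1 h2] h3]|[[t e] _]]; last by case: (P2 t).
  have ne : j <> C1 by move=> e; apply: h3.
  by apply/andP; lia.
- move=> /andP [h1 h2]; have [e|ne] := eqVneq j (C2 + 1); first by right.
  left; split; first by apply/andP; lia.
  by move=> [[t e] _]; case: (P1 t).
- by move=> [[/andP [h1 h2] h3]|[_ e]]; apply/andP; lia.
- move=> h; left; split=> //.
  by move=> [[t e] _]; case: (P1 t).
- by move=> [[h1 _]|[[t e] _]] //; case: (P2 t).
Qed.

(** A column [C0, C1] loses b and becomes part of [D0, D1]. All its other points stay, so b is an
    end; it is not both ends, since the two one-sided hypotheses, which come from the neighbouring
    columns, would then force D0 = D1 = b. *)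
Lemma exchange_cases (b C0 C1 D0 D1 : int) : C0 <= b <= C1 -> D0 <= D1 ->
  (b = C0 -> b <= D0) -> (b = C1 -> D1 <= b) ->
  (forall j, C0 <= j <= C1 -> j <> b -> D0 <= j <= D1) -> ~~ (D0 <= b <= D1) ->
  [/\ b = C0, b < C1 & D0 = b + 1] \/ [/\ C0 < b, b = C1 & D1 = b - 1].
Proof.
move=> /andP [l1 l2] le h0 h1 hj nb.
have {hj}H j : C0 <= j -> j <= C1 -> j <> b -> D0 <= j /\ j <= D1.
  by move=> m1 m2 m3; apply/andP; apply: hj => //; rewrite m1.
have {}nb : ~ (D0 <= b /\ b <= D1) by move=> /andP; apply/negP.
have [e0|n0] := eqVneq b C0; have [e1|n1] := eqVneq b C1.
- by case: nb; have := h0 e0; have := h1 e1; clear H; lia.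
- have [m1 m2] : D0 <= b + 1 /\ b + 1 <= D1 by apply: H; lia.
  by left; have := h0 e0; clear H h0 h1; split; lia.
- have [m1 m2] : D0 <= b - 1 /\ b - 1 <= D1 by apply: H; lia.
  by right; have := h1 e1; clear H h0 h1; split; lia.
have [m1 m2] : D0 <= C0 /\ C0 <= D1 by apply: H; lia.
have [m3 m4] : D0 <= C1 /\ C1 <= D1 by apply: H; lia.
by case: nb; clear H h0 h1; lia.
Qed.

(** Only the orbit of (a, b) may be lost. By [exchange_cases] b is an end of column a, so step a - 1
    rises or step a drops by 1; the steps outside that orbit have both ends preserved. *)
Lemma stair_exchange c d a b : Lambda_vertex q c -> Lambda_vertex q d ->
  stair q c a b -> ~~ stair q d a b ->
  (forall i j, stair q c i j -> arc i j <> arc a b -> stair q d i j) ->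
  \sum_(i < p) `|tnth c i - tnth d i| = 1.
Proof.
move=> hc hd cab dab H.
have {}H i j : stair q c i j -> (forall t, i = a + t * p%:Z ->
  j <> b + t * q%:Z) -> stair q d i j.
  move=> h1 h2; apply: H => // /(arc_eqP p_gt0 q_gt0) [t [e1 e2]].
  exact: h2 e1 e2.
have [ha1 ha2] := andP (stair_cx p_gt0 q_gt0 a hc).
have [hb1 hb2] := andP (stair_cx p_gt0 q_gt0 (a - 1) hc); rewrite subrK in hb2.
have ne0 t : a = a + t * p%:Z -> t = 0 by nia.
have dle := cx_step p_gt0 q_gt0 (a - 1) hd; rewrite subrK in dle.
have Hl (j : int) : stair q c a j -> j <> b -> stair q d a j.
  by move=> h ne; apply: H => // t /ne0 ->; lia.
have mul0 (t : int) : b = b + t * q%:Z -> t = 0.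
  move/eqP; rewrite -{1}[b]addr0 (inj_eq (addrI b)) eq_sym mulf_eq0 =>
    /orP [/eqP //|].
  by rewrite eqz_nat -leqn0 leqNgt q_gt0.
have Hm : stair q c (a - 1) b -> stair q d (a - 1) b.
  by move=> h; apply: H => // t e1 /mul0 t0; move: e1; rewrite t0; clear; lia.
have Hp : stair q c (a + 1) b -> stair q d (a + 1) b.
  by move=> h; apply: H => // t e1 /mul0 t0; move: e1; rewrite t0; clear; lia.
suff [r [hr hn]] : exists r : int, (cx q d r = cx q c r + 1 \/ cx q d r = cx q c
  r - 1) /\
    forall i, (forall t, i <> r + t * p%:Z) -> cx q d i = cx q c i.
  have [r0 [t e]] := int_residue p_gt0 q_gt0 r.
  apply/dist_one; exists r0; split.
    by move: hr; rewrite e !cx_shift // -!addrA ![t * _ + _]addrC !addrA =>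
      -[/addIr|/addIr]; [left | right].
  move=> i ne; apply: hn => t' e'; move/eqP: ne; apply.
  by apply: (@residue_inj _ _ 0 (t + t')); rewrite e' e mul0r addr0 mulrDl
    addrA.
(* A horizontal step is recognized by its two end points ([stair_step]), so it survives in d if they
   do. *)
have others r : (forall i, (forall t, i <> r + t * p%:Z) ->
    (forall t, i = a + t * p%:Z -> cx q c i <> b + t * q%:Z) /\
    (forall t, i + 1 = a + t * p%:Z -> cx q c i <> b + t * q%:Z)) ->
  forall i, (forall t, i <> r + t * p%:Z) -> cx q d i = cx q c i.
  move=> h i /h [n1 n2]; have [h1 h2] := andP (stair_cx p_gt0 q_gt0 i hc).
  by apply/esym/(stair_step p_gt0 q_gt0 hd); apply: H.
have Hm' : b = cx q c (a - 1) -> b <= cx q d (a - 1).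
  by move=> e; rewrite -e in hb1; case/andP: (Hm hb1).
have Hp' : b = cx q c a -> cx q d a <= b.
  by move=> e; rewrite -e in ha2; case/andP: (Hp ha2); rewrite addrK.
have [[e1 lt e2]|[lt e1 e2]] := exchange_cases cab dle Hm' Hp' Hl dab.
  exists (a - 1); split; first by left; rewrite -e1.
  apply: others => i hi; split=> t e; last by case: (hi t); clear -e; lia.
  by rewrite e cx_shift // => /addIr e3; move: lt; rewrite -e3 ltxx.
exists a; split; first by right; rewrite -e1.
apply: others => i hi; split=> t e; first by case: (hi t).
have -> : i = a - 1 + t * p%:Z by clear -e; lia.
by rewrite cx_shift // => /addIr e3; move: lt; rewrite -e3 ltxx.
Qed.

End Flips.

(** * Edges of the tilting graph in coordinates *)

Section Edges.
Variables (k : fieldType) (p q : nat).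
Hypotheses (p_gt0 : (0 < p)%N) (q_gt0 : (0 < q)%N).
Local Notation L := (LL p q).
Local Notation arc := (arc p q).
Local Notation D := (dsum_lines k).
Implicit Types T : tilting_bundle k p q.

Lemma differ_by_one_sym T T' : differ_by_one T T' -> differ_by_one T' T.
Proof.
move=> [s [x [x' [h1 h2 h3]]]]; exists s, x', x; split=> // h; apply: h1.
exact: qiso_sym.
Qed.

Lemma edge_flip T T' (c d : p.-tuple int) :
  Lambda_vertex q c ->
  (forall i j, has_arc T i j <-> stair q c i j) ->
  (forall i j, has_arc T' i j <-> stair q d i j) ->
  forall r : 'I_p, cx q d r%:Z = cx q c r%:Z + 1 ->
  (forall i : 'I_p, i != r -> cx q d i%:Z = cx q c i%:Z) -> differ_by_one T T'.
Proof.
move=> hc hT hT' r hr hn; have F := flip_stair p_gt0 q_gt0 hc hr hn.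
have [s us e] := tilting_bundle_lines p_gt0 q_gt0 T.
have [s' us' e'] := tilting_bundle_lines p_gt0 q_gt0 T'.
have S i j : arc i j \in s <-> stair q c i j.
  by apply: (iff_trans (iff_sym (has_arcP p_gt0 q_gt0 i j e))).
have S' i j : arc i j \in s' <-> stair q d i j.
  by apply: (iff_trans (iff_sym (has_arcP p_gt0 q_gt0 i j e'))).
pose x := arc (r%:Z + 1) (cx q c r%:Z); pose x' := arc r%:Z (cx q c r%:Z + 1).
have xs : x \in s by apply/S; case/andP: (stair_cx p_gt0 q_gt0 r%:Z hc).
have x's : x' \notin s by apply/negP => /S /andP [_]; lia.
exists (rem x s), x, x'; split.
- by move=> /(qiso_line p_gt0 q_gt0) ex; move: x's; rewrite -ex xs.
- by apply: (qiso_trans p_gt0 q_gt0 e); apply: qiso_perm => //;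
  apply: perm_to_rem.
apply: (qiso_trans p_gt0 q_gt0 e'); apply: qiso_perm => //.
apply: uniq_perm => //.
  rewrite /= rem_uniq // andbT; apply: contra x's; exact: mem_rem.
move=> z; have [i [j ->]] := arc_surj z; rewrite inE mem_rem_uniq // !inE.
apply/idP/idP => [/S'/F [[h1 h2]|->]|/orP [/eqP h|/andP [/eqP h1 h2]]].
- by apply/orP; right; apply/andP; split; [apply/eqP | apply/S].
- by rewrite eqxx.
- by apply/S'/F; right.
- by apply/S'/F; left; split=> //; apply/S.
Qed.

Lemma edge_dist T T' (c d : p.-tuple int) :
  Lambda_vertex q c -> Lambda_vertex q d ->
  (forall i j, has_arc T i j <-> stair q c i j) ->
  (forall i j, has_arc T' i j <-> stair q d i j) ->
  differ_by_one T T' <-> \sum_(i < p) `|tnth c i - tnth d i| = 1.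
Proof.
move=> hc hd hT hT'; split; last first.
  (* [edge_flip] treats the raising of an entry; lowering is the same with T and T' exchanged. *)
  move=> /(dist_one p_gt0 q_gt0) [r [[hr|hr] hn]].
    exact: (edge_flip hc hT hT' hr hn).
  apply: differ_by_one_sym; apply: (edge_flip hd hT' hT (r := r)).
    by rewrite hr subrK.
  by move=> i /hn.
move=> [s [x [x' [ne e e']]]].
have u := tilting_bundle_uniq p_gt0 q_gt0 e; have u' := tilting_bundle_uniq
  p_gt0 q_gt0 e'.
have S i j : arc i j \in x :: s <-> stair q c i j.
  by apply: (iff_trans (iff_sym (has_arcP p_gt0 q_gt0 i j e))).
have S' i j : arc i j \in x' :: s <-> stair q d i j.
  by apply: (iff_trans (iff_sym (has_arcP p_gt0 q_gt0 i j e'))).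
have [a [b ex]] := arc_surj x.
have nx : x <> x' by move=> exx; apply: ne; rewrite exx; apply: qiso_refl.
apply: (@stair_exchange p q p_gt0 q_gt0 c d a b hc hd).
- by apply/S; rewrite -ex mem_head.
- apply/negP => /S'; rewrite -ex inE => /orP [/eqP //|xs].
  by move: u; rewrite /= xs.
move=> i j /S; rewrite inE -ex => /orP [/eqP //|h _].
by apply/S'; rewrite inE h orbT.
Qed.

End Edges.

(** * Triangles over the upper boundary of the strip *)

Section Triangles.
Variables (k : fieldType) (p q : nat).
Hypotheses (p_gt0 : (0 < p)%N) (q_gt0 : (0 < q)%N).
Variable T : coh k p q.

Lemma top_inj : injective (top p).
Proof.
move=> i j [/(mulIf _) h]; apply: (@intr_inj rat); apply: h.
by rewrite invr_eq0 pnatr_eq0 -lt0n.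
Qed.

Lemma bot_inj : injective (bot q).
Proof.
move=> i j [/(mulIf _) h]; apply: (@intr_inj rat); apply: h.
by rewrite invr_eq0 pnatr_eq0 -lt0n.
Qed.

Lemma top_neq_bot i j : top p i <> bot q j.
Proof. by case. Qed.

Lemma joined_top i R : joined T (top p i) R ->
  [\/ R = top p (i + 1), R = top p (i - 1) | exists2 j,
    R = bot q j & has_arc T i j].
Proof.
case.
  case=> [[i' [h ->]]|[j [h _]]|[i' [j [_ h _]]]].
  - by move/top_inj: h => ->; apply: Or31; rewrite subrK.
  - by case: (top_neq_bot h).
  - by case: (top_neq_bot h).
case=> [[i' [-> h]]|[j [_ h]]|[i' [j [ha -> h]]]].
- by move/top_inj: h => ->; apply: Or32.
- by case: (top_neq_bot h).
- by move/top_inj: h => ->; apply: Or33; exists j.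
Qed.

(** A third vertex on the upper boundary would be a neighbour of both i and i + 1 there, and no
    point is; so it lies at the bottom and the two other sides are arcs. *)
Lemma triangle_top i R : triangle T (top p i) (top p (i + 1)) R <->
  exists2 j, R = bot q j & has_arc T i j /\ has_arc T (i + 1) j.
Proof.
split=> [[_ /joined_top h1 /joined_top h2]|[j -> [h1 h2]]].
  case: h1 => [e|e|[j e h1]]; rewrite e in h2.
  - by case: h2 => [/top_inj|/top_inj|[j' /top_neq_bot //]]; lia.
  - by case: h2 => [/top_inj|/top_inj|[j' /top_neq_bot //]]; lia.
  case: h2 => [/esym/top_neq_bot //|/esym/top_neq_bot //|[j' /bot_inj ej h2]].
  by exists j => //; split=> //; rewrite ej.
split; first by left; apply: Or31; exists (i + 1); rewrite addrK.
  by right; apply: Or33; exists (i + 1), j.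
by right; apply: Or33; exists i, j.
Qed.

End Triangles.

Theorem theorem1p2 (k : closedFieldType) (p q : nat)
    (p_ge1 : (1 <= p)%N) (le_pq : (p <= q)%N) :
  exists phi : tilting_graph k p q -> Lambda p q,
    is_phi phi /\ graph_iso phi.
Proof.
have q_ge1 : (0 < q)%N := leq_trans p_ge1 le_pq.
(* The staircase is picked by choice; [stair_inj] shows that it is determined by T. *)
pose phi (T : tilting_graph k p q) : Lambda p q :=
  proj1_sig (constructive_indefinite_description _
    (tilting_stair p_ge1 q_ge1 T)).
have hphi (T : tilting_bundle k p q) i j :
    has_arc T i j <-> stair q (val (phi T)) i j.
  exact: (proj2_sig (constructive_indefinite_description _
    (tilting_stair p_ge1 q_ge1 T)) i j).
have vphi T : Lambda_vertex q (val (phi T)) by exact: valP.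
exists phi; split.
  move=> T i R; apply: (iff_trans (triangle_top p_ge1 q_ge1 T _ _)).
  (* The third vertex sits at the only height common to columns i and i + 1, that of the horizontal
     step between them. *)
  rewrite -(cx_ord q); split=> [[j -> [/hphi h1 /hphi h2]]|->].
    by rewrite (stair_step p_ge1 q_ge1 (vphi T) h1 h2).
  exists (cx q (val (phi T)) i%:Z) => //.
  have /andP [h1 h2] := stair_cx p_ge1 q_ge1 i%:Z (vphi T).
  by split; apply/hphi.
split.
- move=> T T' /=; split=> [e|e]; last first.
    by apply: qiso_arcs => // i j; rewrite !hphi e.
  apply: val_inj; apply: (stair_inj p_ge1 q_ge1 (vphi T) (vphi T')) => i j.
  apply/idP/idP => /hphi h; apply/hphi.
    exact: (is_summand_iso p_ge1 q_ge1 e h).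
  exact: (is_summand_iso p_ge1 q_ge1 (qiso_sym e) h).
- move=> [c hc]; exists (stair_bundle k p_ge1 q_ge1 hc) => /=.
  apply: val_inj => /=.
  apply: (stair_inj p_ge1 q_ge1 (vphi _) hc) => i j.
  by apply/idP/idP => [/hphi/stair_bundleP|/stair_bundleP h]; last apply/hphi.
move=> T T'.
exact: (edge_dist p_ge1 q_ge1 (vphi T) (vphi T') (hphi T) (hphi T')).
Qed.
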